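(* Let $n\ge 3$, let $q_*=\frac{2n}{n-2}$, and let $2<q\le q_*$. Set $\alpha=\frac{q}{q-2}$ and \[ C_q=\left[\frac{2\pi^{n/2}}{\Gamma(n/2)}\right]^{1/\alpha}\left(\frac{q}{2}\right)^{2/q}\left[\frac{\Gamma(\alpha)\Gamma(\alpha+1)}{\Gamma(2\alpha)}\right]^{1/\alpha}. \] Then for every Schwartz function $f\in\mathcal S(\mathbb R^n)$, \[ \int_{\mathbb R^n}|\nabla f|^2\,dx\;\ge\;\frac{(n-1)(n-3)}{4}\int_{\mathbb R^n}\frac{1}{|x|^2}|f|^2\,dx\;+\;C_q\left[\int_{\mathbb R^n}|x|^{-n(q_*-q)/q_*}|f|^q\,dx\right]^{2/q}. \] *)

(* Defs.v *)
From HB Require Import structures.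
From mathcomp Require Import all_boot all_order all_algebra.
From mathcomp Require Import all_classical all_reals all_analysis.
Set Implicit Arguments. Unset Strict Implicit. Unset Printing Implicit Defensive.
Import Order.TTheory GRing.Theory Num.Theory.
Import numFieldNormedType.Exports.
Local Open Scope classical_set_scope.
Local Open Scope ring_scope.

Section Defs.
Variable R : realType.

Definition enorm n (x : 'rV[R]_n) : R := Num.sqrt (\sum_(i < n) x ord0 i ^+ 2).

Definition evec n (i : 'I_n) : 'rV[R]_n := delta_mx ord0 i.
Definition dpart1 n (i : 'I_n) (f : 'rV[R]_n -> R) : 'rV[R]_n -> R :=
  fun x => derive f x (evec i).

Fixpoint dpart n (s : seq 'I_n) (f : 'rV[R]_n -> R) : 'rV[R]_n -> R :=
  match s with
  | [::] => f
  | i :: s' => dpart1 i (dpart s' f)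
  end.

Definition schwartz n (f : 'rV[R]_n -> R) : Prop :=
  (forall (s : seq 'I_n) (x : 'rV[R]_n), differentiable (dpart s f) x) /\
  (forall (s : seq 'I_n) (k : nat), exists C : R,
      forall x, (1 + enorm x) ^+ k * `|dpart s f x| <= C).

Definition rcons0 n (t : R) (v : 'rV[R]_n) : 'rV[R]_n.+1 :=
  \row_(j < n.+1) match unlift ord0 j with Some k => v ord0 k | None => t end.

(* Lebesgue integral over R^n of a nonnegative function, computed as the
   iterated integral over the coordinates (equal to the integral against
   n-dimensional Lebesgue measure for nonnegative measurable integrands,
   by Tonelli). *)
Fixpoint intRn (n : nat) : ('rV[R]_n -> \bar R) -> \bar R :=
  match n with
  | 0 => fun g => g 0
  | n'.+1 => fun g =>
      (\int[@lebesgue_measure R]_(t in [set: R]) intRn (fun v => g (rcons0 t v)))%E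
  end.

Definition Gamma (s : R) : R :=
  fine (\int[@lebesgue_measure R]_(t in `]0%R, +oo[%classic)
          ((t `^ (s - 1)) * expR (- t))%:E)%E.

End Defs.

(* Main.v *)
Require Import Defs.
From HB Require Import structures.
From mathcomp Require Import all_boot all_order all_algebra.
From mathcomp Require Import all_classical all_reals all_analysis.
From mathcomp Require Import measurable_realfun.
From mathcomp Require Import ring lra.
Import Order.TTheory GRing.Theory Num.Theory.
Import numFieldNormedType.Exports.
Set Implicit Arguments. Unset Strict Implicit. Unset Printing Implicit Defensive.
Local Open Scope classical_set_scope.
Local Open Scope ring_scope.

(** Write [h = |f|], [c = (N - 2) / 2] and let [G r] be the decreasing rearrangement of [h]:
    the ball of radius [r] has the volume of [{G r < h}].  Brunn-Minkowski, applied to the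
    level sets of [h] and small balls, bounds the perimeter of the level sets from below, and
    Cauchy-Schwarz on the slab [{G (lam r) < h < G r}] bounds the energy there by
    [(G r - G (lam r))^2].  On the lattice [r_i = r_0 lam^i] the numbers
    [w_i = r_i^c (G r_i)] then satisfy a discrete Emden-Fowler estimate: up to errors that
    vanish as [lam -> 1], the energy is at least the sphere area times
    [sum (w_(i+1) - w_i)^2 / tau + c^2 tau w_i^2], while the two weighted integrals are at
    most the sphere area times [sum tau w_i^2] and [sum tau w_i^q].  Since
    [(N - 1)(N - 3) / 4 = c^2 - 1/4], what is left is the one-dimensional inequality for
    [w'^2 + w^2 / 4].  If [w] has maximum [1] and [p = q - 2], then
    [w'^2 + w^2 (1 - w^p) / 4 >= |w w'| sqrt (1 - w^p)] is twice the absolute derivative of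
    [Psi (w^2)], where [Psi' y = sqrt (1 - y^(p/2)) / 4]; rising to the maximum and
    descending again contributes [4 Psi 1], and scaling gives the sharp constant, because
    [Psi 1] is a Beta integral. *)

(** * Lebesgue measure on row vectors *)

(** Only finitely many radii are compared at a time, so everything reduces to volumes of level sets
    and integrals over slabs, whether or not [G] has jumps or plateaus. Both weights fit one
    sequence because each weight exponent [b] and power [p] satisfy [b + p c = N]: the weight
    integrated over a ball of radius [r] scales like [r^(p c)], and [r^(p c) (G r)^p] is [w^p]. For
    the power [q] this says [c = N / qs], with [qs] the critical exponent. The Hardy integral enters
    through an upper bound, which is legitimate because its coefficient [c^2 - 1/4] is nonnegative
    as soon as [N >= 3]. The modulus is not smooth at the zeros of [f]: its second-order error on
    [{d <= h}] is of size [1 / d], so a slab is first lifted above a positive level, and the width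
    of the neighbourhoods is chosen after that level. The limits come in a fixed order: for given
    [lam] the lattice is extended both ways until [w_0] is negligible, then [lam] tends to [1], and
    last the truncations of [h] near [0] and near its supremum are removed. *)

Section measurable_rV.
Context {R : realType} (n : nat).

(** With coordinate preimages as generators, measurability of a map into row vectors is checked
    coordinatewise; [open_measurable_rV] shows that the open sets belong to the generated
    sigma-algebra. *)
Definition coord_cylinders : set (set 'rV[R]_n) :=
  [set A | exists i : 'I_n, exists2 B : set R, measurable B &
    A = [set x : 'rV[R]_n | B (x ord0 i)]].

Let rV_set0 : <<s coord_cylinders >> set0. Proof. exact: sigma_algebra0. Qed.
Let rV_setC A : <<s coord_cylinders >> A -> <<s coord_cylinders >> (~` A).
Proof. exact: sigma_algebraC. Qed.
Let rV_bigcup (F : _^nat) : (forall i, <<s coord_cylinders >> (F i)) ->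
  <<s coord_cylinders >> (\bigcup_i (F i)).
Proof. exact: sigma_algebra_bigcup. Qed.

HB.instance Definition _ := @isMeasurable.Build default_measure_display
  'rV[R]_n <<s coord_cylinders >> rV_set0 rV_setC rV_bigcup.

End measurable_rV.

Section rV_measurability.
Context {R : realType}.

Lemma measurable_coord n (i : 'I_n) :
  measurable_fun [set: 'rV[R]_n] (fun x : 'rV[R]_n => x ord0 i).
Proof.
move=> _ B mB; rewrite setTI; apply: sub_sigma_algebra => /=.
by exists i; exists B.
Qed.

Lemma measurable_rVP d (T : measurableType d) n (f : T -> 'rV[R]_n) :
  (forall i, measurable_fun [set: T] (fun x => f x ord0 i)) ->
  measurable_fun [set: T] f.
Proof.
move=> mf _ A mA; rewrite setTI.
have : <<s @coord_cylinders R n >> `<=` [set A | measurable (f @^-1` A)].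
  apply: smallest_sub.
    split=> /=.
    - by rewrite preimage_set0.
    - by move=> B mB; rewrite setTD preimage_setC; exact: measurableC.
    - by move=> F mF; rewrite preimage_bigcup; exact: bigcup_measurable.
  move=> _ [i [B mB ->]] /=.
  by have := mf i measurableT _ mB; rewrite setTI.
by apply.
Qed.

Definition rcons0p n (p : measurableTypeR R * 'rV[R]_n) : 'rV[R]_n.+1 := rcons0 p.1 p.2.

Lemma rcons0_ord0 n t (v : 'rV[R]_n) : rcons0 t v ord0 ord0 = t.
Proof. by rewrite mxE unlift_none. Qed.

Lemma rcons0_lift n t (v : 'rV[R]_n) i : rcons0 t v ord0 (lift ord0 i) = v ord0 i.
Proof. by rewrite mxE liftK. Qed.

Lemma measurable_rcons0p n : measurable_fun setT (@rcons0p n).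
Proof.
apply: measurable_rVP => i; rewrite /rcons0p.
case: (unliftP ord0 i) => [j|] ->.
  under eq_fun do rewrite rcons0_lift.
  apply: (@measurableT_comp _ _ _ _ _ _ (fun x : 'rV[R]_n => x ord0 j)) => //.
  exact: measurable_coord.
under eq_fun do rewrite rcons0_ord0.
exact: measurable_fst.
Qed.

Lemma measurable_rcons0 n t : measurable_fun setT (@rcons0 R n t).
Proof.
apply: measurable_rVP => i; case: (unliftP ord0 i) => [j|] ->.
  by under eq_fun do rewrite rcons0_lift; exact: measurable_coord.
by under eq_fun do rewrite rcons0_ord0; exact: measurable_cst.
Qed.

Definition rbehead n (x : 'rV[R]_n.+1) : 'rV[R]_n := \row_i x ord0 (lift ord0 i).

Lemma rcons0_eta n (x : 'rV[R]_n.+1) : rcons0 (x ord0 ord0) (rbehead x) = x.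
Proof.
apply/rowP => i; case: (unliftP ord0 i) => [j|] ->.
  by rewrite rcons0_lift mxE.
by rewrite rcons0_ord0.
Qed.

Lemma rbehead_rcons0 n t (v : 'rV[R]_n) : rbehead (rcons0 t v) = v.
Proof. by apply/rowP => i; rewrite mxE rcons0_lift. Qed.

Lemma rcons0_affine n (c t s : R) (v w : 'rV[R]_n) :
  c *: rcons0 t v + rcons0 s w = rcons0 (c * t + s) (c *: v + w).
Proof.
apply/rowP => i; rewrite 2!mxE; case: (unliftP ord0 i) => [j|] ->.
  by rewrite !rcons0_lift !mxE.
by rewrite !rcons0_ord0.
Qed.

Lemma rcons0D n (t s : R) (v w : 'rV[R]_n) :
  rcons0 t v + rcons0 s w = rcons0 (t + s) (v + w).
Proof. by have := rcons0_affine 1 t s v w; rewrite !scale1r mul1r. Qed.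

Lemma sum_rcons0 n t (v : 'rV[R]_n) (F : R -> R) :
  \sum_(i < n.+1) F (rcons0 t v ord0 i) = F t + \sum_(i < n) F (v ord0 i).
Proof.
rewrite big_ord_recl rcons0_ord0; congr (_ + _).
by apply: eq_bigr => i _; rewrite rcons0_lift.
Qed.

Lemma measurable_rbehead n : measurable_fun setT (@rbehead n).
Proof.
apply: measurable_rVP => i; under eq_fun do rewrite mxE.
exact: measurable_coord.
Qed.

Lemma measurable_rV_affine n (c : R) (d : 'rV[R]_n) :
  measurable_fun setT (fun x : 'rV[R]_n => c *: x + d).
Proof.
apply: measurable_rVP => i; under eq_fun do rewrite !mxE.
apply: measurable_funD => //; apply: measurable_funM => //.
exact: measurable_coord.
Qed.

Section volume_step.
Variables (n : nat) (m : {sigma_finite_measure set 'rV[R]_n -> \bar R}).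

(** Adding one coordinate in front follows the recursion of [intRn], so that Tonelli identifies the
    two at each dimension. *)
Definition volS (A : set 'rV[R]_n.+1) : \bar R :=
  pushforward (@lebesgue_measure R \x m)%E (@rcons0p n) A.

HB.instance Definition _ := Measure.copy volS
  (measure_function_pushforward__canonical__measure_function_Measure
    (@lebesgue_measure R \x m)%E (@measurable_rcons0p n)).

(** Sigma-finiteness travels along the recursion because Tonelli on the next product asks for it. *)
Let volS_sigma_finite : sigma_finite setT volS.
Proof.
have /sigma_finiteP[F [TF ndF Foo]] := sigma_finiteT (@lebesgue_measure R).
have /sigma_finiteP[G [TG ndG Goo]] := sigma_finiteT m.
exists (fun k => [set x : 'rV[R]_n.+1 | F k (x ord0 ord0) /\ G k (rbehead x)]).
  apply/esym; rewrite -subTset => x _.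
  have : (\bigcup_i F i) (x ord0 ord0) by rewrite -TF.
  have : (\bigcup_i G i) (rbehead x) by rewrite -TG.
  move=> [k _ Gk] [l _ Fl]; exists (maxn k l) => //; split.
  - by move: Fl; exact/subsetPset/ndF/leq_maxr.
  - by move: Gk; exact/subsetPset/ndG/leq_maxl.
move=> k; have [mF Fk] := Foo k; have [mG Gk] := Goo k; split.
  apply: measurableI.
    by rewrite -[X in measurable X]setTI; exact: measurable_coord.
  by rewrite -[X in measurable X]setTI; exact: measurable_rbehead.
rewrite /volS /pushforward [X in (_ \x _)%E X](_ : _ = F k `*` G k).
  by rewrite product_measure1E// lte_mul_pinfty// ge0_fin_numE.
by apply/seteqP; split => -[t v]; rewrite /rcons0p /= rcons0_ord0 rbehead_rcons0.
Qed.

HB.instance Definition _ := Measure_isSigmaFinite.Build _ _ _ volS volS_sigma_finite.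

End volume_step.

Fixpoint vol n : {sigma_finite_measure set 'rV[R]_n -> \bar R} :=
  match n with
  | 0 => \d_(0 : 'rV[R]_0)
  | n'.+1 => volS (vol n')
  end.

Lemma ge0_integral_volS n (f : 'rV[R]_n.+1 -> \bar R) :
  measurable_fun setT f -> (forall x, 0 <= f x)%E ->
  (\int[vol n.+1]_x f x = \int[lebesgue_measure]_t \int[vol n]_v f (rcons0 t v))%E.
Proof.
move=> mf f0; have := @ge0_integral_pushforward _ _ _ _ R _ (@measurable_rcons0p n)
  (@lebesgue_measure R \x vol n)%E setT f measurableT mf (fun x _ => f0 x).
rewrite preimage_setT => ->.
rewrite fubini_tonelli1//.
  by apply: measurableT_comp => //; exact: measurable_rcons0p.
by move=> x; exact: f0.
Qed.

(** The bridge from the iterated integrals of the theorem to integration against a measure, where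
    monotone convergence and set operations are available. *)
Lemma intRnE n (f : 'rV[R]_n -> \bar R) :
  measurable_fun setT f -> (forall x, 0 <= f x)%E ->
  intRn f = (\int[vol n]_x f x)%E.
Proof.
elim: n f => [|n IH] f mf f0.
  by rewrite /= integral_dirac// diracT mul1e.
rewrite ge0_integral_volS//=; apply: eq_integral => t _.
apply: IH => //.
by apply: (measurableT_comp mf); exact: measurable_rcons0.
Qed.

End rV_measurability.

(** * Affine changes of variable *)

Section affine_change_of_variable.
Context {R : realType}.
Local Notation mu := (@lebesgue_measure R).

Section affine_measure.
Variables (c : {posnum R}) (d : R).

Let aff (t : measurableTypeR R) : measurableTypeR R := c%:num * t + d.

Let measurable_aff : measurable_fun setT aff.
Proof. by apply: measurable_funD => //; apply: measurable_funM. Qed.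

Let push_aff : {measure set (measurableTypeR R) -> \bar R} :=
  measure_function_pushforward__canonical__measure_function_Measure
    mu measurable_aff.

(** Uniqueness of Lebesgue measure: the scaled pushforward gives half-open intervals their
    length. *)
Lemma lebesgue_measure_affine (A : set R) : measurable A ->
  mu A = mscale (c%:num)%:nng push_aff A.
Proof.
move=> mA; apply: lebesgue_measure_unique => //= _ [[a b]] _ <- /=.
rewrite /mscale /= /pushforward.
rewrite (_ : aff @^-1` _ = `](a - d) / c%:num, (b - d) / c%:num]%classic).
  rewrite !lebesgue_measure_itv/= !lte_fin ltr_pM2r ?invr_gt0// ltrD2r.
  case: ifPn => _; last by rewrite mule0.
  by rewrite -!EFinD -EFinM; congr EFin; rewrite -mulrBl mulrC divfK// opprD addrACA subrr addr0.
apply/seteqP; split => t; rewrite /aff /= !in_itv/= ltr_pdivrMr// ler_pdivlMr//.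
  by rewrite ltrBlDr lerBrDr mulrC.
by rewrite ltrBlDr lerBrDr mulrC.
Qed.

Lemma ge0_integral_affine (f : R -> \bar R) :
  measurable_fun setT f -> (forall t, 0 <= f t)%E ->
  (\int[mu]_t f t = (c%:num)%:E * \int[mu]_t f (c%:num * t + d)%R)%E.
Proof.
move=> mf f0.
rewrite (eq_measure_integral (mscale (c%:num)%:nng push_aff)); last first.
  by move=> A mA _; exact: lebesgue_measure_affine.
rewrite ge0_integral_mscale//; congr (_ * _)%E.
by rewrite (ge0_integral_pushforward measurable_aff)// preimage_setT.
Qed.

End affine_measure.

Lemma measurable_integral_slice n (f : 'rV[R]_n.+1 -> \bar R) :
  measurable_fun setT f -> (forall x, 0 <= f x)%E ->
  measurable_fun [set: measurableTypeR R]
    (fun t => \int[vol n]_v f (rcons0 t v))%E.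
Proof.
move=> mf f0; have := @measurable_fun_fubini_tonelli_F _ _ (measurableTypeR R)
  'rV[R]_n R (vol n) (f \o @rcons0p R n) (measurableT_comp mf (@measurable_rcons0p R n)).
by apply=> x; exact: f0.
Qed.

Lemma ge0_integral_vol_affine n (c : R) (d : 'rV[R]_n) (f : 'rV[R]_n -> \bar R) :
  0 < c -> measurable_fun setT f -> (forall x, 0 <= f x)%E ->
  (\int[vol n]_x f x = (c ^+ n)%:E * \int[vol n]_x f (c *: x + d)%R)%E.
Proof.
move=> c0; elim: n d f => [|n IH] d f mf f0.
  have g0 : c *: (0 : 'rV[R]_0) + d = 0 by apply/rowP => -[].
  rewrite expr0 mul1e /= integral_dirac// diracT mul1e.
  rewrite integral_dirac// ?diracT ?mul1e ?g0//.
  by apply: measurableT_comp => //; exact: measurable_rV_affine.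
rewrite !ge0_integral_volS//; last first.
  by apply: measurableT_comp => //; exact: measurable_rV_affine.
have mfa : measurable_fun setT (fun x : 'rV[R]_n.+1 => f (c *: x + d)).
  by apply: measurableT_comp => //; exact: measurable_rV_affine.
rewrite (@ge0_integral_affine (PosNum c0) (d ord0 ord0))//=; last 2 first.
- exact: measurable_integral_slice.
- by move=> t; exact: integral_ge0.
rewrite exprS EFinM -muleA; congr (_ * _)%E.
rewrite -ge0_integralZl//=; last 3 first.
- by apply: (measurable_integral_slice mfa) => x; exact: f0.
- by move=> t _; exact: integral_ge0.
- by rewrite lee_fin exprn_ge0// ltW.
apply: eq_integral => t _; rewrite (IH (rbehead d))//; last first.
  by apply: measurableT_comp => //; exact: measurable_rcons0.
congr (_ * _)%E; apply: eq_integral => v _.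
by rewrite -{3}(rcons0_eta d) rcons0_affine.
Qed.

Lemma vol_affine n (c : R) (d : 'rV[R]_n) (A : set 'rV[R]_n) :
  0 < c -> measurable A ->
  (vol n A = (c ^+ n)%:E * vol n [set x | A (c *: x + d)%R])%E.
Proof.
move=> c0 mA; have mB : measurable [set x | A (c *: x + d)].
  by rewrite -[X in measurable X]setTI; exact: measurable_rV_affine.
have E (B : set 'rV[R]_n) : measurable B -> (vol n B = \int[vol n]_x (\1_B x)%:E)%E.
  by move=> mB'; rewrite integral_indic// setIT.
rewrite !E// (@ge0_integral_vol_affine _ c d)//.
by apply/measurable_EFinP.
Qed.

End affine_change_of_variable.

Section continuous_measurable_rV.
Context {R : realType} (n : nat).

(** Countably many boxes with rational centre and half-width [1/(m+1)] exhaust an open set. The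
    radius [e] has to be at least twice the half-width: both the given point and an arbitrary point
    of the box are within one half-width of the centre. *)
Lemma open_measurable_rV (U : set 'rV[R]_n) : open U -> measurable U.
Proof.
move=> oU.
pose box (q : 'rV[rat]_n * nat) : set 'rV[R]_n :=
  [set x | forall i, `|x ord0 i - ratr (q.1 ord0 i)| < q.2.+1%:R^-1].
have mbox q : measurable (box q).
  rewrite (_ : box q = \bigcap_(i in [set: 'I_n])
      [set x : 'rV[R]_n | `|x ord0 i - ratr (q.1 ord0 i)| < q.2.+1%:R^-1]).
    apply: fin_bigcap_measurable => // i _.
    rewrite (_ : [set _ | _] =
      (fun x : 'rV[R]_n => x ord0 i) @^-1` (ball (ratr (q.1 ord0 i) : R) (q.2.+1%:R^-1))).
      rewrite -[X in measurable X]setTI; apply: measurable_coord => //.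
      exact: measurable_ball.
    by apply/seteqP; split => x /=; rewrite /ball /= distrC.
  by apply/seteqP; split => x /= xq => [i _|i]; exact: xq.
have -> : U = \bigcup_(q in [set: 'rV[rat]_n * nat])
    (if `[< box q `<=` U >] then box q else set0).
  apply/seteqP; split => [x Ux|x [q _]]; last by case: ifPn => // /asboolP; exact.
  have /nbhs_ballP[e /= e0 xeU] : nbhs x U by exact: open_nbhs_nbhs.
  pose k := Num.truncn (2 / e).
  have ke : 2 * k.+1%:R^-1 <= e.
    rewrite ler_pdivrMr// mulrC -ler_pdivrMr//; apply/ltW.
    by rewrite -truncn_lt_nat// divr_ge0// ltW.
  have /choice[q qx] : forall i, exists q : rat, `|x ord0 i - ratr q| < k.+1%:R^-1.
    move=> i.
    have [|q] := @rat_in_itvoo R (x ord0 i - k.+1%:R^-1) (x ord0 i + k.+1%:R^-1).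
      by rewrite ltrD2l (@lt_trans _ _ 0)// ?oppr_lt0 invr_gt0.
    by rewrite in_itv/= => qx; exists q; rewrite distrC ltr_distl.
  exists (\row_i q i, k) => //; rewrite ifT; first by move=> i; rewrite /= mxE.
  apply/asboolP => y /= yq; apply: xeU; split => // i j; rewrite ord1 /ball /=.
  apply: lt_le_trans ke.
  rewrite -(subrK (ratr (q j)) (x _ _)) -addrA.
  rewrite mulr_natl mulr2n (le_lt_trans (ler_normD _ _))// ltrD//.
  by have := yq j; rewrite mxE distrC.
apply: countable_bigcupT_measurable; first exact: countableP.
by move=> q; case: ifPn.
Qed.

Lemma continuous_measurable_rV (f : 'rV[R]_n -> R) :
  continuous f -> measurable_fun setT f.
Proof.
move=> cf; apply: (measurability (@RGenOpens.G R)); first exact: RGenOpens.measurableE.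
move=> _ [_ [a [b ->]] <-]; rewrite setTI.
apply: open_measurable_rV; apply: open_comp => //; exact: interval_open.
Qed.

End continuous_measurable_rV.

(** Convexity of the power function. In the induction, multiplying the previous bound by [x] leaves
    the excess [(n+1) m^n (x - m)^2]. *)
Lemma pow_tangent (R : realFieldType) n (x m : R) : 0 <= x -> 0 <= m ->
  m ^+ n.+1 + n.+1%:R * m ^+ n * (x - m) <= x ^+ n.+1.
Proof.
move=> x0 m0; elim: n => [|n IH]; first by rewrite !expr1 expr0; lra.
rewrite [leRHS]exprS (le_trans _ (ler_wpM2l x0 IH))//.
have h : 0 <= n.+1%:R * m ^+ n * (x - m) ^+ 2.
  by rewrite mulr_ge0 ?sqr_ge0// mulr_ge0// exprn_ge0.
rewrite -subr_ge0; apply: le_trans h _; rewrite le_eqVlt; apply/orP; left.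
apply/eqP; rewrite !exprS -[n.+2%:R]natr1; ring.
Qed.

(** Jensen for the power [n+1] at the points [a s / p] and [b s / q] with weights [p / s] and
    [q / s], where [s = p + q]: their mean is [a + b], so the tangent is taken there. *)
Lemma radon_inequality (R : realFieldType) n (a b p q : R) :
  0 < a -> 0 < b -> 0 < p -> 0 < q ->
  (a + b) ^+ n.+1 <= (p + q) ^+ n * (a ^+ n.+1 / p ^+ n + b ^+ n.+1 / q ^+ n).
Proof.
move=> a0 b0 p0 q0; set s := p + q; have s0 : 0 < s by rewrite addr_gt0.
have h (c r : R) : 0 < c -> 0 < r ->
    r / s * ((a + b) ^+ n.+1 + n.+1%:R * (a + b) ^+ n * (c * s / r - (a + b))) <=
    s ^+ n * (c ^+ n.+1 / r ^+ n).
  move=> c0 r0; have -> : s ^+ n * (c ^+ n.+1 / r ^+ n) = r / s * (c * s / r) ^+ n.+1.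
    rewrite expr_div_n exprMn !exprS; field.
    by rewrite !expf_neq0 ?gt_eqF.
  apply: ler_wpM2l; first by rewrite divr_ge0// ltW.
  by apply: pow_tangent; rewrite ?divr_ge0 ?mulr_ge0 ?addr_ge0// ltW.
rewrite mulrDr; apply: le_trans (lerD (h a p a0 p0) (h b q b0 q0)).
rewrite le_eqVlt; apply/orP; left; apply/eqP; rewrite exprS /s; field.
by rewrite !gt_eqF// addr_gt0.
Qed.

Section measurable_order_sets.
Context d (T : measurableType d) (R : realType).
Implicit Types f g : T -> R.

Lemma measurable_ltr_set f g : measurable_fun setT f -> measurable_fun setT g ->
  measurable [set x | f x < g x].
Proof.
move=> mf mg; have := measurable_fun_ltr mf mg measurableT (_ : measurable [set true]).
by rewrite setTI; apply.
Qed.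

Lemma measurable_ler_set f g : measurable_fun setT f -> measurable_fun setT g ->
  measurable [set x | f x <= g x].
Proof.
move=> mf mg; have := measurable_fun_ler mf mg measurableT (_ : measurable [set true]).
by rewrite setTI; apply.
Qed.

End measurable_order_sets.

Section layer_cake.
Context d (T : measurableType d) (R : realType).
Variable m : {sigma_finite_measure set T -> \bar R}.

Lemma integral_layer_cake (f : T -> R) : measurable_fun setT f ->
  (forall x, 0 <= f x) ->
  (\int[m]_x (f x)%:E =
   \int[@lebesgue_measure R]_(s in `]0%R, +oo[) m [set x | (s < f x)%R])%E.
Proof.
move=> mf f0.
pose D : set (T * measurableTypeR R) := [set p | 0 < p.2 /\ p.2 < f p.1].
have mD : measurable D.
  have m2 : measurable_fun setT (fun p : T * measurableTypeR R => p.2).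
    exact: measurable_snd.
  apply: measurableI; first exact: measurable_ltr_set.
  by apply: measurable_ltr_set => //; exact: measurableT_comp.
have m1D : measurable_fun setT (fun p => (\1_D p)%:E : \bar R).
  exact/measurable_EFinP.
have := @fubini_tonelli _ _ _ _ R m (@lebesgue_measure R) _ m1D (fun=> ltac:(by rewrite lee_fin)).
have mu0 (y : R) : 0 <= y -> @lebesgue_measure R (`]0, y[%classic : set R) = y%:E.
  move=> y0; rewrite lebesgue_measure_itv/= lte_fin.
  case: ifPn => [_|]; first by rewrite sube0.
  by rewrite -leNgt => y0'; congr EFin; apply/eqP; rewrite eq_le y0 y0'.
have E x : (\int[@lebesgue_measure R]_y (\1_D (x, y))%:E = (f x)%:E)%E.
  rewrite (_ : (fun y => _) = EFin \o \1_(`]0, f x[%classic)); last first.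
    apply/funext => s /=; rewrite !indicE; congr ((_ : bool)%:R%:E).
    by apply/idP/idP; rewrite !inE /D /= in_itv/= => /andP.
  by rewrite integral_indic// setIT; exact: mu0.
under eq_integral do rewrite E.
move=> ->; rewrite [RHS]integral_mkcond; apply: eq_integral => s _.
rewrite patchE; case: ifPn => /=; rewrite ?inE ?notin_setE /= in_itv/= andbT => s0.
  rewrite (_ : (fun x => _) = EFin \o \1_([set x | s < f x])); last first.
    apply/funext => x /=; rewrite !indicE; congr ((_ : bool)%:R%:E).
    by apply/idP/idP; rewrite !inE /D /= => // -[].
  by rewrite integral_indic ?setIT//; exact: measurable_ltr_set.
rewrite (eq_integral (cst 0%E)) ?integral0// => x _.
by rewrite indicE memNset// => -[].
Qed.

Lemma measurable_superlevel_measure (f : T -> R) : measurable_fun setT f ->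
  measurable_fun [set: measurableTypeR R] (fun s => m [set x | (s < f x)%R]).
Proof.
move=> mf; pose D : set (T * measurableTypeR R) := [set p | p.2 < f p.1].
have mD : measurable D.
  apply: measurable_ltr_set; first exact: measurable_snd.
  exact: measurableT_comp.
rewrite (_ : (fun s => _) = m \o ysection D); first exact: measurable_fun_ysection.
apply/funext => s /=; congr (m _).
by apply/seteqP; split => x /=; rewrite /ysection /= /D inE.
Qed.

End layer_cake.

Section brunn_minkowski_line.
Context {R : realType}.
Local Notation mu := (@lebesgue_measure R).

Lemma measurable_shift_set (d : R) (A : set R) :
  measurable A -> measurable [set x | A (x + d)].
Proof.
move=> mA; rewrite -[X in measurable X]setTI.
have : measurable_fun setT (fun x : R => x + d) by exact: measurable_funD.
by apply.
Qed.

Lemma lebesgue_measure_shift (d : R) (A : set R) : measurable A ->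
  mu [set x | A (x + d)] = mu A.
Proof.
move=> mA; rewrite [RHS](@lebesgue_measure_affine R (PosNum ltr01) d)//.
rewrite /mscale /= mul1e /pushforward; congr (mu _).
by apply/seteqP; split => x /=; rewrite mul1r.
Qed.

(** [C] contains the translates [A + b] and [a + B]. With [a] close to [sup A] and [b] close to
    [inf B] these barely overlap; cutting [A] at [c = a + inf B - b] puts [A1 + b] strictly to the
    left of [a + B], and the part cut off has length at most [e]. *)
Lemma brunn_minkowski_line (A B C : set R) (k : R) :
  measurable A -> measurable B -> measurable C -> A !=set0 -> B !=set0 ->
  (forall x, A x -> `|x| <= k) -> (forall x, B x -> `|x| <= k) ->
  (forall x y, A x -> B y -> C (x + y)) ->
  (mu A + mu B <= mu C)%E.
Proof.
move=> mA mB mC A0 B0 Ak Bk ABC; apply/lee_addgt0Pr => e e0.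
have hA : has_sup A by split=> //; exists k => x /Ak; rewrite ler_norml => /andP[].
have hB : has_inf B.
  by split=> //; exists (- k) => x /Bk; rewrite ler_norml => /andP[].
have e20 : 0 < e / 2 by rewrite divr_gt0.
have [a Aa aA] := sup_adherent e20 hA.
have [b Bb bB] := inf_adherent e20 hB.
pose c := a + inf B - b.
pose A1 := A `&` `]-oo, c[%classic.
have mA1 : measurable A1 by exact: measurableI.
have muc : (mu (`[c, sup A]%classic : set R) <= e%:E)%E.
  rewrite lebesgue_measure_itv/=; case: ifPn => _; last by rewrite lee_fin ltW.
  by rewrite -EFinB lee_fin /c; lra.
have AA1 : (mu A <= mu A1 + e%:E)%E.
  apply: (@le_trans _ _ (mu (A1 `|` `[c, sup A]%classic))).
    apply: le_measure; rewrite ?inE//; first exact: measurableU.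
    move=> x Ax; case: (ltP x c) => xc; [left|right] => /=.
      by split => //=; rewrite in_itv.
    by rewrite in_itv/= xc/=; apply: ub_le_sup => //; case: hA.
  apply: le_trans (measureU2 _ _ _) _ => //; rewrite leeD2l//.
apply: (le_trans (leeD2r _ AA1)); rewrite addeAC leeD2r//.
rewrite -(lebesgue_measure_shift (- b) mA1) -(lebesgue_measure_shift (- a) mB).
rewrite -measureU//=.
- apply: le_measure; rewrite ?inE//.
    by apply: measurableU; exact: measurable_shift_set.
  move=> x [[/= Ax _]|/= Bx].
    by have := ABC _ _ Ax Bb; rewrite subrK.
  by have := ABC _ _ Aa Bx; rewrite addrC subrK.
- exact: measurable_shift_set.
- exact: measurable_shift_set.
- rewrite -subset0 => x [[/= _]]; rewrite in_itv/= /c => xc Bx.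
  have : inf B <= x - a by apply: ge_inf => //; case: hB.
  by lra.
Qed.

End brunn_minkowski_line.

(** * The Brunn-Minkowski inequality and volumes of balls *)

Section slices.
Context {R : realType} (n : nat).
Local Notation mu := (@lebesgue_measure R).
Implicit Types A : set 'rV[R]_n.+1.

Definition slice A (t : R) : set 'rV[R]_n := [set v | A (rcons0 t v)].

Lemma measurable_slice A t : measurable A -> measurable (slice A t).
Proof.
by move=> mA; rewrite -[X in measurable X]setTI; exact: measurable_rcons0.
Qed.

Let vol_sliceE A t : measurable A ->
  (vol n (slice A t) = \int[vol n]_v (\1_A (rcons0 t v))%:E)%E.
Proof.
move=> mA; rewrite (_ : (fun v => _) = EFin \o \1_(slice A t)).
  by rewrite integral_indic// ?setIT//; exact: measurable_slice.
by apply/funext => v /=; rewrite !indicE.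
Qed.

Lemma measurable_vol_slice A : measurable A ->
  measurable_fun [set: measurableTypeR R] (fun t => vol n (slice A t)).
Proof.
move=> mA; under eq_fun do rewrite vol_sliceE//.
apply: (@measurable_integral_slice _ _ (fun x => (\1_A x)%:E)) => //.
by apply/measurable_EFinP.
Qed.

Lemma vol_slice A : measurable A ->
  (vol n.+1 A = \int[mu]_t vol n (slice A t))%E.
Proof.
move=> mA; rewrite -[A in LHS]setIT -integral_indic//.
rewrite ge0_integral_volS//; last exact/measurable_EFinP.
by apply: eq_integral => t _; rewrite vol_sliceE.
Qed.

End slices.

Section cubes.
Context {R : realType}.
Local Notation mu := (@lebesgue_measure R).

(** A bounding box that keeps volumes finite and passes to slices with the same [k]. *)
Definition cube n (k : R) : set 'rV[R]_n := [set x | forall i, `|x ord0 i| <= k].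

Arguments cube n k : clear implicits.

Lemma measurable_cube n k : measurable (cube n k).
Proof.
rewrite (_ : cube n k = \bigcap_(i in [set: 'I_n]) [set x : 'rV[R]_n | `|x ord0 i| <= k]).
  apply: fin_bigcap_measurable => // i _; apply: measurable_ler_set => //.
  by apply: measurableT_comp => //; exact: measurable_coord.
by apply/seteqP; split => x /= xq => [i _|i]; exact: xq.
Qed.

Lemma slice_cube n k t :
  slice (cube n.+1 k) t = if `|t| <= k then cube n k else set0.
Proof.
apply/seteqP; split => v /=.
  move=> h; have := h ord0; rewrite rcons0_ord0 => -> i.
  by have := h (lift ord0 i); rewrite rcons0_lift.
case: ifPn => // tk h i; case: (unliftP ord0 i) => [j|] ->.
  by rewrite rcons0_lift.
by rewrite rcons0_ord0.
Qed.

Lemma vol_cube_lty n k : (vol n (cube n k) < +oo)%E.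
Proof.
elim: n => [|n IH]; first by rewrite /= diracE ltry.
rewrite vol_slice; last exact: measurable_cube.
apply: (@le_lt_trans _ _ (\int[mu]_(t in `[(- k)%R, k]) vol n (cube n k))%E).
  rewrite [leRHS]integral_mkcond; apply: ge0_le_integral => //=.
  - by apply: measurable_vol_slice; exact: measurable_cube.
  - apply/(measurable_restrictT _ _).1 => //.
  - move=> t _; rewrite patchE slice_cube mem_setE in_itv/= -ler_norml.
    by case: ifPn => //; rewrite measure0.
rewrite integral_cst//= lte_mul_pinfty//.
  by rewrite ge0_fin_numE.
have : (mu (`[(- k)%R, k]%classic : set R) < +oo)%E.
  by rewrite lebesgue_measure_itv; case: ifPn => _ //=; rewrite -EFinB ltry.
by [].
Qed.

Lemma vol_sub_cube n (A : set 'rV[R]_n) k : measurable A -> A `<=` cube n k ->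
  vol n A \is a fin_num.
Proof.
move=> mA Ak; rewrite ge0_fin_numE//; apply: le_lt_trans (vol_cube_lty n k).
by apply: le_measure; rewrite ?inE//; exact: measurable_cube.
Qed.

End cubes.
Arguments cube {R} n k.

Section brunn_minkowski.
Context {R : realType}.
Local Notation mu := (@lebesgue_measure R).

(** For [n = 0] every power equals [1], so a root exists only for [x = 1]. In dimension [0] positive
    volumes are equal to [1], which is how the side condition gets discharged. *)
Let root_exists n (x : R) : 0 < x -> (n = 0%N -> x = 1) ->
  exists2 y, 0 < y & y ^+ n = x.
Proof.
case: n => [_ /(_ erefl) ->|n x0 _]; first by exists 1.
exists (x `^ n.+1%:R^-1); first by rewrite powR_gt0.
by rewrite -powR_mulrn ?powR_ge0// -powRrM mulVf// powRr1// ltW.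
Qed.

Let fine_vol_dim0 n (S : set 'rV[R]_n) : n = 0%N ->
  0 < fine (vol n S) -> fine (vol n S) = 1.
Proof.
move=> n0; subst n.
have -> : vol 0 S = (0 \in S)%:R%:E by rewrite -diracE.
by case: (0 \in S) => //=; rewrite ltxx.
Qed.

Section slice_function.
Variables (n : nat) (A : set 'rV[R]_n.+1) (k : R).
Hypotheses (mA : measurable A) (Ak : A `<=` cube n.+1 k).

Definition slice_vol (t : R) : R := fine (vol n (slice A t)).

Lemma slice_sub_cube t : slice A t `<=` cube n k.
Proof. by move=> v /Ak h i; have := h (lift ord0 i); rewrite rcons0_lift. Qed.

Lemma slice_volE t : (slice_vol t)%:E = vol n (slice A t).
Proof.
by rewrite fineK//; apply: vol_sub_cube (@slice_sub_cube t); exact: measurable_slice.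
Qed.

Lemma slice_vol_ge0 t : 0 <= slice_vol t.
Proof. exact: fine_ge0. Qed.

Lemma slice_vol_le t : slice_vol t <= fine (vol n (cube n k)).
Proof.
apply: fine_le.
- by apply: vol_sub_cube (@slice_sub_cube t); exact: measurable_slice.
- by rewrite ge0_fin_numE// vol_cube_lty.
- apply: le_measure (@slice_sub_cube t); rewrite inE.
    exact: measurable_slice.
  exact: measurable_cube.
Qed.

Lemma slice_vol_supp t : 0 < slice_vol t -> `|t| <= k.
Proof.
move=> t0; have : slice A t !=set0.
  apply/set0P/eqP => s0; by move: t0; rewrite /slice_vol s0 measure0 ltxx.
by move=> [v /Ak /(_ ord0)]; rewrite rcons0_ord0.
Qed.

Lemma measurable_slice_vol : measurable_fun [set: measurableTypeR R] slice_vol.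
Proof.
apply/measurable_EFinP; rewrite (_ : _ \o _ = fun t => vol n (slice A t)).
  exact: measurable_vol_slice.
by apply/funext => t; exact: slice_volE.
Qed.

Lemma integral_slice_vol (c : R) : 0 < c ->
  (\int[mu]_t (slice_vol t / c)%:E = (fine (vol n.+1 A) / c)%:E)%E.
Proof.
move=> c0; have cV : (0 <= (c^-1)%:E)%E by rewrite lee_fin invr_ge0 ltW.
under eq_integral do rewrite mulrC EFinM slice_volE.
rewrite ge0_integralZl//; last exact: measurable_vol_slice.
by rewrite -vol_slice// mulrC EFinM fineK//; apply: vol_sub_cube Ak.
Qed.

Lemma slice_vol_sup (a : R) : 0 < a -> (a%:E <= vol n.+1 A)%E ->
  let s := sup (range slice_vol) in
  [/\ 0 < s, (forall t, slice_vol t <= s),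
    (forall r, r < s -> exists t, r < slice_vol t) & (n = 0%N -> s = 1)].
Proof.
move=> a0 aA s.
have hs : has_sup (range slice_vol).
  split; first by exists (slice_vol 0), 0.
  by exists (fine (vol n (cube n k))) => _ [t _ <-]; exact: slice_vol_le.
have sle t : slice_vol t <= s by apply: ub_le_sup; [case: hs|exists t].
have sgt r : r < s -> exists t, r < slice_vol t.
  move=> rs; have := sup_adherent (_ : 0 < s - r) hs.
  by rewrite subr_gt0 => /(_ rs)[_ [t _ <-]]; rewrite -/s subKr; exists t.
have s0 : 0 < s.
  rewrite ltNge; apply/negP => s0; move: aA; rewrite vol_slice//.
  rewrite (eq_integral (cst 0%E)) ?integral0 ?lee_fin ?leNgt ?a0// => t _.
  rewrite -slice_volE; congr EFin; apply/eqP; rewrite eq_le slice_vol_ge0 andbT.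
  exact: le_trans s0.
split => // n0; have h t : 0 < slice_vol t -> slice_vol t = 1 by exact: fine_vol_dim0.
have [t t0] := sgt _ s0.
apply/eqP; rewrite eq_le -{2}(h t t0) sle andbT.
rewrite leNgt; apply/negP => /sgt[t' t'1].
by move: (t'1); rewrite h ?ltxx// (lt_trans ltr01).
Qed.

End slice_function.

(* Comparing the superlevel sets of the slice volumes, each normalised by its
   supremum, reduces the inequality to dimension one. *)
Theorem brunn_minkowski n (A B C : set 'rV[R]_n) (k a b : R) :
  measurable A -> measurable B -> measurable C ->
  A `<=` cube n k -> B `<=` cube n k -> C `<=` cube n k ->
  (forall x y, A x -> B y -> C (x + y)) ->
  0 < a -> 0 < b -> ((a ^+ n)%:E <= vol n A)%E -> ((b ^+ n)%:E <= vol n B)%E ->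
  (((a + b) ^+ n)%:E <= vol n C)%E.
Proof.
elim: n A B C a b => [|n IH] A B C a b mA mB mC Ak Bk Ck ABC a0 b0 aA bB.
  move: aA bB; rewrite /= !diracE !expr0 !lee_fin.
  case: (boolP (0 \in A)) => [|_]; last by rewrite ler10.
  case: (boolP (0 \in B)) => [|_]; last by rewrite ler10.
  rewrite !inE => B0 A0 _ _; have := ABC _ _ A0 B0; rewrite addr0 => C0.
  by rewrite mem_set.
have an0 : 0 < a ^+ n.+1 by rewrite exprn_gt0.
have bn0 : 0 < b ^+ n.+1 by rewrite exprn_gt0.
have [al0 Aal alA al1] := slice_vol_sup mA Ak an0 aA.
have [be0 Bbe beB be1] := slice_vol_sup mB Bk bn0 bB.
set al := sup _ in al0 Aal alA al1; set be := sup _ in be0 Bbe beB be1.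
have [p p0 pal] := root_exists al0 al1.
have [q q0 qbe] := root_exists be0 be1.
have pqn : 0 < (p + q) ^+ n by rewrite exprn_gt0// addr_gt0.
pose f t := slice_vol A t / al; pose g t := slice_vol B t / be.
pose h t := slice_vol C t / (p + q) ^+ n.
have mf : measurable_fun [set: measurableTypeR R] f.
  by apply: measurable_funM => //; exact: measurable_slice_vol Ak.
have mg : measurable_fun [set: measurableTypeR R] g.
  by apply: measurable_funM => //; exact: measurable_slice_vol Bk.
have mh : measurable_fun [set: measurableTypeR R] h.
  by apply: measurable_funM => //; exact: measurable_slice_vol Ck.
(* With [s^n = min (f x) (g y)], the slices at [x] and [y] have volumes at least [(s p)^n] and
   [(s q)^n]; the induction hypothesis gives the slice of [C] at [x + y] volume at least
   [(s (p + q))^n]. *)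
have fgh r x y : 0 < r -> r < f x -> r < g y -> r < h (x + y).
  move=> r0 rf rg; pose z := Num.min (f x) (g y).
  have rz : r < z by rewrite lt_min rf.
  have [|s s0 sz] := @root_exists n z (lt_trans r0 rz).
    move=> n0; rewrite /z /f /g al1// be1// !divr1.
    have /(fine_vol_dim0 n0) : 0 < slice_vol A x.
      by have := lt_trans r0 rf; rewrite pmulr_lgt0 ?invr_gt0.
    have /(fine_vol_dim0 n0) : 0 < slice_vol B y.
      by have := lt_trans r0 rg; rewrite pmulr_lgt0 ?invr_gt0.
    by rewrite /slice_vol => -> ->; rewrite minxx.
  apply: (lt_le_trans rz); rewrite ler_pdivlMr// -lee_fin (slice_volE mC Ck).
  rewrite -sz -exprMn mulrDr; apply: (IH (slice A x) (slice B y)) => //.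
  - exact: measurable_slice.
  - exact: measurable_slice.
  - exact: measurable_slice.
  - exact: (slice_sub_cube Ak).
  - exact: (slice_sub_cube Bk).
  - exact: (slice_sub_cube Ck).
  - by move=> v w Av Bw; rewrite /slice /= -rcons0D; exact: ABC.
  - by rewrite mulr_gt0.
  - by rewrite mulr_gt0.
  - rewrite exprMn sz pal -(slice_volE mA Ak) lee_fin -ler_pdivlMr//.
    by rewrite ge_min lexx.
  - rewrite exprMn sz qbe -(slice_volE mB Bk) lee_fin -ler_pdivlMr//.
    by rewrite ge_min lexx orbT.
(* Layer cake in the height. Below height [1] the superlevel sets of both [f] and [g] are nonempty,
   because both have supremum [1], so the inequality on the line applies; from height [1] on they
   are empty. *)
have key : (\int[mu]_t (f t)%:E + \int[mu]_t (g t)%:E <= \int[mu]_t (h t)%:E)%E.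
  have mS (D : set (measurableTypeR R)) (F : R -> R) :
      measurable_fun [set: measurableTypeR R] F ->
      measurable_fun D (fun s : measurableTypeR R => mu [set x | (s < F x)%R]).
    by move=> mF; apply: measurable_funTS; exact: measurable_superlevel_measure.
  have f0 t : 0 <= f t by rewrite divr_ge0 ?slice_vol_ge0// ltW.
  have g0 t : 0 <= g t by rewrite divr_ge0 ?slice_vol_ge0// ltW.
  have h0 t : 0 <= h t by rewrite divr_ge0 ?slice_vol_ge0// ltW.
  have f1 t : f t <= 1 by rewrite ler_pdivrMr// mul1r.
  have g1 t : g t <= 1 by rewrite ler_pdivrMr// mul1r.
  have msf (F : R -> R) (s : R) : measurable_fun [set: measurableTypeR R] F ->
      measurable [set x | s < F x].
    by move=> mF; exact: (@measurable_ltr_set _ (measurableTypeR R)).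
  rewrite !integral_layer_cake// -ge0_integralD//; [|exact: mS|exact: mS].
  apply: ge0_le_integral => //.
  - by move=> s _; rewrite adde_ge0.
  - by apply: emeasurable_funD; exact: mS.
  - exact: mS.
  move=> s /=; rewrite in_itv/= andbT => s0.
  have [s1|s1] := ltP s 1; last first.
    rewrite (_ : [set x | s < f x] = set0); last first.
      by rewrite -subset0 => x /=; rewrite ltNge (le_trans (f1 x)).
    rewrite (_ : [set x | s < g x] = set0); last first.
      by rewrite -subset0 => x /=; rewrite ltNge (le_trans (g1 x)).
    by rewrite measure0 adde0.
  apply: (@brunn_minkowski_line _ _ _ _ k) => //.
  - exact: msf.
  - exact: msf.
  - exact: msf.
  - have [|t ht] := alA (s * al); first by rewrite gtr_pMl.
    by exists t; rewrite /= ltr_pdivlMr.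
  - have [|t ht] := beB (s * be); first by rewrite gtr_pMl.
    by exists t; rewrite /= ltr_pdivlMr.
  - move=> x /= sx; apply: (slice_vol_supp Ak).
    by have := lt_trans s0 sx; rewrite pmulr_lgt0 ?invr_gt0.
  - move=> x /= sx; apply: (slice_vol_supp Bk).
    by have := lt_trans s0 sx; rewrite pmulr_lgt0 ?invr_gt0.
  - by move=> x y /=; exact: fgh.
move: key; rewrite (integral_slice_vol mA Ak)// (integral_slice_vol mB Bk)// (integral_slice_vol mC Ck)// -EFinD lee_fin => key.
rewrite -(fineK (vol_sub_cube mC Ck)) lee_fin.
(* The bound [key] divides the volumes of [A], [B], [C] by [p^n], [q^n], [(p + q)^n]; Radon's
   inequality turns the sum of quotients back into a power of [a + b]. *)
apply: (le_trans (radon_inequality n a0 b0 p0 q0)).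
rewrite mulrC -ler_pdivlMr//; apply: le_trans key; rewrite pal qbe lerD//.
  rewrite ler_wpM2r ?invr_ge0 ?(ltW al0)// -lee_fin fineK//; exact: vol_sub_cube Ak.
rewrite ler_wpM2r ?invr_ge0 ?(ltW be0)// -lee_fin fineK//; exact: vol_sub_cube Bk.
Qed.

End brunn_minkowski.

(** * Euclidean norm and balls *)

Section euclidean_ball.
Context {R : realType}.
Implicit Type n : nat.

Lemma enorm_ge0 n (x : 'rV[R]_n) : 0 <= enorm x.
Proof. exact: sqrtr_ge0. Qed.

Lemma sum_sqr_ge0 n (x : 'rV[R]_n) : 0 <= \sum_(i < n) x ord0 i ^+ 2.
Proof. by apply: sumr_ge0 => i _; exact: sqr_ge0. Qed.

Lemma enorm_sqr n (x : 'rV[R]_n) : enorm x ^+ 2 = \sum_(i < n) x ord0 i ^+ 2.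
Proof. by rewrite sqr_sqrtr// sum_sqr_ge0. Qed.

Lemma ler_coord_enorm n (x : 'rV[R]_n) i : `|x ord0 i| <= enorm x.
Proof.
rewrite -sqrtr_sqr ler_wsqrtr// (bigD1 i)//= lerDl.
by apply: sumr_ge0 => j _; exact: sqr_ge0.
Qed.

Lemma enormZ n (c : R) (x : 'rV[R]_n) : 0 <= c -> enorm (c *: x) = c * enorm x.
Proof.
move=> c0; rewrite /enorm; under eq_bigr do rewrite mxE exprMn.
by rewrite -mulr_sumr sqrtrM ?sqr_ge0// sqrtr_sqr ger0_norm.
Qed.

Lemma cauchy_schwarz_enorm n (x : 'rV[R]_n) (a : 'I_n -> R) :
  (\sum_(i < n) x ord0 i * a i) ^+ 2 <= enorm x ^+ 2 * \sum_(i < n) a i ^+ 2.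
Proof.
rewrite enorm_sqr.
set X := \sum_(i < n) x ord0 i ^+ 2; set A := \sum_(i < n) a i ^+ 2.
set P := \sum_(i < n) x ord0 i * a i.
have X0 : 0 <= X := sum_sqr_ge0 x.
have h : 0 <= X * (X * A - P ^+ 2).
  have : 0 <= \sum_(i < n) (X * a i - P * x ord0 i) ^+ 2.
    by apply: sumr_ge0 => i _; exact: sqr_ge0.
  rewrite (eq_bigr (fun i => X ^+ 2 * a i ^+ 2 + (- (2 * X * P)) * (x ord0 i * a i)
    + P ^+ 2 * x ord0 i ^+ 2)); last by move=> i _; ring.
  rewrite !big_split/= -!mulr_sumr -/X -/A -/P; congr (_ <= _); ring.
have [X1|X1] := ltP 0 X; first by rewrite -subr_ge0 -(pmulr_rge0 _ X1).
have XE : X = 0 by apply/eqP; rewrite eq_le X0 X1.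
have x0 i : x ord0 i = 0.
  have /eqP := XE; rewrite psumr_eq0 => [/allP/(_ i)|j _]; last exact: sqr_ge0.
  by rewrite mem_index_enum sqrf_eq0 => /(_ isT)/eqP.
by rewrite /P big1 ?expr0n ?XE ?mul0r//= => i _; rewrite x0 mul0r.
Qed.

Lemma measurable_enorm n : measurable_fun setT (@enorm R n).
Proof.
rewrite (_ : @enorm R n = @Num.sqrt R \o (fun x => \sum_(i < n) x ord0 i ^+ 2))//.
apply: measurableT_comp.
  by apply: continuous_measurable_fun; exact: sqrt_continuous.
apply: measurable_sum => i.
by apply: measurable_funX; exact: measurable_coord.
Qed.

Definition eball n (r : R) : set 'rV[R]_n := [set x | enorm x < r].
Arguments eball n r : clear implicits.

Lemma measurable_eball n r : measurable (eball n r).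
Proof. by apply: measurable_ltr_set => //; exact: measurable_enorm. Qed.

Lemma eball_sub_cube n r : eball n r `<=` cube n r.
Proof. by move=> x /ltW xr i; exact: le_trans (ler_coord_enorm _ _) xr. Qed.

(** It enters the estimates as [n * kappa n], the area of the unit sphere. *)
Definition kappa n : R := fine (vol n (eball n 1)).

Lemma kappa_ge0 n : 0 <= kappa n. Proof. exact: fine_ge0. Qed.

Lemma vol_eball_fin n r : vol n (eball n r) \is a fin_num.
Proof. by apply: vol_sub_cube (@eball_sub_cube n r); exact: measurable_eball. Qed.

Lemma vol_eball n r : (0 < n)%N -> 0 <= r ->
  vol n (eball n r) = (kappa n * r ^+ n)%:E.
Proof.
move=> n0; rewrite le_eqVlt => /predU1P[<-|r0].
  rewrite expr0n gtn_eqF// mulr0 (_ : eball n 0 = set0) ?measure0//.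
  by rewrite -subset0 => x /=; rewrite /eball /= ltNge enorm_ge0.
rewrite (@vol_affine _ _ r 0)//; last exact: measurable_eball.
rewrite (_ : [set x | _] = eball n 1).
  by rewrite mulrC EFinM /kappa fineK// vol_eball_fin.
by apply/seteqP; split => x /=; rewrite /eball /= addr0 enormZ ?(ltW r0)// gtr_pMr.
Qed.

End euclidean_ball.
Arguments eball {R} n r.
Arguments kappa {R} n.

(** * Gamma and Beta integrals *)

Section fubini_tools.
Context {R : realType}.
Local Notation mu := (@lebesgue_measure R).

Lemma integral_indic_mul d (T : measurableType d) (m : {measure set T -> \bar R})
    (D : set T) (b : pred T) (f : T -> R) : (forall x, D x <-> b x) ->
  (\int[m]_(x in D) (f x)%:E = \int[m]_x ((b x)%:R * f x)%:E)%E.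
Proof.
move=> Db; rewrite integral_mkcond; apply: eq_integral => x _; rewrite patchE.
case: ifPn => [/set_mem/Db ->|xD]; first by rewrite mul1r.
rewrite (_ : b x = false) ?mul0r//; apply: contraNF xD => bx.
by rewrite inE; exact/Db.
Qed.

Lemma measurable_bool_indic d (T : measurableType d) (b : T -> bool) :
  measurable_fun setT b -> measurable_fun setT (fun x => (b x)%:R : R).
Proof.
move=> mb; rewrite (_ : (fun x => _) = \1_[set x | b x]).
  apply: measurable_indic; rewrite -[X in measurable X]setTI.
  exact: (mb measurableT [set true]).
apply/funext => x; rewrite indicE; congr (nat_of_bool _)%:R.
by apply/idP/idP; rewrite inE.
Qed.

(** Tonelli on the region [{q x < t}]. It is applied with [q = |x|^2] and with [q = |x|], both times
    with [g t = exp (- t)], whose tail integral is [exp (- q x)]. *)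
Lemma tonelli_superlevel d (T : measurableType d)
    (m : {sigma_finite_measure set T -> \bar R}) (q f : T -> R) (g : R -> R) :
  measurable_fun setT q -> measurable_fun setT f ->
  measurable_fun [set: measurableTypeR R] g ->
  (forall x, 0 <= q x) -> (forall x, 0 <= f x) -> (forall t, 0 <= g t) ->
  (\int[m]_x ((f x)%:E * \int[mu]_(t in `]q x, +oo[) (g t)%:E) =
   \int[mu]_(t in `]0%R, +oo[) ((g t)%:E * \int[m]_(x in [set x | (q x < t)%R]) (f x)%:E))%E.
Proof.
move=> mq mf mg q0 f0 g0.
have mb : measurable_fun [set: T * measurableTypeR R]
    (fun p => (q p.1 < p.2)%R%:R : R).
  apply: measurable_bool_indic; apply: measurable_fun_ltr.
    exact: measurableT_comp.
  exact: measurable_snd.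
pose K (p : T * measurableTypeR R) : \bar R :=
  ((q p.1 < p.2)%R%:R * (f p.1 * g p.2))%:E.
have mK : measurable_fun setT K.
  apply/measurable_EFinP; apply: measurable_funM => //.
  by apply: measurable_funM; exact: measurableT_comp.
have K0 p : (0 <= K p)%E by rewrite lee_fin !mulr_ge0.
have := @fubini_tonelli _ _ _ _ R m mu K mK K0.
have mbx x : measurable_fun [set: measurableTypeR R] (fun t : R => (q x < t)%R%:R : R).
  by apply: measurable_bool_indic; exact: measurable_fun_ltr.
have mbt (t : R) : measurable_fun setT (fun x => (q x < t)%R%:R : R).
  by apply: measurable_bool_indic; exact: measurable_fun_ltr.
under eq_integral => x _.
  rewrite (_ : (fun t => _) =
    (fun t : measurableTypeR R => (f x)%:E * ((q x < t)%R%:R * g t)%:E)%E); last first.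
    by apply/funext => t; rewrite /K /= -EFinM mulrCA.
  rewrite ge0_integralZl//; last 3 first.
  - by apply/measurable_EFinP; exact: measurable_funM.
  - by move=> t _; rewrite lee_fin mulr_ge0.
  - by rewrite lee_fin.
  rewrite -(@integral_indic_mul _ _ mu `]q x, +oo[%classic); last first.
    by move=> t; rewrite /= in_itv/= andbT.
  over.
move=> ->; rewrite [RHS]integral_mkcond; apply: eq_integral => t _.
rewrite patchE; case: ifPn; rewrite ?inE ?notin_setE /= in_itv/= andbT => t0.
  rewrite (@integral_indic_mul _ _ m [set x | q x < t] (fun x => q x < t))//.
  rewrite -ge0_integralZl//.
  - by apply: eq_integral => x _; rewrite /K /= -EFinM; congr EFin; ring.
  - by apply/measurable_EFinP; exact: measurable_funM.
  - by move=> x _; rewrite lee_fin mulr_ge0.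
  - by rewrite lee_fin.
rewrite (eq_integral (cst 0%E)) ?integral0// => x _.
rewrite /K /= (_ : q x < t = false) ?mul0r//.
by apply/negbTE; rewrite -leNgt (le_trans _ (q0 x))// leNgt; apply/negP.
Qed.

Lemma integral_expRN_ray (a : R) :
  (\int[mu]_(t in `]a, +oo[) (expR (- t))%:E = (expR (- a))%:E)%E.
Proof.
rewrite integral_itv_obnd_cbnd; last first.
  apply/measurable_EFinP; apply: measurable_funTS.
  by apply: measurableT_comp => //; exact: measurableT_comp.
have dF (x : R) : is_derive x 1 (fun t => - expR (- t)) (expR (- x)).
  apply: is_derive_eq; rewrite /GRing.scale /=; ring.
rewrite (@ge0_continuous_FTC2y _ _ (fun t => - expR (- t)) _ 0).
- by rewrite sub0e -EFinN opprK.
- by move=> x _; exact: expR_ge0.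
- apply: continuous_subspaceT => x.
  by apply: continuous_comp; [exact: opp_continuous|exact: continuous_expR].
- rewrite -oppr0; apply: cvgN; exact: (@cvgr_expR R).
- by move=> x _; have [] := dF x.
- apply: cvg_at_right_filter; apply: cvgN.
  by apply: continuous_comp; [exact: opp_continuous|exact: continuous_expR].
- by move=> x _; rewrite derive1E; apply: derive_val.
Qed.

End fubini_tools.

(** * Gaussian integrals and identities for the Gamma function *)

Section gamma_integrals.
Context {R : realType}.
Local Notation mu := (@lebesgue_measure R).

(** The integral behind [Gamma] before [fine] is applied: identities between nonnegative integrals
    can be stated in extended reals. *)
Definition eGamma (s : R) : \bar R :=
  (\int[mu]_(t in `]0%R, +oo[%classic) ((t `^ (s - 1)) * expR (- t))%:E)%E.

Lemma eGamma_ge0 s : (0 <= eGamma s)%E.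
Proof.
by apply: integral_ge0 => t _; rewrite lee_fin mulr_ge0 ?powR_ge0 ?expR_ge0.
Qed.

Lemma integral_gauss_vol n :
  (\int[vol n]_x (expR (- enorm x ^+ 2))%:E = (Num.sqrt pi ^+ n)%:E :> \bar R)%E.
Proof.
have mE k : measurable_fun setT (fun x : 'rV[R]_k => (expR (- enorm x ^+ 2))%:E).
  apply/measurable_EFinP; apply: measurableT_comp => //.
  by apply: measurableT_comp => //; apply: measurable_funX; exact: measurable_enorm.
have E0 k (x : 'rV[R]_k) : (0 <= (expR (- enorm x ^+ 2))%:E)%E.
  by rewrite lee_fin expR_ge0.
elim: n => [|n IH].
  rewrite /= integral_dirac//; last exact: mE.
  rewrite diracE in_setT mul1e expr0 /enorm big_ord0 sqrtr0.
  by rewrite expr0n oppr0 expR0.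
have step (t : R) : (\int[vol n]_v (expR (- enorm (rcons0 t v) ^+ 2))%:E =
    (expR (- t ^+ 2))%:E * (Num.sqrt pi ^+ n)%:E)%E.
  rewrite -IH -ge0_integralZl;
    [|exact: measurableT|exact: mE|by move=> x _; exact: E0|by rewrite lee_fin expR_ge0].
  apply: eq_integral => v _; rewrite -EFinM -expRD !enorm_sqr.
  by rewrite (sum_rcons0 t v (fun y => y ^+ 2)) opprD.
rewrite ge0_integral_volS//; under eq_integral do rewrite step.
rewrite ge0_integralZr; [|exact: measurableT| | |]; last 3 first.
- apply/measurable_EFinP; exact: measurable_gauss_fun.
- by move=> t _; rewrite lee_fin expR_ge0.
- by rewrite lee_fin exprn_ge0// sqrtr_ge0.
by have := @integralT_gauss R; rewrite /gauss_fun => ->; rewrite -EFinM -exprS.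
Qed.

(** The Gaussian integral computed by layers: [exp (- |x|^2)] is the integral of [exp (- t)] over
    [t > |x|^2], and the ball of radius [sqrt t] has volume [kappa n * t^(n/2)]. *)
Lemma kappa_eGamma n : (0 < n)%N ->
  ((kappa n)%:E * eGamma (n%:R / 2 + 1) = (Num.sqrt pi ^+ n)%:E :> \bar R)%E.
Proof.
move=> n0; rewrite -integral_gauss_vol.
have mq : measurable_fun setT (fun x : 'rV[R]_n => enorm x ^+ 2).
  by apply: measurable_funX; exact: measurable_enorm.
have me : measurable_fun [set: measurableTypeR R] (fun t : R => expR (- t)).
  exact: measurableT_comp.
transitivity (\int[vol n]_x ((cst 1 x : R)%:E *
    \int[mu]_(t in `](enorm x ^+ 2)%R, +oo[) (expR (- t))%:E))%E; last first.
  by apply: eq_integral => x _; rewrite mul1e integral_expRN_ray.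
rewrite tonelli_superlevel//; last by move=> x; exact: sqr_ge0.
rewrite -ge0_integralZl; [|exact: measurable_itv| | |]; last 3 first.
- by apply/measurable_EFinP/measurable_funTS/measurable_funM.
- by move=> t _; rewrite lee_fin mulr_ge0 ?powR_ge0 ?expR_ge0.
- by rewrite lee_fin kappa_ge0.
apply: eq_integral => t; rewrite inE /= in_itv/= andbT => t0.
rewrite integral_cst/=; last exact: measurable_ltr_set.
rewrite mul1e (_ : [set x | _] = eball n (Num.sqrt t)); last first.
  have E (x : 'rV[R]_n) : (enorm x ^+ 2 < t) = (enorm x < Num.sqrt t).
    by rewrite -ltr_sqrt// sqrtr_sqr ger0_norm// enorm_ge0.
  by apply/seteqP; split => x /=; rewrite /eball /= E.
rewrite vol_eball// ?sqrtr_ge0// -!EFinM; congr EFin.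
rewrite addrK mulrA [RHS]mulrC; congr (_ * _ * _).
by rewrite -powR12_sqrt ?(ltW t0)// -powR_mulrn ?powR_ge0// -powRrM mulrC.
Qed.

Let mf_gamma (p c : R) : measurable_fun [set: measurableTypeR R]
  (fun t : R => (0 < t)%R%:R * (t `^ (p - 1) * expR (- (c * t))) : R).
Proof.
apply: measurable_funM.
  by apply: measurable_bool_indic; exact: measurable_fun_ltr.
apply: measurable_funM; first exact: measurable_powR.
by apply: measurableT_comp => //; apply: measurableT_comp.
Qed.

Let mf_gamma1 (p : R) : measurable_fun [set: measurableTypeR R]
  (fun t : R => (0 < t)%R%:R * (t `^ (p - 1) * expR (- t)) : R).
Proof.
rewrite (_ : (fun t => _) =
  (fun t : R => (0 < t)%R%:R * (t `^ (p - 1) * expR (- (1 * t))))) //.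
by apply/funext => t; rewrite mul1r.
Qed.

Lemma eGamma_scale (p c : R) : 0 < c ->
  eGamma p = ((c `^ p)%:E * \int[mu]_t ((0 < t)%R%:R * (t `^ (p - 1) * expR (- (c * t))))%:E)%E.
Proof.
move=> c0; rewrite /eGamma (@integral_indic_mul R _ (measurableTypeR R) mu _ (fun t : R => 0 < t)); last first.
  by move=> t; rewrite /= in_itv/= andbT.
rewrite [LHS](@ge0_integral_affine R (PosNum c0) 0) /=; last 2 first.
- by apply/measurable_EFinP; exact: mf_gamma1.
- by move=> t; rewrite lee_fin !mulr_ge0 ?powR_ge0 ?expR_ge0.
have -> : c `^ p = c * c `^ (p - 1).
  by rewrite -[X in _ = X * _](powRr1 (ltW c0)) -powRD ?(gt_eqF c0) ?implybT// addrC subrK.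
rewrite EFinM -muleA; congr (_ * _)%E; rewrite -ge0_integralZl//.
- apply: eq_integral => t _; rewrite -EFinM addr0 pmulr_rgt0//; congr EFin.
  case: (ltP 0 t) => [t0|_]; last by rewrite !mul0r mulr0.
  by rewrite powRM ?(ltW c0) ?(ltW t0)// !mul1r mulrA.
- by apply/measurable_EFinP; exact: mf_gamma.
- by move=> t _; rewrite lee_fin !mulr_ge0 ?powR_ge0 ?expR_ge0.
- by rewrite lee_fin powR_ge0.
Qed.

(** In the double integral for the square, the second variable is written as [t z], by
    [eGamma_scale]. Integrating in [t] first then gives [(1 + z)^(-2a)] times the Gamma integral at
    [2a]; what remains is the Beta integral over the half-line. *)
Lemma eGamma_beta (a : R) : (eGamma a * eGamma a =
  (\int[mu]_(z in `]0%R, +oo[%classic) (z `^ (a - 1) * (1 + z) `^ (- (2 * a)))%:E) *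
  eGamma (2 * a))%E.
Proof.
have fp0 (p c t : R) :
    0 <= (0 < t)%R%:R * (t `^ (p - 1) * expR (- (c * t))) :> R.
  by rewrite !mulr_ge0 ?powR_ge0 ?expR_ge0.
pose K (p : measurableTypeR R * measurableTypeR R) : \bar R :=
  (((0 < p.1)%R%:R * (p.1 `^ (2 * a - 1) * expR (- p.1))) *
   ((0 < p.2)%R%:R * (p.2 `^ (a - 1) * expR (- (p.1 * p.2)))))%:E.
have mK : measurable_fun setT K.
  have m1 : measurable_fun [set: measurableTypeR R * measurableTypeR R] fst.
    exact: measurable_fst.
  have m2 : measurable_fun [set: measurableTypeR R * measurableTypeR R] snd.
    exact: measurable_snd.
  apply/measurable_EFinP; apply: measurable_funM.
    apply: (@measurableT_comp _ _ _ _ _ _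
      (fun t : measurableTypeR R => (0 < t)%R%:R * (t `^ (2 * a - 1) * expR (- t)) : R)) => //; exact: mf_gamma1.
  apply: measurable_funM.
    apply: (@measurableT_comp _ _ _ _ _ _
      (fun t : measurableTypeR R => (0 < t)%R%:R : R)) => //.
    by apply: measurable_bool_indic; exact: measurable_fun_ltr.
  apply: measurable_funM.
    exact: (@measurableT_comp _ _ _ _ _ _
      (fun t : measurableTypeR R => t `^ (a - 1) : R)).
  by apply: measurableT_comp => //; apply: measurableT_comp => //; exact: measurable_funM.
have K0 p : (0 <= K p)%E.
  by rewrite lee_fin !mulr_ge0 ?powR_ge0 ?expR_ge0.
have If0 (p c : R) : (0 <= \int[mu]_t ((0 < t)%R%:R * (t `^ (p - 1) * expR (- (c * t))))%:E)%E.
  by apply: integral_ge0 => t _; rewrite lee_fin.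
transitivity (\int[mu]_t \int[mu]_z K (t, z))%E.
  rewrite [X in (X * _)%E]/eGamma
    (@integral_indic_mul R _ (measurableTypeR R) mu _ (fun t : R => 0 < t)); last first.
    by move=> t; rewrite /= in_itv/= andbT.
  rewrite -ge0_integralZr; [|exact: measurableT| | |exact: eGamma_ge0]; last 2 first.
  - by apply/measurable_EFinP; exact: mf_gamma1.
  - by move=> t _; rewrite lee_fin !mulr_ge0 ?powR_ge0 ?expR_ge0.
  apply: eq_integral => t _.
  transitivity (((0 < t)%R%:R * (t `^ (2 * a - 1) * expR (- t)))%:E *
      \int[mu]_z ((0 < z)%R%:R * (z `^ (a - 1) * expR (- (t * z))))%:E)%E.
    case: (ltP 0 t) => t0; last by rewrite !mul0r !mul0e.
    rewrite (eGamma_scale a t0) muleA -EFinM; congr (_%:E * _)%E.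
    rewrite !mul1r mulrAC -powRD; last by rewrite (gt_eqF t0) implybT.
    by congr (_ `^ _ * _); ring.
  rewrite -ge0_integralZl; [|exact: measurableT| | |]; last 3 first.
  - by apply/measurable_EFinP; exact: mf_gamma.
  - by move=> z _; rewrite lee_fin.
  - by rewrite lee_fin !mulr_ge0 ?powR_ge0 ?expR_ge0.
  by apply: eq_integral => z _; rewrite -EFinM.
rewrite fubini_tonelli//.
rewrite (@integral_indic_mul R _ (measurableTypeR R) mu _ (fun t : R => 0 < t)); last first.
  by move=> t; rewrite /= in_itv/= andbT.
rewrite -ge0_integralZr; [|exact: measurableT| | |exact: eGamma_ge0]; last 2 first.
- apply/measurable_EFinP; apply: measurable_funM.
    by apply: measurable_bool_indic; exact: measurable_fun_ltr.
  apply: measurable_funM => //.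
  apply: (@measurableT_comp _ _ _ _ _ _
    (fun t : measurableTypeR R => t `^ (- (2 * a)) : R)) => //.
  exact: measurable_funD.
- by move=> t _; rewrite lee_fin !mulr_ge0 ?powR_ge0.
apply: eq_integral => z _.
transitivity (((0 < z)%R%:R * z `^ (a - 1))%:E *
   \int[mu]_t ((0 < t)%R%:R * (t `^ (2 * a - 1) * expR (- ((1 + z) * t))))%:E)%E.
  rewrite -ge0_integralZl; [|exact: measurableT| | |]; last 3 first.
  - by apply/measurable_EFinP; exact: mf_gamma.
  - by move=> t _; rewrite lee_fin.
  - by rewrite lee_fin !mulr_ge0 ?powR_ge0.
  apply: eq_integral => t _; rewrite -EFinM /K /=; congr EFin.
  have -> : - ((1 + z) * t) = - t + - (t * z) by ring.
  by rewrite expRD; ring.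
case: (ltP 0 z) => z0; last by rewrite !mul0r !mul0e.
have z1 : 0 < 1 + z by rewrite addr_gt0.
rewrite (eGamma_scale (2 * a) z1) muleA -EFinM; congr (_%:E * _)%E.
by rewrite !mul1r -mulrA -powRD ?subrr ?addNr ?powRr0 ?mulr1// (gt_eqF z1) implybT.
Qed.

Lemma continuous_powR_gt0 (s x : R) : 0 < x -> {for x, continuous (@powR R ^~ s)}.
Proof.
move=> x0; apply: differentiable_continuous; apply/derivable1_diffP.
by apply: derivable_powR; rewrite in_itv/= x0.
Qed.

Lemma powR_cvg_right0 (s : R) : 0 < s -> (x `^ s) @[x --> 0^'+] --> (0 : R) `^ s.
Proof. by move=> s0; rewrite powR0 ?gt_eqF//; exact: powR_cvg0. Qed.

Lemma continuous_powR_segment (s t : R) : 0 < s -> 0 < t ->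
  {within `[0, t], continuous (@powR R ^~ s)}.
Proof.
move=> s0 t0; apply/continuous_within_itvP => //; split.
- move=> x; rewrite in_itv/= => /andP[x0 _]; exact: continuous_powR_gt0.
- exact: powR_cvg_right0.
- by apply: cvg_at_left_filter; exact: continuous_powR_gt0.
Qed.

Lemma integral_powR_segment (s t : R) : 1 < s -> 0 < t ->
  (\int[mu]_(x in `[0%R, t]) (s * x `^ (s - 1))%:E = (t `^ s)%:E)%E.
Proof.
move=> s1 t0; have s0 : 0 < s by exact: lt_trans s1.
rewrite (@continuous_FTC2 R _ (@powR R ^~ s))//.
- by rewrite powR0 ?gt_eqF// sube0.
- move=> x; apply: cvgM; first exact: cvg_cst.
  by apply: continuous_powR_segment; rewrite ?subr_gt0.
- split.
  + move=> x; rewrite in_itv/= => /andP[x0 _].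
    by apply: derivable_powR; rewrite in_itv/= x0.
  + exact: powR_cvg_right0.
  + by apply: cvg_at_left_filter; exact: continuous_powR_gt0.
- move=> x; rewrite in_itv/= => /andP[x0 _].
  by rewrite powR_derive1// in_itv/= x0.
Qed.

(** Integration by parts through Tonelli, with [t^s] written as the integral of [s x^(s-1)] over
    [[0, t]]; [1 < s] makes that integrand continuous up to [0]. The threshold is [|x|] because it
    must be nonnegative, and [f] vanishes for [x <= 0]. *)
Lemma eGammaD1 (s : R) : 1 < s -> (eGamma (s + 1) = s%:E * eGamma s)%E.
Proof.
move=> s1; have s0 : 0 < s by exact: lt_trans s1.
pose f (x : R) : R := (0 < x)%R%:R * (s * x `^ (s - 1)).
have mf : measurable_fun [set: measurableTypeR R] f.
  apply: measurable_funM; last exact: measurable_funM.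
  by apply: measurable_bool_indic; exact: measurable_fun_ltr.
have me : measurable_fun [set: measurableTypeR R] (fun t : R => expR (- t)).
  exact: measurableT_comp.
have f0 x : 0 <= f x by rewrite !mulr_ge0 ?powR_ge0// ltW.
transitivity (\int[mu]_x ((f x)%:E * \int[mu]_(t in `]`|x|%R, +oo[) (expR (- t))%:E))%E.
  rewrite (@tonelli_superlevel R _ (measurableTypeR R) mu (fun x : R => `|x|) f
    (fun t => expR (- t)))//; last exact: normr_measurable.
  apply: eq_integral => t; rewrite inE/= in_itv/= andbT => t0.
  rewrite addrK mulrC EFinM; congr (_ * _)%E.
  rewrite -integral_powR_segment// -integral_itv_bndo_bndc; last first.
    by apply/measurable_EFinP; apply: measurable_funTS; exact: measurable_funM.
  rewrite -integral_itv_obnd_cbnd; last first.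
    by apply/measurable_EFinP; apply: measurable_funTS; exact: measurable_funM.
  rewrite (@integral_indic_mul R _ (measurableTypeR R) mu _ (fun x : R => 0 < x < t)); last first.
    by move=> x; rewrite /= in_itv.
  rewrite (@integral_indic_mul R _ (measurableTypeR R) mu
    [set x : R | `|x| < t] (fun x : R => `|x| < t))//.
  apply: eq_integral => x _; congr EFin; rewrite /f.
  case: (ltP 0 x) => x0 /=; last by rewrite !mul0r mulr0.
  by rewrite gtr0_norm// mul1r.
rewrite /eGamma (@integral_indic_mul R _ (measurableTypeR R) mu _ (fun x : R => 0 < x)); last first.
  by move=> x; rewrite /= in_itv/= andbT.
rewrite -ge0_integralZl; [|exact: measurableT| | |]; last 3 first.
- by apply/measurable_EFinP; exact: mf_gamma1.
- by move=> t _; rewrite lee_fin !mulr_ge0 ?powR_ge0 ?expR_ge0.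
- by rewrite lee_fin ltW.
apply: eq_integral => x _; rewrite integral_expRN_ray -!EFinM; congr EFin.
rewrite /f; case: (ltP 0 x) => x0; last by rewrite !mul0r mulr0.
by rewrite gtr0_norm// !mul1r mulrA.
Qed.

Lemma kappa_gt0 n : (0 < n)%N -> 0 < kappa n :> R.
Proof.
move=> n0; rewrite lt_def kappa_ge0 andbT; apply/eqP => k0.
have := kappa_eGamma n0; rewrite k0 mul0e => /esym/eqP.
by rewrite eqe gt_eqF// exprn_gt0// sqrtr_gt0 pi_gt0.
Qed.

(** Equality holds when the Gamma integral at [n/2] is a nonzero real, by [kappa_eGamma] and the
    functional equation. If it were infinite or zero, [fine] or the division would return [0], and
    the bound is trivial; the sharp constant only has to be bounded from above. *)
Lemma sphere_area_le n : (2 < n)%N ->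
  2 * pi `^ (n%:R / 2) / Gamma (n%:R / 2) <= n%:R * kappa n :> R.
Proof.
move=> n2; have n0 : (0 < n)%N by exact: ltn_trans n2.
have n21 : 1 < n%:R / 2 :> R by rewrite ltr_pdivlMr// mul1r ltr_nat.
have := kappa_eGamma n0; rewrite eGammaD1// => E.
have -> : Gamma (n%:R / 2) = fine (eGamma (n%:R / 2)) by [].
have -> : pi `^ (n%:R / 2) = Num.sqrt pi ^+ n :> R.
  rewrite -powR12_sqrt ?pi_ge0// -powR_mulrn ?powR_ge0// -powRrM; congr (_ `^ _).
  by rewrite mulrC.
have := eGamma_ge0 (n%:R / 2); case: (eGamma _) E => [g E g0|E _|//]; last first.
  by rewrite /= invr0 mulr0 mulr_ge0// kappa_ge0.
move: E; rewrite -!EFinM => -[<-] /=.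
have [->|gn0] := eqVneq g 0; first by rewrite invr0 mulr0 mulr_ge0// kappa_ge0.
by rewrite le_eqVlt; apply/orP; left; apply/eqP; field.
Qed.

(** The ratio is [a] times the square of [Gamma a] divided by [Gamma (2 * a)], which [eGamma_beta]
    evaluates. The degenerate values of the integrals make the left side [0]. *)
Lemma Gamma_ratio_le (a B : R) : 1 < a ->
  (\int[mu]_(z in `]0%R, +oo[%classic) (z `^ (a - 1) * (1 + z) `^ (- (2 * a)))%:E = B%:E)%E ->
  Gamma a * Gamma (a + 1) / Gamma (2 * a) <= a * B.
Proof.
move=> a1 BE; have a0 : 0 <= a by rewrite ltW// (lt_trans _ a1).
have B0 : 0 <= B.
  rewrite -lee_fin -BE; apply: integral_ge0 => z _.
  by rewrite lee_fin mulr_ge0 ?powR_ge0.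
have -> : Gamma a = fine (eGamma a) by [].
have -> : Gamma (a + 1) = fine (eGamma (a + 1)) by [].
have -> : Gamma (2 * a) = fine (eGamma (2 * a)) by [].
have := eGamma_beta a; rewrite BE eGammaD1//.
have := eGamma_ge0 (2 * a); case: (eGamma (2 * a)) => [g g0|_ _|//]; last first.
  by rewrite /= invr0 mulr0 mulr_ge0.
have := eGamma_ge0 a; case: (eGamma a) => [h h0|_ _|//]; last first.
  by rewrite /= mul0r mul0r mulr_ge0.
rewrite -!EFinM => -[E] /=.
have [->|gn0] := eqVneq g 0; first by rewrite invr0 mulr0 mulr_ge0.
by rewrite mulrCA E le_eqVlt; apply/orP; left; apply/eqP; field.
Qed.

End gamma_integrals.

(** * The one-dimensional inequality *)

Section bliss_profile.
Context {R : realType}.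
Variable p : R.
Hypothesis p0 : 0 < p.
Local Notation mu := (@lebesgue_measure R).

Definition psi (y : R) : R := Num.sqrt (1 - y `^ (p / 2)) / 4.
Definition Psi (y : R) : R := (\int[mu]_(t in `[0%R, y]) psi t)%R.

Let p20 : 0 < p / 2. Proof. by rewrite divr_gt0. Qed.

Lemma psi_ge0 y : 0 <= psi y. Proof. by rewrite divr_ge0 ?sqrtr_ge0. Qed.

Lemma psi_decr x y : 0 <= x -> x <= y -> psi y <= psi x.
Proof.
move=> x0 xy; rewrite /psi ler_pM2r ?invr_gt0// ler_wsqrtr// lerB//.
by rewrite ge0_ler_powR ?nnegrE ?(ltW p20)// (le_trans x0).
Qed.

Let psi_cvg (F : set_system R) (FF : Filter F) (l : R) :
  (y `^ (p / 2)) @[y --> F] --> l -> psi y @[y --> F] --> Num.sqrt (1 - l) / 4.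
Proof.
move=> h; apply: cvgM; last exact: cvg_cst.
apply: (@cvg_comp _ _ _ _ _ _ (nbhs (1 - l))); last exact: sqrt_continuous.
by apply: cvgB => //; exact: cvg_cst.
Qed.

Lemma continuous_psi y : 0 < y -> {for y, continuous psi}.
Proof. by move=> y0; apply: psi_cvg; exact: continuous_powR_gt0. Qed.

Lemma continuous_psi_segment : {within `[0, 1], continuous psi}.
Proof.
apply/continuous_within_itvP => //; split.
- by move=> x; rewrite in_itv/= => /andP[x0 _]; exact: continuous_psi.
- by apply: psi_cvg; exact: powR_cvg_right0.
- by apply: cvg_at_left_filter; exact: continuous_psi.
Qed.

Let psi_integrable : mu.-integrable `[0%R, 1%R] (EFin \o psi).
Proof.
apply: continuous_compact_integrable; first exact: segment_compact.
exact: continuous_psi_segment.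
Qed.

Lemma is_derive_Psi (y : R) : 0 < y < 1 -> is_derive y 1 Psi (psi y).
Proof.
move=> /andP[y0 y1].
have [d <-] := continuous_FTC1_closed y1 psi_integrable y0 (continuous_psi y0).
by rewrite derive1E; apply: DeriveDef.
Qed.

Lemma continuous_Psi_segment : {within `[0, 1], continuous Psi}.
Proof. by apply: parameterized_integral_continuous => //; exact: psi_integrable. Qed.

Lemma Psi0 : Psi 0 = 0.
Proof. by rewrite /Psi set_itv1 Rintegral_set1. Qed.

(** Concavity of [Psi]: its derivative [psi] decreases, so the slope at the left end dominates in
    the mean value theorem. *)
Lemma Psi_increment x y : 0 <= x -> x <= y -> y <= 1 ->
  0 <= Psi y - Psi x <= psi x * (y - x).
Proof.
move=> x0 xy y1; have [||c] := @MVT_segment R Psi psi x y xy.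
- move=> z; rewrite in_itv/= => /andP[xz zy]; apply: is_derive_Psi.
  by rewrite (le_lt_trans x0 xz) (lt_le_trans zy y1).
- apply: continuous_subspaceW continuous_Psi_segment => z /=.
  by rewrite !in_itv/= => /andP[xz zy]; rewrite (le_trans x0 xz) (le_trans zy y1).
rewrite in_itv/= => /andP[xc cy] ->; rewrite mulr_ge0 ?psi_ge0 ?subr_ge0//=.
by rewrite ler_wpM2r ?subr_ge0// psi_decr.
Qed.

Lemma Psi_le y : 0 <= y -> y <= 1 -> Psi y <= y / 4.
Proof.
move=> y0 y1; have /andP[_] := Psi_increment (lexx 0) y0 y1.
rewrite Psi0 !subr0 mulrC => /le_trans; apply; rewrite ler_wpM2l// /psi.
by rewrite powR0 ?gt_eqF// subr0 sqrtr1 mul1r.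
Qed.

Lemma Psi_lip x y : 0 <= x <= 1 -> 0 <= y <= 1 -> `|Psi x - Psi y| <= `|x - y|.
Proof.
wlog yx : x y / y <= x => [h|] /andP[x0 x1] /andP[y0 y1].
  by have [?|?] := leP y x; [|rewrite distrC [leRHS]distrC];
    apply: h; rewrite ?x0 ?x1 ?y0 ?y1// ltW.
have /andP[h1 h2] := Psi_increment y0 yx x1.
rewrite !ger0_norm ?subr_ge0 ?(le_trans h2)//; last by rewrite -subr_ge0.
rewrite -[leRHS]mul1r ler_wpM2r ?subr_ge0//.
rewrite /psi ler_pdivrMr// mul1r (@le_trans _ _ 1)//; last by rewrite ler1n.
by rewrite -[leRHS]sqrtr1 ler_wsqrtr// gerBl powR_ge0.
Qed.

Lemma cvg_Psi (T : Type) (F : set_system T) (FF : Filter F) (f : T -> R) (l : R) :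
  (\forall z \near F, 0 <= f z <= 1) -> 0 <= l <= 1 ->
  f z @[z --> F] --> l -> Psi (f z) @[z --> F] --> Psi l.
Proof.
move=> nf l01 /cvgrPdist_lt fl; apply/cvgrPdist_lt => e e0.
near=> z; apply: le_lt_trans (Psi_lip l01 _) _; first by near: z.
by near: z; exact: fl.
Unshelve. all: end_near. Qed.

Lemma cvg_powR0 (T : Type) (F : set_system T) (FF : Filter F) (f : T -> R) (s : R) :
  0 < s -> (\forall z \near F, 0 <= f z) ->
  f z @[z --> F] --> 0 -> (f z) `^ s @[z --> F] --> 0.
Proof.
move=> s0 nf /cvgrPdist_lt fl; apply/cvgrPdist_lt => e e0.
have e0' : 0 < e `^ s^-1 by rewrite powR_gt0.
near=> z; have fz0 : 0 <= f z by near: z.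
rewrite sub0r normrN ger0_norm ?powR_ge0//.
rewrite -[ltRHS](powRr1 (ltW e0)) -[X in _ < e `^ X](mulVf (lt0r_neq0 s0)).
rewrite powRrM gt0_ltr_powR ?nnegrE ?powR_ge0//.
have : `|0 - f z| < e `^ s^-1 by near: z; exact: fl.
by rewrite sub0r normrN ger0_norm.
Unshelve. all: end_near. Qed.

Let al := 1 + 2 / p.
(** With [z = exp (p s / 2)] this is the square of the profile [w = sech (p s / 4)^(2/p)], a
    solution of [w'^2 = w^2 (1 - w^p) / 4], the equality case of the one-dimensional inequality.
    Along it [psi (Y z)] is [|z - 1| / (4 (z + 1))], up to its sign a rational function. *)
Let Y (z : R) : R := (4 * z / (1 + z) ^+ 2) `^ (al - 1).

Let al1 : 0 < al - 1. Proof. by rewrite /al addrAC subrr add0r divr_gt0. Qed.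

Let base_gt0 (z : R) : 0 < z -> 0 < 4 * z / (1 + z) ^+ 2.
Proof. by move=> z0; apply: divr_gt0; [rewrite mulr_gt0|rewrite exprn_gt0// addr_gt0]. Qed.

Let baseE (z : R) : 0 < z -> 1 - 4 * z / (1 + z) ^+ 2 = ((z - 1) / (z + 1)) ^+ 2.
Proof. by move=> z0; field; rewrite gt_eqF// addr_gt0. Qed.

Let Y01 (z : R) : 0 < z -> z != 1 -> 0 < Y z < 1.
Proof.
move=> z0 z1; rewrite powR_gt0 ?base_gt0//=.
have e1 : 1 `^ (al - 1) = 1 :> R by rewrite powR1.
rewrite -[ltRHS]e1 gt0_ltr_powR ?nnegrE ?ler01 ?(ltW (base_gt0 z0))//.
rewrite -subr_gt0 baseE// exprn_even_gt0//= mulf_neq0 ?subr_eq0//.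
by rewrite invr_neq0// gt_eqF// addr_gt0.
Qed.

Let psi_Y (z : R) : 0 < z -> psi (Y z) = `|z - 1| / (z + 1) / 4.
Proof.
move=> z0; rewrite /psi /Y -powRrM (_ : (al - 1) * (p / 2) = 1); last first.
  by rewrite /al; field; rewrite gt_eqF.
rewrite powRr1 ?(ltW (base_gt0 z0))// baseE// sqrtr_sqr normrM normfV.
by rewrite [`|z + 1|]gtr0_norm// addr_gt0.
Qed.

Let YE (z : R) : 0 < z ->
  z `^ (al - 1) * (1 + z) `^ (- (2 * al)) = 4 `^ (1 - al) * (Y z / (1 + z) ^+ 2).
Proof.
move=> z0; have z1 : 0 < 1 + z by rewrite addr_gt0.
rewrite /Y powRM ?invr_ge0 ?exprn_ge0 ?mulr_ge0 ?(ltW z0) ?(ltW z1)//.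
rewrite powRM ?(ltW z0)//.
have -> : ((1 + z) ^+ 2)^-1 `^ (al - 1) = (1 + z) `^ (- (2 * (al - 1))).
  by rewrite -powR_invn ?(ltW z1)// -powRrM mulNr.
have -> : ((1 + z) ^+ 2)^-1 = (1 + z) `^ (- 2).
  by rewrite -powR_invn ?(ltW z1).
rewrite -!mulrA -powRD ?(negbT (gt_eqF z1)) ?implybT// mulrA -powRD ?pnatr_eq0 ?implybT//.
have -> : 1 - al + (al - 1) = 0 by ring.
rewrite powRr0 mul1r; congr (_ * _ `^ _); ring.
Qed.

Let dV (z : R) : 0 < z -> is_derive z 1 (fun z : R => (z + 1)^-1) (- (z + 1) ^- 2).
Proof.
move=> z0; have z10 : z + 1 != 0 by rewrite gt_eqF// addr_gt0.
have dz : is_derive z 1 (fun z : R => z + 1) 1 by apply: is_derive_eq; rewrite addr0.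
apply: DeriveDef; first exact: derivableV.
by rewrite deriveV// derive_val /GRing.scale /= mulr1.
Qed.

Let dY (z : R) : 0 < z -> derivable Y z 1.
Proof.
move=> z0; have dVz := dV z0.
have z1 : (z + 1)^-1 != 0 by rewrite invr_neq0// gt_eqF// addr_gt0.
have -> : Y = (@powR R ^~ (al - 1)) \o (fun z => 4 * z * ((z + 1)^-1 * (z + 1)^-1)).
  by apply/funext => x; rewrite /Y /= [1 + x]addrC -invfM -expr2.
have b0 : 0 < 4 * z * ((z + 1)^-1 * (z + 1)^-1).
  by rewrite -invfM -expr2 [z + 1]addrC base_gt0.
apply/derivable1_diffP; apply: differentiable_comp.
  apply/derivable1_diffP; apply: derivableM.
    by apply: derivableM; [exact: derivable_cst|exact: derivable_id].
  by apply: derivableM; have [] := dVz.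
by apply/derivable1_diffP; have [] := is_derive1_powR (al - 1) b0.
Qed.

Let U (z : R) : R := 1 - 2 * (z + 1)^-1.

Let dU (z : R) : 0 < z -> is_derive z 1 U (2 * (z + 1) ^- 2).
Proof.
move=> z0; have D := is_deriveB (is_derive_cst (1 : R) z 1) (is_deriveZ 2 (dV z0)).
by apply: (is_derive_eq D); rewrite sub0r scalerN opprK.
Qed.

(** An antiderivative of the Beta integrand, found by parts: by [YE] the integrand is a constant
    times [Y / (1 + z)^2], [U] is [(z - 1) / (z + 1)] with derivative [2 / (z + 1)^2], and [Y' U] is
    [4 s] times the derivative of [Psi (Y z)], where [s] is the sign of [z - 1]. *)
Let H (s z : R) : R := - (2 * 4 `^ (1 - al)) * (s * Psi (Y z) - 4^-1 * (Y z * U z)).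

Let dH (s z : R) : 0 < z -> z != 1 -> s * `|z - 1| = z - 1 ->
  is_derive z 1 (H s) (z `^ (al - 1) * (1 + z) `^ (- (2 * al))).
Proof.
move=> z0 z1 sz.
have DY : is_derive z 1 Y ('D_1 Y z) by apply: DeriveDef; first exact: dY.
have z10 : z + 1 != 0 by rewrite gt_eqF// addr_gt0.
have DPsi : is_derive z 1 (Psi \o Y) (psi (Y z) * 'D_1 Y z).
  by apply: is_derive1_comp; apply: is_derive_Psi; exact: Y01.
have D := is_deriveZ (- (2 * 4 `^ (1 - al)))
  (is_deriveB (is_deriveZ s DPsi) (is_deriveZ (4^-1) (is_deriveM DY (dU z0)))).
apply: (is_derive_eq D); rewrite (YE z0) (psi_Y z0) /GRing.scale /= /U.
have -> : s * (`|z - 1| / (z + 1) / 4 * 'D_1 Y z) =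
    (z - 1) / (z + 1) / 4 * 'D_1 Y z by rewrite -[in RHS]sz; ring.
by rewrite [1 + z]addrC; field.
Qed.

Let Y_01 (z : R) : 0 <= z -> 0 <= Y z <= 1.
Proof.
rewrite le_eqVlt => /predU1P[<-|z0].
  by rewrite /Y mulr0 mul0r powR0 ?lexx ?ler01// gt_eqF.
have [->|z1] := eqVneq z 1.
  rewrite /Y (_ : 4 * 1 / (1 + 1) ^+ 2 = 1); last by field.
  by rewrite powR1 lexx ler01.
by have /andP[/ltW -> /ltW ->] := Y01 z0 z1.
Qed.

Let H_bound (s z : R) : `|s| <= 1 -> 0 <= z -> `|H s z| <= 2 * 4 `^ (1 - al) * Y z.
Proof.
move=> s1 z0; have /andP[Y0 Y1] := Y_01 z0.
have c0 : 0 <= 2 * 4 `^ (1 - al) by rewrite mulr_ge0// powR_ge0.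
rewrite /H normrM normrN (ger0_norm c0) ler_wpM2l//.
have U1 : `|U z| <= 1.
  have z1 : 0 < z + 1 by rewrite ltr_wpDl.
  have h1 : 0 < (z + 1)^-1 by rewrite invr_gt0.
  have h2 : (z + 1)^-1 <= 1 by rewrite invf_le1// lerDr.
  by rewrite /U ler_norml; apply/andP; split; lra.
have h1 : `|s * Psi (Y z)| <= Y z / 4.
  rewrite normrM -[leRHS]mul1r ler_pM//.
  have /andP[P0 _] := Psi_increment (lexx 0) Y0 Y1.
  by rewrite ger0_norm ?Psi_le//; move: P0; rewrite Psi0 subr0.
have h2 : `|4^-1 * (Y z * U z)| <= Y z / 4.
  rewrite normrM ger0_norm// mulrC ler_wpM2r// normrM -[leRHS]mulr1.
  by rewrite ger0_norm// ler_wpM2l.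
by rewrite (le_trans (ler_normB _ _))//; lra.
Qed.

Let H0 s : H s 0 = 0.
Proof.
rewrite /H; have -> : Y 0 = 0 by rewrite /Y mulr0 mul0r powR0// gt_eqF.
by rewrite Psi0 mul0r !mulr0 subr0 mulr0.
Qed.

Let H1 s : H s 1 = - (2 * 4 `^ (1 - al)) * (s * Psi 1).
Proof.
rewrite /H /U (_ : 1 - 2 * (1 + 1)^-1 = 0); last by field.
by rewrite !mulr0 subr0 /Y (_ : 4 * 1 / (1 + 1) ^+ 2 = 1) ?powR1//; field.
Qed.

Let H_cvg0 (F : set_system R) (FF : Filter F) s : `|s| <= 1 ->
  (\forall z \near F, 0 <= z) -> (4 * z / (1 + z) ^+ 2) @[z --> F] --> (0 : R) ->
  H s z @[z --> F] --> 0.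
Proof.
move=> s1 F0 Fb.
have hY : 2 * 4 `^ (1 - al) * Y z @[z --> F] --> 0.
  rewrite -(mulr0 (2 * 4 `^ (1 - al))); apply: cvgM; first exact: cvg_cst.
  apply: cvg_powR0 => //; near=> z; have z0 : 0 <= z by near: z.
  by apply: divr_ge0; [rewrite mulr_ge0|rewrite exprn_ge0// addr_ge0].
apply: (squeeze_cvgr (f := fun z => - (2 * 4 `^ (1 - al) * Y z))
  (h := fun z => 2 * 4 `^ (1 - al) * Y z)) => //.
- near=> z; rewrite -ler_norml; apply: H_bound => //; by near: z.
- by rewrite -oppr0; exact: cvgN.
Unshelve. all: end_near. Qed.

Let H_cvg1 s : {for 1, continuous (H s)}.
Proof.
have cY : {for 1, continuous Y}.
  apply: differentiable_continuous; apply/derivable1_diffP; exact: dY.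
have cU : {for 1, continuous U}.
  apply: differentiable_continuous; apply/derivable1_diffP.
  by have [] := dU (ltr01 : 0 < 1 :> R).
apply: cvgM; first exact: cvg_cst.
apply: cvgB; apply: cvgM; [exact: cvg_cst| |exact: cvg_cst|exact: cvgM].
apply: cvg_Psi => //; last exact: Y_01.
by near=> z; apply: Y_01; apply: ltW; near: z; exact: lt_nbhsr.
Unshelve. all: end_near. Qed.

(** The half-line is split at [z = 1], where [Y] attains its maximum [1] and the sign [s] changes.
    [H] tends to [0] at both [0] and infinity because [Y] does, and each half contributes
    [2 * 4^(1 - al) * Psi 1]. *)
Lemma beta_integral_Psi :
  (\int[mu]_(z in `]0%R, +oo[%classic) (z `^ (al - 1) * (1 + z) `^ (- (2 * al)))%:E =
   (4 `^ (2 - al) * Psi 1)%:E)%E.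
Proof.
pose b (z : R) := z `^ (al - 1) * (1 + z) `^ (- (2 * al)).
have b0 z : 0 <= b z by rewrite mulr_ge0// powR_ge0.
have cb1 (z : R) : 0 <= z -> {for z, continuous (fun z : R => (1 + z) `^ (- (2 * al)))}.
  move=> z0; apply: (@continuous_comp _ _ _ (fun z : R => 1 + z) (@powR R ^~ _)).
    by apply: cvgD; [exact: cvg_cst|exact: cvg_id].
  by apply: continuous_powR_gt0; rewrite ltr_pwDl.
have cb (z : R) : 0 < z -> {for z, continuous b}.
  move=> z0; apply: cvgM; first exact: continuous_powR_gt0.
  by apply: cb1; exact: ltW.
have mb : measurable_fun [set: measurableTypeR R] b.
  apply: measurable_funM => //.
  apply: (@measurableT_comp _ _ _ _ _ _
    (fun t : measurableTypeR R => t `^ (- (2 * al)) : R)) => //.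
  exact: measurable_funD.
have bc : 2 * 4 `^ (1 - al) * Psi 1 + 2 * 4 `^ (1 - al) * Psi 1 = 4 `^ (2 - al) * Psi 1.
  have -> : 2 - al = 1 + (1 - al) by ring.
  by rewrite [in RHS]powRD ?pnatr_eq0 ?implybT// powRr1//; ring.
have I1 : (\int[mu]_(z in `[0%R, 1%R]) (b z)%:E = (2 * 4 `^ (1 - al) * Psi 1)%:E)%E.
  rewrite (@continuous_FTC2 R b (H (-1))) ?ltr01//.
  - by rewrite H0 H1 sube0; congr EFin; ring.
  - apply/continuous_within_itvP => //; split.
    + by move=> z; rewrite in_itv/= => /andP[z0 _]; exact: cb.
    + apply: cvgM; first exact: powR_cvg_right0.
      by apply: cvg_at_right_filter; exact: cb1.
    + by apply: cvg_at_left_filter; exact: cb.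
  - split.
    + move=> z; rewrite in_itv/= => /andP[z0 z1].
      have [|//] := @dH (-1) z z0 (negbT (lt_eqF z1)).
      by rewrite ltr0_norm ?subr_lt0// mulN1r opprK.
    + rewrite H0; apply: H_cvg0.
      * by rewrite normrN1.
      * by near=> z.
      * apply/cvgrPdist_lt => e e0; near=> z.
        have z0 : 0 < z by [].
        have ze : z < e / 4 by near: z; apply: nbhs_right_lt; rewrite divr_gt0.
        rewrite sub0r normrN ger0_norm ?(ltW (base_gt0 z0))//.
        rewrite (@le_lt_trans _ _ (4 * z))//; last by rewrite mulrC -ltr_pdivlMr.
        rewrite ler_pdivrMr ?exprn_gt0 ?addr_gt0// ler_peMr ?mulr_ge0 ?(ltW z0)//.
        by rewrite exprn_ege1// lerDl ltW.
    + by apply: cvg_at_left_filter; exact: H_cvg1.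
  - move=> z; rewrite in_itv/= => /andP[z0 z1]; rewrite derive1E.
    have [|//] := @dH (-1) z z0 (negbT (lt_eqF z1)).
    by rewrite ltr0_norm ?subr_lt0// mulN1r opprK.
have I2 : (\int[mu]_(z in `[1%R, +oo[) (b z)%:E = (2 * 4 `^ (1 - al) * Psi 1)%:E)%E.
  have E := @ge0_continuous_FTC2y R b (H 1) 1 0.
  rewrite E; clear E.
  - by rewrite H1 sub0e -EFinN; congr EFin; ring.
  - by move=> z _; exact: b0.
  - apply: continuous_in_subspaceT => z; rewrite inE/= in_itv/= andbT => z1.
    by apply: cb; exact: lt_le_trans z1.
  - apply: H_cvg0.
    + by rewrite normr1.
    + exact: nbhs_pinfty_ge.
    + apply/cvgrPdist_lt => e e0; near=> z.
      have z0 : 0 < z by near: z; exact: nbhs_pinfty_gt.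
      have ze : 4 / e < z by near: z; apply: nbhs_pinfty_gt; exact: num_real.
      rewrite sub0r normrN ger0_norm ?(ltW (base_gt0 z0))//.
      rewrite ltr_pdivrMr ?exprn_gt0 ?addr_gt0//.
      move: ze; rewrite ltr_pdivrMr// => ze.
      rewrite (@lt_le_trans _ _ (z * e * z))//; first by rewrite ltr_pM2r.
      rewrite [z * e]mulrC -mulrA ler_wpM2l ?(ltW e0)// -expr2.
      by rewrite lerXn2r ?nnegrE ?addr_ge0 ?lerDr// ltW.
  - move=> z z1; have [|//] := @dH 1 z (lt_trans ltr01 z1) (negbT (gt_eqF z1)).
    by rewrite gtr0_norm ?subr_gt0// mul1r.
  - by apply: cvg_at_right_filter; exact: H_cvg1.
  - move=> z; rewrite in_itv/= andbT => z1; rewrite derive1E.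
    have [|//] := @dH 1 z (lt_trans ltr01 z1) (negbT (gt_eqF z1)).
    by rewrite gtr0_norm ?subr_gt0// mul1r.
have -> : `]0%R, +oo[%classic = `]0%R, 1%R] `|` `]1%R, +oo[ :> set R.
  by rewrite -itv_bndbnd_setU// bnd_simp.
rewrite ge0_integral_setU//=; last 3 first.
- apply/measurable_EFinP; exact: measurable_funTS.
- by move=> z _; rewrite lee_fin; exact: b0.
- apply/disj_setPS => z [] /=; rewrite !in_itv/= => /andP[_ z1].
  by rewrite andbT ltNge z1.
rewrite -bc EFinD -{1}I1 -I2; congr (_ + _)%E.
  by rewrite integral_itv_obnd_cbnd//; apply/measurable_EFinP; exact: measurable_funTS.
by rewrite integral_itv_obnd_cbnd//; apply/measurable_EFinP; exact: measurable_funTS.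
Unshelve. all: end_near. Qed.

End bliss_profile.

(** * The one-dimensional inequality for finite differences *)

Section discrete_bliss.
Context {R : realType}.

(** For [r <= p / (1 + p)] the right side is at least [1]. Otherwise
    [r^p >= 1 + p ln r >= 1 - p (1/r - 1)], and [p / r] is less than [1 + p]. *)
Lemma one_sub_powR_le (p r : R) : 0 < p -> 0 <= r <= 1 ->
  1 - r `^ p <= (1 + p) * (1 - r).
Proof.
move=> p0 /andP[r0 r1]; have pr0 := powR_ge0 r p.
have [rp|rp] := leP r (p / (1 + p)).
  have : r * (1 + p) <= p by rewrite -ler_pdivlMr// addr_gt0.
  by nra.
have r00 : 0 < r by apply: lt_trans rp; rewrite divr_gt0// addr_gt0.
have rp' : p < r * (1 + p) by rewrite -ltr_pdivrMr// addr_gt0.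
have h : 1 + p * (1 - r^-1) <= r `^ p.
  rewrite /powR gt_eqF//; apply: le_trans (expR_ge1Dx _); rewrite lerD2l.
  apply: ler_wpM2l; first exact: ltW.
  have rV : 0 < r^-1 by rewrite invr_gt0.
  have x1 : -1 < r^-1 - 1 by lra.
  have := le_ln1Dx x1; rewrite (_ : 1 + (r^-1 - 1) = r^-1); last by ring.
  by rewrite lnV ?posrE//; lra.
have : p * (r^-1 - 1) <= (1 + p) * (1 - r); last by lra.
rewrite (_ : p * (r^-1 - 1) = p / r * (1 - r)); last by field; rewrite gt_eqF.
rewrite ler_wpM2r ?subr_ge0// ler_pdivrMr// mulrC; exact: ltW.
Qed.

Variable p : R.
Hypothesis p0 : 0 < p.

Let weighted_square (tau D S dl m : R) : 0 < tau -> D * tau = dl ^+ 2 ->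
  S * dl * m <= D + tau * S ^+ 2 * m ^+ 2 / 4.
Proof.
move=> t0 Dd; rewrite -subr_ge0 -(pmulr_rge0 _ t0).
have -> : tau * (D + tau * S ^+ 2 * m ^+ 2 / 4 - S * dl * m) =
  (dl - tau * S * m / 2) ^+ 2 by rewrite mulrBr mulrDr [tau * D]mulrC Dd; field.
exact: sqr_ge0.
Qed.

Let psi_sqr (a : R) : 0 <= a <= 1 ->
  exists S, [/\ 0 <= S, S ^+ 2 = 1 - a `^ p & psi p (a ^+ 2) = S / 4].
Proof.
move=> /andP[a0 a1]; exists (Num.sqrt (1 - a `^ p)).
have ap : a `^ p <= 1.
  have e1 : 1 `^ p = 1 :> R by rewrite powR1.
  by rewrite -[leRHS]e1 ge0_ler_powR ?nnegrE// ltW.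
split; [exact: sqrtr_ge0|by rewrite sqr_sqrtr ?subr_ge0|].
rewrite /psi -powR_mulrn// -powRrM (_ : 2%:R * (p / 2) = p)//.
by rewrite mulrC divfK// pnatr_eq0.
Qed.

(** Concavity of [Psi] bounds the left side by [S |b - a| (a + b) / 2], with [S / 4] the value of
    [psi] at the smaller of [a^2] and [b^2]; completing a square yields the quadratic form with
    midpoint [(a + b) / 2]. Replacing the midpoint by [a] costs at most [O(tau)] times the form.
    When [b < a], [S] involves [b^p], and [one_sub_powR_le] trades it for [a^p], whence the [p] in
    the error factor. *)
Lemma discrete_bliss_step (tau a b : R) : 0 < tau -> tau <= 1 ->
  0 <= a <= 1 -> 0 <= b <= 1 ->
  2 * `|Psi p (b ^+ 2) - Psi p (a ^+ 2)| <=
  (1 + (p + 2) * tau) * ((b - a) ^+ 2 / tau + tau * a ^+ 2 / 4)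
    - tau / 4 * (a ^+ 2 * a `^ p).
Proof.
move=> t0 t1 a01 b01; have /andP[a0 a1] := a01; have /andP[b0 b1] := b01.
set D := (b - a) ^+ 2 / tau.
have DE : D * tau = (b - a) ^+ 2 by rewrite divfK// gt_eqF.
have D0 : 0 <= D by rewrite divr_ge0 ?sqr_ge0// ltW.
set e := D + _.
have ta0 : 0 <= tau * a ^+ 2 / 4 by rewrite divr_ge0// mulr_ge0 ?sqr_ge0// ltW.
have De : D <= e by rewrite lerDl.
have sqr01 (x : R) : 0 <= x <= 1 -> 0 <= x ^+ 2 <= 1.
  by move=> /andP[x0 x1]; rewrite sqr_ge0 exprn_ile1.
have /andP[aa0 aa1] := sqr01 a a01; have /andP[bb0 bb1] := sqr01 b b01.
have ap0 := powR_ge0 a p.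
have ade (dl : R) : D * tau = dl ^+ 2 -> a * dl <= e.
  by move=> /(weighted_square 1 a t0); rewrite /e expr1n; lra.
have te : tau * D <= tau * e by rewrite ler_wpM2l// ltW.
have [ab|ba] := leP a b.
  have [S [S0 S2 SE]] := psi_sqr a01.
  have aabb : a ^+ 2 <= b ^+ 2 by rewrite lerXn2r.
  have /andP[h0] := Psi_increment p0 aa0 aabb bb1; rewrite SE (ger0_norm h0) => h1.
  have h2 := weighted_square S ((a + b) / 2) t0 DE.
  have h3 := ade _ DE.
  have h4 : S ^+ 2 * ((a + b) / 2) ^+ 2 <= a ^+ 2 - a ^+ 2 * a `^ p + a * (b - a) + (b - a) ^+ 2 / 4.
    have -> : ((a + b) / 2) ^+ 2 = a ^+ 2 + (a * (b - a) + (b - a) ^+ 2 / 4) by field.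
    have k0 : 0 <= a * (b - a) + (b - a) ^+ 2 / 4.
      by rewrite addr_ge0 ?mulr_ge0 ?subr_ge0// sqr_ge0.
    by rewrite S2; nra.
  have h5 : tau * (S ^+ 2 * ((a + b) / 2) ^+ 2) <=
    tau * (a ^+ 2 - a ^+ 2 * a `^ p + a * (b - a) + (b - a) ^+ 2 / 4).
    by rewrite ler_wpM2l// ltW.
  have h6 : tau * (a * (b - a)) <= tau * e by rewrite ler_wpM2l// ltW.
  have h7 : tau * (b - a) ^+ 2 <= tau * e.
    by rewrite -DE ler_wpM2l ?(ltW t0)// (le_trans _ De)// ler_piMr.
  have pe : 0 <= p * tau * e by rewrite !mulr_ge0 ?(ltW p0) ?(ltW t0)// (le_trans D0).
  rewrite /e in h6 h7 pe *.
  by nra.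
have [S [S0 S2 SE]] := psi_sqr b01.
have bbaa : b ^+ 2 <= a ^+ 2 by rewrite lerXn2r// ltW.
have /andP[h0] := Psi_increment p0 bb0 bbaa aa1; rewrite SE distrC (ger0_norm h0) => h1.
have DE' : D * tau = (a - b) ^+ 2 by rewrite DE -sqrrN opprB.
have h2 := weighted_square S ((a + b) / 2) t0 DE'.
have h3 := ade _ DE'.
have a00 : 0 < a by exact: le_lt_trans ba.
have bp0 := powR_ge0 b p.
have ap1 : a `^ p <= 1.
  have e1 : 1 `^ p = 1 :> R by rewrite powR1.
  by rewrite -[leRHS]e1 ge0_ler_powR ?nnegrE// ltW.
have h3' : a ^+ 2 * (a `^ p - b `^ p) <= (1 + p) * (a * (a - b)).
  have ba01 : 0 <= b / a <= 1 by rewrite divr_ge0//= ler_pdivrMr// mul1r ltW.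
  have := one_sub_powR_le p0 ba01.
  have -> : (b / a) `^ p = b `^ p / a `^ p.
    by rewrite powRM ?invr_ge0// -powR_inv1// -powRrM mulN1r powRN.
  have ap00 : 0 < a `^ p by rewrite powR_gt0.
  rewrite -(ler_pM2l (_ : 0 < a ^+ 2 * a `^ p)) ?mulr_gt0 ?exprn_gt0//.
  rewrite (_ : a ^+ 2 * a `^ p * (1 - _) = a ^+ 2 * (a `^ p - b `^ p)); last first.
    by field; rewrite gt_eqF.
  move=> /le_trans; apply.
  rewrite (_ : _ * ((1 + p) * (1 - b / a)) = a `^ p * ((1 + p) * (a * (a - b)))); last first.
    by field; rewrite gt_eqF.
  rewrite ler_piMl// mulr_ge0 ?addr_ge0 ?(ltW p0)// mulr_ge0// subr_ge0 ltW//.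
have S21 : 0 <= S ^+ 2 by exact: sqr_ge0.
have m2 : ((a + b) / 2) ^+ 2 <= a ^+ 2.
  by rewrite lerXn2r ?nnegrE ?divr_ge0 ?addr_ge0// ler_pdivrMr//; lra.
have h4 : S ^+ 2 * ((a + b) / 2) ^+ 2 <= a ^+ 2 - a ^+ 2 * a `^ p + (1 + p) * (a * (a - b)).
  have : S ^+ 2 * ((a + b) / 2) ^+ 2 <= S ^+ 2 * a ^+ 2 by rewrite ler_wpM2l.
  by rewrite S2; lra.
have h5 : tau * (S ^+ 2 * ((a + b) / 2) ^+ 2) <=
  tau * (a ^+ 2 - a ^+ 2 * a `^ p + (1 + p) * (a * (a - b))).
  by rewrite ler_wpM2l// ltW.
have h6 : tau * ((1 + p) * (a * (a - b))) <= tau * ((1 + p) * e).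
  by rewrite ler_wpM2l ?(ltW t0)// ler_wpM2l// addr_ge0// ltW.
have pe : 0 <= p * tau * e by rewrite !mulr_ge0 ?(ltW p0) ?(ltW t0)// (le_trans D0).
have pe1 : 0 <= tau * e by rewrite !mulr_ge0 ?(ltW t0)// (le_trans D0).
rewrite /e in h6 pe pe1 *.
by nra.
Qed.

(** Twice the variation of [Psi (w^2)], up to the maximum at [j] and down to [0] at [L], is at least
    [4 Psi 1 - 2 Psi (w_0^2)]; the last term is at most [w_0^2 / 2] by [Psi_le]. *)
Lemma discrete_bliss_unit (tau : R) (w : nat -> R) (L j : nat) :
  0 < tau -> tau <= 1 -> (forall k, 0 <= w k <= 1) -> (j <= L)%N -> w j = 1 -> w L = 0 ->
  tau / 4 * (\sum_(0 <= k < L) w k ^+ 2 * w k `^ p) + 4 * Psi p 1 <=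
  (1 + (p + 2) * tau) *
    (\sum_(0 <= k < L) ((w k.+1 - w k) ^+ 2 / tau + tau * w k ^+ 2 / 4)) + w 0%N ^+ 2 / 2.
Proof.
move=> t0 t1 w01 jL wj wL.
pose P k := Psi p (w k ^+ 2).
have tele m n : (m <= n)%N -> `|P n - P m| <= \sum_(m <= k < n) `|P k.+1 - P k|.
  move=> mn; rewrite -telescope_sumr//; exact: ler_norm_sum.
have h1 : P j - P 0%N <= \sum_(0 <= k < j) `|P k.+1 - P k|.
  exact: le_trans (ler_norm _) (tele _ _ (leq0n _)).
have h2 : P j - P L <= \sum_(j <= k < L) `|P k.+1 - P k|.
  by apply: le_trans (tele _ _ jL); rewrite distrC ler_norm.
have h3 : 2 * \sum_(0 <= k < L) `|P k.+1 - P k| <= (1 + (p + 2) * tau) *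
    (\sum_(0 <= k < L) ((w k.+1 - w k) ^+ 2 / tau + tau * w k ^+ 2 / 4)) -
    tau / 4 * (\sum_(0 <= k < L) w k ^+ 2 * w k `^ p).
  rewrite !mulr_sumr -sumrB; apply: ler_sum => k _.
  exact: discrete_bliss_step.
move: h3; rewrite (big_cat_nat (leq0n j) jL)//= => h3.
have Pj : P j = Psi p 1 by rewrite /P wj expr1n.
have PL : P L = 0 by rewrite /P wL expr0n Psi0.
have P0 : P 0%N <= w 0%N ^+ 2 / 4.
  have /andP[w0 w1] := w01 0%N.
  by apply: Psi_le => //; rewrite ?sqr_ge0// exprn_ile1.
by lra.
Qed.

(** Dividing by the maximum [m] and multiplying the unit case by [m^2] leaves an unknown [m] on the
    left, which Young's inequality with exponents [q/2] and [al] removes. The factors [q / 8] and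
    [al] in the constant undo the division by these exponents. *)
Theorem discrete_bliss (tau : R) (w : nat -> R) (L : nat) :
  let q := p + 2 in let al := q / p in
  0 < tau -> tau <= 1 -> (forall k, 0 <= w k) -> (forall k, (L <= k)%N -> w k = 0) ->
  (q / 8) `^ (2 / q) * (al * (4 * Psi p 1)) `^ (al^-1) *
    (tau * \sum_(0 <= k < L) w k `^ q) `^ (2 / q) <=
  (1 + q * tau) *
    (\sum_(0 <= k < L) ((w k.+1 - w k) ^+ 2 / tau + tau * w k ^+ 2 / 4)) + w 0%N ^+ 2 / 2.
Proof.
move=> q al t0 t1 w0 wL.
have q0 : 0 < q by rewrite addr_gt0.
have al0 : 0 < al by rewrite divr_gt0.
have alV : al^-1 = 1 - 2 / q by rewrite /al /q; field; rewrite !gt_eqF// addr_gt0.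
set X := tau * \sum_(0 <= k < L) _; set E := \sum_(0 <= k < L) _.
have E0 : 0 <= E.
  apply: sumr_ge0 => k _; rewrite addr_ge0 ?divr_ge0 ?sqr_ge0 ?(ltW t0)//.
  by rewrite mulr_ge0 ?sqr_ge0 ?(ltW t0).
have [j wj] : exists j : 'I_L.+1, forall k, w k <= w j.
  case: (@Order.TotalTheory.arg_maxP _ _ 'I_L.+1 ord0 xpredT (fun i => w i) isT) => j _ h.
  exists j => k; have [kL|kL] := ltnP k L.
    by have := h (inord k) isT; rewrite inordK// ltnW.
  by rewrite wL.
set m := w j in wj; have m0 : 0 <= m by exact: w0.
have [m00|m1] := eqVneq m 0.
  have wz k : w k = 0 by apply/eqP; rewrite eq_le w0 -m00 wj.
  have -> : X = 0.
    by rewrite /X big1 ?mulr0// => k _; rewrite wz powR0// gt_eqF.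
  rewrite powR0 ?mulr0; last by rewrite gt_eqF// divr_gt0.
  apply: addr_ge0; last by rewrite divr_ge0 ?sqr_ge0.
  by apply: mulr_ge0 => //; rewrite addr_ge0// mulr_ge0// ltW.
have {}m1 : 0 < m by rewrite lt_def m1.
have K0 : 0 <= Psi p 1.
  have /andP[] := Psi_increment p0 (lexx 0) ler01 (lexx 1).
  by rewrite Psi0 subr0.
have X0 : 0 <= X.
  by rewrite mulr_ge0 ?(ltW t0)//; apply: sumr_ge0 => k _; exact: powR_ge0.
have main : X * m `^ (- p) / 4 + 4 * Psi p 1 * m ^+ 2 <= (1 + q * tau) * E + w 0%N ^+ 2 / 2.
  have w01 k : 0 <= w k / m <= 1 by rewrite divr_ge0//= ler_pdivrMr// mul1r.
  have := @discrete_bliss_unit tau (fun k => w k / m) L j t0 t1 w01.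
  rewrite -ltnS ltn_ord divff ?gt_eqF// wL// mul0r => /(_ isT erefl erefl).
  rewrite -(ler_pM2l (_ : 0 < m ^+ 2)) ?exprn_gt0// mulrDr mulrDr.
  rewrite (_ : m ^+ 2 * (tau / 4 * _) = X * m `^ (- p) / 4); last first.
    rewrite /X; under eq_bigr => k _.
      rewrite (_ : _ * _ = m ^- 2 * m `^ (- p) * w k `^ q); last first.
        rewrite powRM ?invr_ge0// -(powR_inv1 m0) -powRrM mulN1r powR_inv1//.
        rewrite /q powRD ?(gt_eqF q0)// powR_mulrn// exprMn exprVn; ring.
      over.
    by rewrite -mulr_sumr; field; rewrite gt_eqF.
  rewrite (_ : m ^+ 2 * (4 * Psi p 1) = 4 * Psi p 1 * m ^+ 2); last by rewrite mulrC.
  rewrite (_ : m ^+ 2 * (_ * \sum_(0 <= k < L) _) = (1 + q * tau) * E); last first.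
    rewrite mulrCA; congr (_ * _); rewrite mulr_sumr; apply: eq_bigr => k _.
    by field; rewrite !gt_eqF.
  rewrite (_ : m ^+ 2 * ((w 0%N / m) ^+ 2 / 2) = w 0%N ^+ 2 / 2)//.
  by field; rewrite gt_eqF.
apply: le_trans main.
(* weighted AM-GM; the powers of [m] cancel because [-p (2/q) + 2 (1 - 2/q) = 0] *)
pose A := q / 8 * X * m `^ (- p); pose B := al * (4 * Psi p 1) * m ^+ 2.
have A0 : 0 <= A.
  by rewrite mulr_ge0 ?powR_ge0// mulr_ge0// divr_ge0// ltW.
have B0 : 0 <= B by rewrite mulr_ge0 ?sqr_ge0// mulr_ge0 ?(ltW al0)// mulr_ge0.
have h := @conjugate_powR R (A `^ (2 / q)) (B `^ al^-1) (q / 2) al (powR_ge0 _ _) (powR_ge0 _ _)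
  (divr_gt0 q0 (ltr0Sn _ _)) al0 _.
have {h} := h ltac:(by rewrite alV invf_div; ring).
rewrite -!powRrM (_ : 2 / q * (q / 2) = 1); last by field; rewrite gt_eqF.
rewrite mulVf ?gt_eqF// !powRr1// => h.
apply: le_trans (le_trans _ h) _; last first.
  rewrite le_eqVlt; apply/orP; left; apply/eqP; rewrite /A /B /al; field.
  by rewrite !gt_eqF.
rewrite le_eqVlt; apply/orP; left; apply/eqP.
have q8 : 0 <= q / 8 by rewrite divr_ge0// ltW.
have aP : 0 <= al * (4 * Psi p 1) by rewrite mulr_ge0 ?(ltW al0)// mulr_ge0.
rewrite /A /B -(powR_mulrn _ m0).
rewrite (powRM _ (mulr_ge0 q8 X0) (powR_ge0 m (- p))) (powRM _ q8 X0) (powRM _ aP) ?powR_ge0//.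
rewrite -!powRrM.
have mm : m `^ (- p * (2 / q)) * m `^ (2%:R * al^-1) = 1.
  rewrite -powRD ?(gt_eqF m1) ?implybT// (_ : _ + _ = 0) ?powRr0//.
  by rewrite /al /q; field; rewrite !gt_eqF// addr_gt0.
rewrite -[LHS]mulr1 -[X in _ * X = _]mm; ring.
Qed.

End discrete_bliss.

(** * Energy between two levels *)

Section slab_inequality.
Context {R : realType} (n : nat).
Local Notation N := n.+1.
Local Notation mu := (@lebesgue_measure R).
(** [h] stands for the modulus and [g] for the gradient norm. The regularity hypotheses bound how
    much [h] can rise over a short distance, which controls the outer neighbourhoods of its
    superlevel sets. *)
Variables (h g : 'rV[R]_N -> R) (C1 C2 : R).
Hypotheses (mh : measurable_fun setT h) (mg : measurable_fun setT g).
Hypothesis g0 : forall x, 0 <= g x.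
Hypothesis C10 : 0 <= C1.
Hypothesis C20 : 0 < C2.
Hypothesis h_lip : forall x y, enorm y <= 1 -> h (x + y) <= h x + C2 * enorm y.
Hypothesis h_taylor : forall x y d, 0 < d -> d <= h x -> enorm y <= 1 ->
  h (x + y) <= h x + enorm y * g x + C1 / d * enorm y ^+ 2.
Hypothesis h_decay : forall t, 0 < t -> exists k, [set x | t < h x] `<=` cube N k.

(** It catches every point outside [{t < h}] at distance less than [e] from that set, provided
    [a + C2 * e <= t]: from such a point [h] rises above [t] within distance [e], and the Taylor
    bound at the point gives the last condition. *)
Let level_shell (a t e : R) : set 'rV[R]_N :=
  [set x | [/\ a < h x, h x <= t & t < h x + e * g x + C1 / a * e ^+ 2]].

Let measurable_shell_fun a e :
  measurable_fun setT (fun x => h x + e * g x + C1 / a * e ^+ 2).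
Proof.
by apply: measurable_funD => //; apply: measurable_funD => //; exact: measurable_funM.
Qed.

Let level_set_measurable t : measurable [set x | t < h x].
Proof. exact: measurable_ltr_set. Qed.

Let vol_level_set_fin t : 0 < t -> vol N [set x | t < h x] \is a fin_num.
Proof. by move=> /h_decay[k tk]; apply: vol_sub_cube tk. Qed.

(** Brunn-Minkowski for [{t < h}] and the ball of radius [e], linearised by [pow_tangent]: the
    neighbourhood gains at least the area of the sphere of radius [rho] times [e]. By the Lipschitz
    bound the condition on [t] keeps the neighbourhood above the level [a], where the Taylor error
    is [C1 / a]. *)
Lemma vol_level_shell (a t e rho : R) : 0 < a -> a + C2 * e <= t ->
  0 < e -> e <= 1 -> 0 < rho ->
  ((kappa N * rho ^+ N)%:E <= vol N [set x | (t < h x)%R])%E ->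
  ((N%:R * kappa N * rho ^+ n * e)%:E <= vol N (level_shell a t e))%E.
Proof.
move=> a0 at_ e0 e1 rho0 rhot.
have t0 : 0 < t by apply: lt_le_trans at_; rewrite addr_gt0// mulr_gt0.
have k0 : 0 < kappa N :> R by exact: kappa_gt0.
have root (x : R) : 0 < x -> exists2 y, 0 < y & y ^+ N = x.
  move=> x0; exists (x `^ N%:R^-1); first by rewrite powR_gt0.
  by rewrite -powR_mulrn ?powR_ge0// -powRrM mulVf// powRr1// ltW.
set A := [set x | t < h x] in rhot *.
have VAE := fineK (vol_level_set_fin t0); rewrite -/A in VAE.
set VA := fine _ in VAE.
have VA_ge : kappa N * rho ^+ N <= VA by rewrite -lee_fin VAE.
have [al al0 alE] : exists2 y, 0 < y & y ^+ N = VA.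
  by apply: root; apply: lt_le_trans VA_ge; rewrite mulr_gt0// exprn_gt0.
have [k1 k10 k1E] := root _ k0.
pose C := A `|` level_shell a t e.
have [k ak] := h_decay a0.
have mS : measurable (level_shell a t e).
  rewrite (_ : level_shell a t e = [set x | a < h x] `&` ([set x | h x <= t] `&`
    [set x | t < h x + e * g x + C1 / a * e ^+ 2])).
    apply: measurableI => //; apply: measurableI.
      exact: measurable_ler_set.
    exact: measurable_ltr_set.
  by apply/seteqP; split => x /= [] => [? ? ?|? []].
have mC : measurable C by apply: measurableU => //; exact: level_set_measurable.
have at' : a < t by apply: lt_le_trans at_; rewrite ltrDl mulr_gt0.
pose K := Num.max k 1.
have AK : A `<=` cube N K.
  by move=> x /= tx i; rewrite le_max (ak x (lt_trans at' tx) i).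
have h1 : eball N e `<=` cube N K.
  move=> x /(@eball_sub_cube _ _ _) xe i.
  by rewrite (le_trans (xe i))// le_max e1 orbT.
have h2 : C `<=` cube N K.
  move=> x [/AK//|[ax _ _] i].
  by rewrite le_max (ak x ax i).
have h3 x y : A x -> eball N e y -> C (x + y).
  move=> Ax ye; have y1 : enorm y <= 1 by rewrite (le_trans (ltW ye)).
  have NyE : enorm (- y) = enorm y.
    by rewrite /enorm; under eq_bigr do rewrite mxE sqrrN.
  have xE : x = x + y + (- y) by rewrite addrK.
  have [xt|xt] := ltP t (h (x + y)); [by left|right].
  have hl : h x <= h (x + y) + C2 * enorm y.
    by rewrite {1}xE -[in X in _ <= X]NyE h_lip// NyE.
  have ax : a < h (x + y).
    have : C2 * enorm y <= C2 * e by rewrite ler_pM2l// ltW.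
    by move: Ax; rewrite /A /=; lra.
  split => //; apply: lt_le_trans (_ : h x <= _) => //.
  rewrite {1}xE (le_trans (h_taylor a0 (ltW ax) _))// NyE// -!addrA lerD2l lerD//.
    by rewrite ler_wpM2r// ltW.
  rewrite ler_wpM2l ?divr_ge0 ?(ltW a0)// lerXn2r ?nnegrE ?enorm_ge0 ?(ltW e0)//.
  exact: ltW.
have : (((al + k1 * e) ^+ N)%:E <= vol N C)%E.
  apply: (@brunn_minkowski R N A (eball N e) C K) => //.
  - exact: level_set_measurable.
  - exact: measurable_eball.
  - exact: mulr_gt0.
  - by rewrite alE VAE.
  - by rewrite exprMn k1E vol_eball// ltW.
have -> : vol N C = (vol N A + vol N (level_shell a t e))%E.
  rewrite measureU//; first exact: level_set_measurable.
  by rewrite -subset0 => x [/= + [_ + _]]; rewrite leNgt => ->.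
rewrite -VAE -leeBlDl// -EFinB; apply: le_trans; rewrite lee_fin.
have k1al : k1 * rho <= al.
  rewrite -(@ler_pXn2r _ N) ?nnegrE ?mulr_ge0 ?(ltW k10) ?(ltW rho0) ?(ltW al0)//.
  by rewrite exprMn k1E alE.
have tangent := @pow_tangent R n (al + k1 * e) al.
rewrite lerBrDl -alE; apply: le_trans (tangent _ _);
  rewrite ?addr_ge0 ?mulr_ge0 ?(ltW al0) ?(ltW k10) ?(ltW e0)//.
rewrite lerD2l [al + _ - _]addrC addKr -k1E exprS.
have : (k1 * rho) ^+ n <= al ^+ n.
  by rewrite lerXn2r ?nnegrE ?mulr_ge0 ?(ltW k10) ?(ltW rho0) ?(ltW al0).
rewrite exprMn => kr.
rewrite (_ : N%:R * (k1 * k1 ^+ n) * rho ^+ n * e = N%:R * (k1 ^+ n * rho ^+ n) * (k1 * e)); last by ring.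
by rewrite ler_wpM2r ?mulr_ge0 ?(ltW k10) ?(ltW e0)// ler_wpM2l.
Qed.

Let measurable_level_shell a t e : measurable (level_shell a t e).
Proof.
rewrite (_ : level_shell a t e = [set x | a < h x] `&` ([set x | h x <= t] `&`
    [set x | t < h x + e * g x + C1 / a * e ^+ 2])).
  apply: measurableI => //; apply: measurableI; first exact: measurable_ler_set.
  exact: measurable_ltr_set.
by apply/seteqP; split => x /= [] => [? ? ?|? []].
Qed.

Lemma slab_measurable a b : measurable [set x | a < h x < b].
Proof.
rewrite (_ : [set x | _] = [set x | a < h x] `&` [set x | h x < b]).
  by apply: measurableI => //; exact: measurable_ltr_set.
by apply/seteqP; split => x /= => [/andP|[-> ->]].
Qed.

(** A coarea estimate at scale [e]: for fixed [x] the levels [t] whose shell contains [x] lie in an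
    interval of length [e * g x + C1 / a * e^2], so Tonelli turns the bound at each level into a
    bound on the slab. *)
Lemma integral_level_shell (a a1 b e M : R) : 0 < a -> 0 < e -> a1 < b -> 0 <= M ->
  (forall t, a1 < t < b -> (M%:E <= vol N (level_shell a t e))%E) ->
  (((b - a1) * M)%:E <= \int[vol N]_(x in [set x | (a < h x < b)%R])
    (e * g x + C1 / a * e ^+ 2)%:E)%E.
Proof.
move=> a0 e0 ab M0 hM.
have c0 : 0 <= C1 / a * e ^+ 2 by rewrite mulr_ge0 ?divr_ge0 ?sqr_ge0// ltW.
have eg0 x : 0 <= e * g x by rewrite mulr_ge0// ltW.
pose F x := h x + e * g x + C1 / a * e ^+ 2.
have mF : measurable_fun setT F by exact: measurable_shell_fun.
pose D : set ('rV[R]_N * measurableTypeR R) :=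
  [set p | [/\ a < h p.1, a1 < p.2, p.2 < b, h p.1 <= p.2 & p.2 < F p.1]].
have mD : measurable D.
  rewrite (_ : D = [set p | a < h p.1] `&` ([set p | a1 < p.2] `&` ([set p | p.2 < b] `&`
    ([set p | h p.1 <= p.2] `&` [set p | p.2 < F p.1])))).
    have m1 (f : 'rV[R]_N -> R) : measurable_fun setT f ->
        measurable_fun [set: 'rV[R]_N * measurableTypeR R] (fun p => f p.1).
      by move=> mf; exact: measurableT_comp.
    have m2 : measurable_fun [set: 'rV[R]_N * measurableTypeR R] (fun p => p.2 : R).
      exact: measurable_snd.
    do 4?apply: measurableI.
    - exact: (measurable_ltr_set _ (m1 _ mh)).
    - exact: measurable_ltr_set.
    - exact: measurable_ltr_set.
    - exact: (measurable_ler_set (m1 _ mh)).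
    - exact: (measurable_ltr_set _ (m1 _ mF)).
  by apply/seteqP; split => x /= [] => [? ? ? ? ?|? [? [? []]]].
have m1D : measurable_fun setT (fun p => (\1_D p)%:E : \bar R).
  exact/measurable_EFinP.
have := @fubini_tonelli _ _ _ _ R (vol N) mu _ m1D (fun=> ltac:(by rewrite lee_fin)).
move=> fub.
have h1 : (((b - a1) * M)%:E <= \int[mu]_t \int[vol N]_x (\1_D (x, t))%:E)%E.
  have muab : mu (`]a1, b[%classic : set R) = (b - a1)%:E.
    by rewrite lebesgue_measure_itv/= lte_fin ab EFinB.
  apply: (@le_trans _ _ (\int[mu]_(t in `]a1, b[) M%:E)%E).
    by rewrite integral_cst//= mulrC EFinM muab.
  rewrite integral_mkcond; apply: ge0_le_integral => //.
  - by move=> t _; rewrite patchE; case: ifPn => //; rewrite lee_fin.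
  - exact/(measurable_restrictT _ _).1.
  - have := @measurable_fun_fubini_tonelli_G _ _ _ _ R (vol N) _ m1D.
    by apply => p; rewrite lee_fin.
  - move=> t _; rewrite patchE; case: ifPn => [|_]; last first.
      by apply: integral_ge0 => x _; rewrite lee_fin.
    rewrite inE/= in_itv/= => /[dup] /andP[t1 t2] /hM /le_trans; apply.
    rewrite (_ : (fun x => _) = EFin \o \1_(level_shell a t e)); last first.
      apply/funext => x /=; rewrite !indicE; congr ((_ : bool)%:R%:E).
      by apply/idP/idP; rewrite !inE /D /= => -[].
    by rewrite integral_indic// setIT.
apply: le_trans h1 _; rewrite -fub [leRHS]integral_mkcond.
apply: ge0_le_integral => //.
- by move=> x _; apply: integral_ge0 => t _; rewrite lee_fin.
- have := @measurable_fun_fubini_tonelli_F _ _ _ _ R mu _ m1D.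
  by apply => p; rewrite lee_fin.
- apply/(measurable_restrictT _ _).1; first exact: slab_measurable.
  apply/measurable_EFinP/measurable_funTS; apply: measurable_funD => //.
  exact: measurable_funM.
- move=> x _; rewrite patchE; case: ifPn => [_|/negP xS]; last first.
    rewrite (eq_integral (cst 0%E)) ?integral0// => t _.
    rewrite indicE memNset// => -[/= ax _ tb ht _]; apply: xS.
    by rewrite inE /= ax (le_lt_trans ht tb).
  apply: (@le_trans _ _ (\int[mu]_t (\1_(`[h x, F x[%classic : set R) t)%:E)%E).
    apply: ge0_le_integral => //.
    + by apply: (measurableT_comp m1D); exact: pair1_measurable.
    + exact/measurable_EFinP.
    + move=> t _; rewrite lee_fin !indicE ler_nat.
      have [/set_mem[/= _ _ _ ht tF]|] := boolP ((x, t) \in D) => //.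
      by rewrite mem_set//= in_itv/= ht.
  have L : mu (`[h x, F x[%classic : set R) = (F x - h x)%:E.
    rewrite lebesgue_measure_itv/= lte_fin; case: ifPn => [_|]; first by rewrite EFinB.
    rewrite -leNgt => Fh; congr EFin; apply/eqP; rewrite eq_sym subr_eq0 eq_le Fh.
    by rewrite /F -addrA lerDl addr_ge0.
  apply: (@le_trans _ _ (F x - h x)%:E); first by rewrite integral_indic// setIT -L.
  by rewrite lee_fin /F; lra.
Qed.

(** The previous estimate divided by [e], for small [e]. Since [a] may be [0], the Taylor bound is
    used above [a2 = a + dl / 2], and levels start at [a1 = a + dl], which leaves room for [C2 * e].
    One half of [eps] pays for the lost levels, the other for the second-order term on a set of
    finite volume. *)
Theorem slab_isoperimetry (a b rho : R) : (0 < n)%N -> 0 <= a -> a < b -> 0 <= rho ->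
  ((kappa N * rho ^+ N)%:E <= vol N [set x | (b <= h x)%R])%E ->
  (((b - a) * (N%:R * kappa N * rho ^+ n))%:E <=
    \int[vol N]_(x in [set x | (a < h x < b)%R]) (g x)%:E)%E.
Proof.
move=> n0 a0 ab; rewrite le_eqVlt => /predU1P[<- _|rho0 rhob].
  rewrite expr0n gtn_eqF//= !mulr0.
  by apply: integral_ge0 => x _; rewrite lee_fin.
set M := N%:R * kappa N * rho ^+ n.
have M0 : 0 < M by rewrite !mulr_gt0 ?exprn_gt0// kappa_gt0.
apply/lee_addgt0Pr => eps eps0.
have M2 : 0 < 2 * M by exact: mulr_gt0.
pose dl := Num.min ((b - a) / 2) (eps / (2 * M)).
have dl0 : 0 < dl by rewrite lt_min !divr_gt0 ?subr_gt0.
have dlb : dl <= (b - a) / 2 by rewrite ge_min lexx.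
have dle : dl * M <= eps / 2.
  have : dl <= eps / (2 * M) by rewrite ge_min lexx orbT.
  by rewrite (ler_pdivlMr _ _ M2) => h1; lra.
pose a2 := a + dl / 2; pose a1 := a + dl.
have a20 : 0 < a2 by rewrite ltr_wpDl// divr_gt0.
have V0 := vol_level_set_fin a20; set V := vol N _ in V0.
have fV0 : 0 <= fine V by apply: fine_ge0; exact: measure_ge0.
pose c := C1 / a2.
have c0 : 0 <= c by rewrite divr_ge0// ltW.
have cV : 0 < 2 * (c * fine V + 1) by have := mulr_ge0 c0 fV0; lra.
pose e := Num.min 1 (Num.min (dl / (2 * C2)) (eps / (2 * (c * fine V + 1)))).
have e0 : 0 < e by rewrite !lt_min ltr01 !divr_gt0// mulr_gt0.
have e1 : e <= 1 by rewrite ge_min lexx.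
have e2 : C2 * e <= dl / 2.
  have : e <= dl / (2 * C2) by rewrite !ge_min lexx orbT.
  by rewrite ler_pdivlMr ?mulr_gt0// => h1; lra.
have e3 : e * (c * fine V) <= eps / 2.
  have : e <= eps / (2 * (c * fine V + 1)) by rewrite !ge_min lexx !orbT.
  by rewrite ler_pdivlMr// => h1; lra.
have := @integral_level_shell a2 a1 b e (M * e) a20 e0.
have a1b : a1 < b by rewrite /a1; lra.
move=> /(_ a1b (ltW (mulr_gt0 M0 e0))) H.
have {H} := H _; have hM t : a1 < t < b -> ((M * e)%:E <= vol N (level_shell a2 t e))%E.
  move=> /andP[t1 t2]; apply: vol_level_shell => //.
    by rewrite /a2; move: t1; rewrite /a1; lra.
  apply: le_trans rhob _; apply: le_measure; rewrite ?inE.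
  - exact: measurable_ler_set.
  - exact: level_set_measurable.
  - by move=> x /=; exact: lt_le_trans.
move=> /(_ hM) H.
have S2 : [set x | a2 < h x < b] `<=` [set x | a < h x < b].
  move=> x /= /andP[ax ->]; rewrite andbT (lt_trans _ ax)// /a2 ltrDl divr_gt0//.
set I := (X in (_ <= X + _)%E).
have I0 : (0 <= I)%E by apply: integral_ge0 => x _; rewrite lee_fin.
have HI : (((b - a1) * (M * e))%:E <= e%:E * (I + (e * (c * fine V))%:E))%E.
  apply: le_trans H _.
  under eq_integral do rewrite EFinD EFinM.
  have eg x : (0 <= e%:E * (g x)%:E)%E by rewrite mule_ge0// lee_fin// ltW.
  have meg (D : set 'rV[R]_N) : measurable_fun D (fun x => e%:E * (g x)%:E)%E.
    by apply: measurable_funTS; apply: emeasurable_funM => //; exact/measurable_EFinP.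
  have mgD (D : set 'rV[R]_N) : measurable_fun D (fun x => (g x)%:E).
    by apply: measurable_funTS; exact/measurable_EFinP.
  rewrite ge0_integralD; [|exact: slab_measurable|by move=> x _|exact: meg| |exact: measurable_cst];
    last by move=> x _; rewrite lee_fin mulr_ge0// exprn_ge0// ltW.
  rewrite ge0_muleDr//; last by rewrite lee_fin; exact: mulr_ge0 (ltW e0) (mulr_ge0 c0 fV0).
  apply: leeD.
    rewrite ge0_integralZl; [|exact: slab_measurable|exact: mgD|by move=> x _; rewrite lee_fin
      |by rewrite lee_fin ltW].
    rewrite lee_pmul2l ?lte_fin//; apply: ge0_subset_integral; [exact: slab_measurable
      |exact: slab_measurable|exact: mgD|by move=> x _; rewrite lee_fin|exact: S2].
  rewrite integral_cst; last exact: slab_measurable.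
  apply: (@le_trans _ _ ((c * e ^+ 2)%:E * V)%E).
    have ce0 : 0 <= c * e ^+ 2 := mulr_ge0 c0 (sqr_ge0 e).
    rewrite lee_wpmul2l ?lee_fin//.
    apply: le_measure; rewrite ?inE; [exact: slab_measurable|exact: level_set_measurable|].
    by move=> x /= /andP[].
  by rewrite -(fineK V0) -!EFinM lee_fin expr2; lra.
have : ((e * ((b - a1) * M))%:E <= e%:E * (I + (e * (c * fine V))%:E))%E.
  by apply: le_trans HI; rewrite lee_fin; lra.
rewrite EFinM lee_pmul2l ?lte_fin// => H2.
apply: (@le_trans _ _ (((b - a1) * M + eps / 2)%:E)%E).
  by rewrite lee_fin /a1; lra.
rewrite EFinD; apply: le_trans (leeD2r _ H2) _.
rewrite -addeA leeD2l// -EFinD lee_fin; lra.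
Qed.

(** Cauchy-Schwarz on the slab, by integrating [2 ps g <= g^2 + ps^2]; [ps = m / v] is the optimal
    constant. *)
Theorem slab_energy (a b rho v : R) : (0 < n)%N -> 0 <= a -> a < b -> 0 <= rho -> 0 < v ->
  ((kappa N * rho ^+ N)%:E <= vol N [set x | (b <= h x)%R])%E ->
  (vol N [set x | (a < h x < b)%R] <= v%:E)%E ->
  (((b - a) ^+ 2 * (N%:R * kappa N * rho ^+ n) ^+ 2 / v)%:E <=
    \int[vol N]_(x in [set x | (a < h x < b)%R]) (g x ^+ 2)%:E)%E.
Proof.
move=> n0 a0 ab rho0 v0 rhob volv.
have := slab_isoperimetry n0 a0 ab rho0 rhob.
set S := [set x | _] in volv *; set m := (b - a) * _ => H.
have mS : measurable S by exact: slab_measurable.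
have m0 : 0 <= m.
  by rewrite mulr_ge0 ?subr_ge0 ?(ltW ab)// !mulr_ge0// ?kappa_ge0// exprn_ge0.
pose ps := m / v; have ps0 : 0 <= ps by rewrite divr_ge0// ltW.
have -> : (b - a) ^+ 2 * (N%:R * kappa N * rho ^+ n) ^+ 2 / v = ps * m.
  by rewrite /ps /m; field; rewrite gt_eqF.
have mgS (f : 'rV[R]_N -> R) : measurable_fun setT f ->
    measurable_fun S (fun x => (f x)%:E).
  by move=> mf; apply: measurable_funTS; exact/measurable_EFinP.
have mg2 : measurable_fun setT (fun x => g x ^+ 2) by exact: measurable_funX.
have : ((2 * ps)%:E * \int[vol N]_(x in S) (g x)%:E <=
    \int[vol N]_(x in S) (g x ^+ 2)%:E + (ps ^+ 2 * v)%:E)%E.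
  apply: (@le_trans _ _ (\int[vol N]_(x in S) ((g x ^+ 2)%:E + (ps ^+ 2)%:E))%E); last first.
    rewrite ge0_integralD; [|exact: mS|by move=> x _; rewrite lee_fin sqr_ge0|exact: mgS
      |by move=> x _; rewrite lee_fin sqr_ge0|exact: measurable_cst].
    rewrite leeD2l// integral_cst// (EFinM (ps ^+ 2) v) lee_wpmul2l// lee_fin sqr_ge0//.
  rewrite -ge0_integralZl; [|exact: mS|exact: mgS|by move=> x _; rewrite lee_fin
    |by rewrite lee_fin mulr_ge0].
  apply: ge0_le_integral => //.
  - by move=> x _; rewrite -EFinM lee_fin mulr_ge0// mulr_ge0.
  - by apply: emeasurable_funM => //; exact: mgS.
  - by apply: emeasurable_funD => //; exact: mgS.
  - move=> x _; rewrite -EFinM -EFinD lee_fin.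
    by have := sqr_ge0 (g x - ps); rewrite sqrrB; lra.
have psm : ((2 * (ps * m))%:E <= (2 * ps)%:E * \int[vol N]_(x in S) (g x)%:E)%E.
  by rewrite mulrA EFinM lee_wpmul2l// lee_fin mulr_ge0.
move=> /(le_trans psm).
have -> : ps ^+ 2 * v = ps * m by rewrite /ps; field; rewrite gt_eqF.
rewrite -leeBlDr// -EFinB; apply: le_trans.
by rewrite lee_fin; lra.
Qed.

End slab_inequality.

(** * Rearrangement on a geometric lattice *)

Section monotone_limit_bound.
Context d (T : measurableType d) (R : realType) (m : {measure set T -> \bar R}).

Lemma integral_le_of_monotone_approx (D : set T) (f_ : nat -> T -> R) (f : T -> R) (c : \bar R) :
  measurable D -> (forall k, measurable_fun setT (f_ k)) ->
  (forall k x, 0 <= f_ k x) ->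
  (forall x, {homo f_ ^~ x : i j / (i <= j)%N >-> i <= j}) ->
  (forall x, f_ k x @[k --> \oo] --> f x) ->
  (forall k, (\int[m]_(x in D) (f_ k x)%:E <= c)%E) ->
  (\int[m]_(x in D) (f x)%:E <= c)%E.
Proof.
move=> mD mf f0 ndf fcvg fc.
have mfD k : measurable_fun D (fun x => (f_ k x)%:E).
  by apply: measurable_funTS; exact/measurable_EFinP.
have f0' k x : D x -> (0 <= (f_ k x)%:E)%E by rewrite lee_fin.
have nd' x : D x -> {homo (fun k => (f_ k x)%:E) : i j / (i <= j)%N >-> (i <= j)%E}.
  by move=> _ i j ij; rewrite lee_fin; exact: ndf.
have := @cvg_monotone_convergence _ _ R m D mD (fun k x => (f_ k x)%:E) mfD f0' nd'.
rewrite (eq_integral (fun x => (f x)%:E)) => [h|x _]; last first.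
  by apply/cvg_lim => //; apply: cvg_EFin; [exact: nearW|exact: fcvg].
rewrite -(cvg_lim _ h)//; apply: lime_le; first by apply/cvg_ex; eexists; exact: h.
by near=> k.
Unshelve. all: end_near. Qed.

End monotone_limit_bound.

Lemma pow_unbounded (R : realType) (y lam : R) : 1 < lam ->
  exists k0 : nat, forall k, (k0 <= k)%N -> y <= lam ^+ k.
Proof.
move=> lam1; pose k0 := Num.truncn (`|y| / (lam - 1)); exists k0.+1 => -[//|k] k0k.
have l1 : 0 < lam - 1 by rewrite subr_gt0.
have := @pow_tangent R k lam 1 (ltW (lt_trans ltr01 lam1)) ler01.
rewrite !expr1n mulr1; apply: le_trans.
have : `|y| / (lam - 1) < k0.+1%:R by rewrite -truncn_lt_nat// divr_ge0// ltW.
rewrite ltr_pdivrMr// => /ltW; have := ler_norm y.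
have : k0.+1%:R * (lam - 1) <= k.+1%:R * (lam - 1) by rewrite ler_wpM2r ?ler_nat// ltW.
by lra.
Qed.

(** * Radial weights over sets of bounded volume *)

Section radial_weight.
Context {R : realType} (n : nat).
Local Notation N := n.+1.

Definition radial_weight (b : R) (x : 'rV[R]_N) : R := enorm x `^ (- b).

Lemma radial_weight_ge0 b x : 0 <= radial_weight b x. Proof. exact: powR_ge0. Qed.

Lemma measurable_radial_weight b : measurable_fun setT (radial_weight b).
Proof.
apply: (@measurableT_comp _ _ _ _ _ _ (fun t : R => t `^ (- b))) => //.
exact: measurable_enorm.
Qed.

(* On the annuli [r lam^-(j+1) <= |x| < r lam^-j] the weight is at most a constant,
   which turns the integral into a geometric series. *)
Lemma integral_radial_weight_le (lam r b p : R) (A : set 'rV[R]_N) :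
  1 < lam -> 0 < r -> 0 <= b -> 0 < p -> b + p = N%:R -> measurable A ->
  (vol N A <= (kappa N * r ^+ N)%:E)%E ->
  (\int[vol N]_(x in A) (radial_weight b x)%:E <=
    (kappa N * (lam ^+ N - 1) / (lam `^ p - 1) * r `^ p)%:E)%E.
Proof.
move=> lam1 r0; rewrite le_eqVlt => /predU1P[<-|b0] p0 bpN mA volA.
  (* The case [b = 0] occurs for the critical exponent: the weight is identically [1] and the two
     factors in [lam] cancel. *)
  have -> : p = N%:R by rewrite -bpN add0r.
  rewrite !powR_mulrn ?(ltW r0) ?(le_trans ler01 (ltW lam1))//.
  rewrite mulfK; last by rewrite subr_eq0 gt_eqF// exprn_egt1.
  rewrite (eq_integral (cst 1%E)) ?integral_cst ?mul1e// => x _.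
  by rewrite /radial_weight oppr0 powRr0.
have lam0 : 0 < lam by exact: lt_trans lam1.
pose s j := r * lam `^ (- j%:R).
have s0 j : 0 < s j by rewrite mulr_gt0// powR_gt0.
pose c j := s j.+1 `^ (- b) - s j `^ (- b).
pose F_ k x := ((s k <= enorm x)%R%:R * radial_weight b x : R).
have sS j i : (i <= j)%N -> s j <= s i.
  by move=> ij; rewrite ler_pM2l// ler_powR ?(ltW lam1)// lerN2 ler_nat.
have sb j i : (i <= j)%N -> s i `^ (- b) <= s j `^ (- b).
  move=> ij; rewrite !powRN lef_pV2 ?posrE ?powR_gt0//.
  by rewrite ge0_ler_powR ?nnegrE ?(ltW b0) ?(ltW (s0 _))// sS.
have c0 j : 0 <= c j by rewrite subr_ge0 sb.
have mF k : measurable_fun setT (F_ k).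
  apply: measurable_funM; last exact: measurable_radial_weight.
  by apply: measurable_bool_indic; apply: measurable_fun_ler => //; exact: measurable_enorm.
(* The increments [c j] telescope to the weight at the inner radius of an annulus. After integration
   the constant term uses the volume of [A], and the other terms the volumes of the balls of radius
   [s j]. *)
have step k x : F_ k x <= r `^ (- b) + \sum_(j < k) c j * (enorm x < s j)%R%:R.
  have Wle (t : R) : 0 < t -> t <= enorm x -> radial_weight b x <= t `^ (- b).
    move=> t0 tx; rewrite /radial_weight !powRN lef_pV2 ?posrE ?powR_gt0 ?(lt_le_trans t0)//.
    by rewrite ge0_ler_powR ?nnegrE ?(ltW b0) ?(ltW t0) ?enorm_ge0.
  elim: k => [|k IH].
    rewrite big_ord0 addr0 /F_ {1}/s oppr0 powRr0 mulr1.
    case: (leP r (enorm x)) => [rx|_]; last by rewrite mul0r powR_ge0.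
    by rewrite mul1r Wle.
  have [skx|xsk] := leP (s k) (enorm x).
    apply: (@le_trans _ _ (F_ k x)); last first.
      by apply: le_trans IH _; rewrite big_ord_recr/= addrA lerDl mulr_ge0.
    by rewrite /F_ skx (le_trans (sS _ _ (leqnSn k)) skx).
  rewrite (eq_bigr (fun j : 'I_k.+1 => c j)); last first.
    move=> j _; rewrite (lt_le_trans xsk) ?mulr1//; apply: sS.
    by rewrite -ltnS.
  rewrite -(big_mkord xpredT c) telescope_sumr// {2}/s oppr0 powRr0 mulr1 addrC subrK.
  rewrite /F_; case: (leP (s k.+1) (enorm x)) => [sx|_]; last by rewrite mul0r powR_ge0.
  by rewrite mul1r Wle.
apply: (@integral_le_of_monotone_approx _ _ _ _ _ F_) => //.
- by move=> k x; rewrite mulr_ge0// radial_weight_ge0.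
- move=> x i j ij; rewrite ler_wpM2r ?radial_weight_ge0// ler_nat.
  by case: (leP (s i) (enorm x)) => // /(le_trans (sS _ _ ij)) ->.
- move=> x; apply: cvg_near_cst.
  have := enorm_ge0 x; rewrite le_eqVlt => /predU1P[x0|x0].
    (* At the origin the power with negative exponent takes the value [0], so the approximation is
       exact there. *)
    by apply: nearW => k; rewrite /F_ /radial_weight -x0 powR0 ?mulr0// oppr_eq0 gt_eqF.
  have [k0 hk] := pow_unbounded (r / enorm x) lam1.
  exists k0 => // k /= k0k; rewrite /F_ (_ : s k <= enorm x) ?mul1r//.
  rewrite /s powR_invn ?(ltW lam0)// ler_pdivrMr ?exprn_gt0// mulrC -ler_pdivrMr//.
  exact: hk.
move=> k.
have k00 : 0 <= kappa N :> R by exact: kappa_ge0.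
have mind j : measurable_fun setT (fun x : 'rV[R]_N => (c j * (enorm x < s j)%R%:R)%:E).
  apply/measurable_EFinP; apply: measurable_funM => //.
  by apply: measurable_bool_indic; apply: measurable_fun_ltr => //; exact: measurable_enorm.
apply: (@le_trans _ _ (\int[vol N]_(x in A) ((r `^ (- b))%:E +
    \sum_(j < k) (c j * (enorm x < s j)%R%:R)%:E))%E).
  apply: ge0_le_integral => //.
  - by move=> x _; rewrite lee_fin mulr_ge0// radial_weight_ge0.
  - by apply/measurable_EFinP/measurable_funTS.
  - apply: emeasurable_funD => //; apply: emeasurable_sum => j.
    exact: measurable_funTS.
  - by move=> x _; rewrite sumEFin -EFinD lee_fin; exact: step.
rewrite ge0_integralD; [|exact: mA|by move=> x _; rewrite lee_fin powR_ge0
  |exact: measurable_cst|by move=> x _; apply: sume_ge0 => j _; rewrite lee_fin mulr_ge0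
  |by apply: emeasurable_sum => j; exact: measurable_funTS].
rewrite integral_cst// ge0_integral_sum//; last 2 first.
- by move=> j; exact: measurable_funTS.
- by move=> j x _; rewrite lee_fin mulr_ge0.
apply: (@le_trans _ _ ((r `^ (- b))%:E * (kappa N * r ^+ N)%:E +
    \sum_(j < k) (c j * (kappa N * s j ^+ N))%:E)%E).
  apply: leeD; first by rewrite lee_wpmul2l// lee_fin powR_ge0.
  apply: lee_sum => j _; under eq_integral do rewrite EFinM.
  have mb : measurable_fun setT (fun x : 'rV[R]_N => ((enorm x < s j)%R%:R : R)%:E).
    apply/measurable_EFinP/measurable_bool_indic.
    by apply: measurable_fun_ltr => //; exact: measurable_enorm.
  rewrite ge0_integralZl; [|exact: mA|exact: measurable_funTS
    |by move=> x _; rewrite lee_fin|by rewrite lee_fin].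
  rewrite EFinM lee_wpmul2l ?lee_fin//.
  rewrite -vol_eball ?(ltW (s0 j))//.
  apply: (@le_trans _ _ (\int[vol N]_x ((enorm x < s j)%R%:R)%:E)%E).
    exact: ge0_subset_integral.
  rewrite (_ : (fun x => _) = EFin \o \1_(eball N (s j))).
    by rewrite integral_indic ?setIT//; exact: measurable_eball.
  apply/funext => x /=; rewrite indicE; congr ((_ : bool)%:R%:E).
  by apply/idP/idP; rewrite inE.
rewrite sumEFin -EFinM -EFinD lee_fin.
pose y := lam `^ (- p).
have y0 : 0 < y by rewrite powR_gt0.
have y1 : y < 1.
  rewrite /y powRN invf_lt1 ?powR_gt0//.
  have e1 : 1 `^ p = 1 :> R by rewrite powR1.
  by rewrite -[ltLHS]e1 gt0_ltr_powR ?nnegrE ?ler01 ?(ltW lam0).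
have lb : 1 <= lam `^ b.
  have e1 : 1 `^ b = 1 :> R by rewrite powR1.
  by rewrite -[leLHS]e1 ge0_ler_powR ?nnegrE ?ler01 ?(ltW lam0) ?(ltW lam1) ?(ltW b0).
have lD (x1 x2 : R) : lam `^ (x1 + x2) = lam `^ x1 * lam `^ x2.
  by rewrite powRD// (gt_eqF lam0) implybT.
have rE : r `^ (- b) * (kappa N * r ^+ N) = kappa N * r `^ p.
  rewrite mulrCA -powR_mulrn ?(ltW r0)// -powRD ?(gt_eqF r0) ?implybT//.
  by rewrite -bpN addKr.
have sbE j : s j `^ (- b) = r `^ (- b) * lam `^ (b * j%:R).
  by rewrite /s powRM ?powR_ge0 ?(ltW r0)// -powRrM mulrNN [j%:R * b]mulrC.
have csE j : c j * (kappa N * s j ^+ N) = kappa N * r `^ p * ((lam `^ b - 1) * y ^+ j).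
  have yE : y ^+ j = lam `^ (b * j%:R) * lam `^ (- j%:R) ^+ N.
    rewrite -!powR_mulrn ?powR_ge0 ?(ltW y0)// /y -!powRrM -lD -bpN.
    by congr (_ `^ _); ring.
  rewrite yE /c !sbE -natr1 mulrDr mulr1 lD -rE /s exprMn; ring.
under eq_bigr do rewrite csE.
rewrite rE -mulr_sumr -mulr_sumr -[X in X + _]mulr1 -mulrDr.
have -> : kappa N * (lam ^+ N - 1) / (lam `^ p - 1) * r `^ p =
    kappa N * r `^ p * ((lam ^+ N - 1) / (lam `^ p - 1)) by ring.
rewrite ler_wpM2l ?mulr_ge0 ?powR_ge0//.
have geom : (\sum_(j < k) y ^+ j) * (1 - y) <= 1.
  have := subrX1 y k; rewrite -opprB => /eqP; rewrite eqr_oppLR -mulNr opprB mulrC => /eqP <-.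
  by rewrite lerBlDr lerDl exprn_ge0// ltW.
have y1' : 0 < 1 - y by rewrite subr_gt0.
have lp : lam `^ p = y^-1 by rewrite /y powRN invrK.
have -> : (lam ^+ N - 1) / (lam `^ p - 1) = 1 + (lam `^ b - 1) / (1 - y).
  rewrite -powR_mulrn ?(ltW lam0)// -bpN lD lp; field.
  by rewrite !gt_eqF// subr_gt0 invf_gt1.
by rewrite lerD2l ler_wpM2l ?subr_ge0// -[leRHS]mul1r ler_pdivlMr.
Qed.

End radial_weight.

Section rearrangement.
Context {R : realType} (n : nat).
Local Notation N := n.+1.
Variables (h : 'rV[R]_N -> R) (Mh : R).
Hypotheses (mh : measurable_fun setT h) (h0 : forall x, 0 <= h x).
Hypothesis hM : forall x, h x <= Mh.
Hypothesis h_fin : forall t, 0 < t -> vol N [set x | t < h x] \is a fin_num.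

Let lev t : set 'rV[R]_N := [set x | t < h x].

Let mlev t : measurable (lev t). Proof. exact: measurable_ltr_set. Qed.

Let lev_le s t : s <= t -> (vol N (lev t) <= vol N (lev s))%E.
Proof.
by move=> st; apply: le_measure; rewrite ?inE// => x /=; exact: le_lt_trans.
Qed.

Definition radial_set (r : R) : set R :=
  [set t | 0 <= t /\ (vol N [set x | (t < h x)%R] <= (kappa N * r ^+ N)%:E)%E].

(** The generalised inverse of the distribution function of [h]. Across jumps and plateaus the
    volume of the ball of radius [r] still lies between those of [{G r < h}] and, when [G r > 0],
    [{G r <= h}]. *)
Definition radial_profile (r : R) : R := inf (radial_set r).
Local Notation G := radial_profile.

Let Mh0 : 0 <= Mh. Proof. exact: le_trans (h0 0) (hM 0). Qed.

Let radial_set_Mh r : 0 <= r -> radial_set r Mh.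
Proof.
move=> r0; split => //.
rewrite (_ : [set x | _] = set0) ?measure0 ?lee_fin ?mulr_ge0 ?kappa_ge0 ?exprn_ge0//.
by rewrite -subset0 => x /=; rewrite ltNge hM.
Qed.

Let has_inf_radial r : 0 <= r -> has_inf (radial_set r).
Proof.
by move=> r0; split; [exists Mh; exact: radial_set_Mh|exists 0 => t []].
Qed.

Lemma radial_profile_ge0 r : 0 <= r -> 0 <= G r.
Proof. by move=> r0; apply: lb_le_inf; [case: (has_inf_radial r0)|move=> t []]. Qed.

Lemma radial_profile_le_bound r : 0 <= r -> G r <= Mh.
Proof.
by move=> r0; apply: ge_inf; [case: (has_inf_radial r0)|exact: radial_set_Mh].
Qed.

Lemma radial_profile_le r t : 0 <= r -> 0 <= t ->
  (vol N [set x | (t < h x)%R] <= (kappa N * r ^+ N)%:E)%E -> G r <= t.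
Proof. by move=> r0 t0 ht; apply: ge_inf; [case: (has_inf_radial r0)|split]. Qed.

Lemma radial_profile_ge r t : 0 <= r ->
  ((kappa N * r ^+ N)%:E < vol N [set x | (t < h x)%R])%E -> t <= G r.
Proof.
move=> r0 ht; apply: lb_le_inf; first by case: (has_inf_radial r0).
move=> s [s0 hs]; rewrite leNgt; apply/negP => st.
have := lt_le_trans ht (le_trans (lev_le (ltW st)) hs).
by rewrite ltxx.
Qed.

Lemma radial_profile_decr r s : 0 <= r -> r <= s -> G s <= G r.
Proof.
move=> r0 rs; have s0 := le_trans r0 rs.
apply: lb_le_inf; first by case: (has_inf_radial r0).
move=> t [t0 ht]; apply: radial_profile_le => //; apply: le_trans ht _.
by rewrite lee_fin ler_wpM2l ?kappa_ge0// lerXn2r.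
Qed.

(** Continuity of the volume from below, along levels decreasing to [G r]; at each of them the bound
    comes from the infimum. *)
Lemma vol_above_radial_profile r : 0 <= r ->
  (vol N [set x | (G r < h x)%R] <= (kappa N * r ^+ N)%:E)%E.
Proof.
move=> r0; pose F k := lev (G r + k.+1%:R^-1).
have -> : [set x | G r < h x] = \bigcup_k F k.
  apply/seteqP; split => x /=.
    move=> Gx; pose k := Num.truncn ((h x - G r)^-1); exists k => //=.
    have d0 : 0 < h x - G r by rewrite subr_gt0.
    rewrite /F /lev /= -ltrBrDl -[ltRHS]invrK ltf_pV2 ?posrE ?invr_gt0//.
    by rewrite -truncn_lt_nat// invr_ge0 ltW.
  by move=> [k _] /=; apply: le_lt_trans; rewrite lerDl.
have ndF : {homo F : i j / (i <= j)%N >-> (i <= j)%O}.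
  move=> i j ij; apply/subsetPset => x /=; apply: le_lt_trans.
  by rewrite lerD2l lef_pV2 ?posrE// ler_nat.
have mU : measurable (\bigcup_k F k) by apply: bigcup_measurable => k _; exact: mlev.
have := @nondecreasing_cvg_mu _ _ _ (vol N) F (fun i => mlev _) mU ndF => cv.
rewrite -(cvg_lim _ cv)//; apply: lime_le; first by apply/cvg_ex; eexists; exact: cv.
apply: nearW => k /=.
have k0 : 0 < k.+1%:R^-1 :> R by rewrite invr_gt0.
have [t [t0 ht] tG] := inf_adherent k0 (has_inf_radial r0).
exact: le_trans (lev_le (ltW tG)) ht.
Qed.

(** Continuity from above, along levels increasing to [G r], none of which can satisfy the bound
    that defines the infimum. The denominators start at [2] so that the first level is positive and
    its superlevel set has finite volume. *)
Lemma vol_radial_profile_le r : 0 <= r -> 0 < G r ->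
  ((kappa N * r ^+ N)%:E <= vol N [set x | (G r <= h x)%R])%E.
Proof.
move=> r0 G0; pose F k := lev (G r - G r / k.+2%:R).
have FE k : G r - G r / k.+2%:R = G r * (1 - k.+2%:R^-1) by rewrite mulrBr mulr1.
have k21 k : 0 < 1 - k.+2%:R^-1 :> R by rewrite subr_gt0 invf_lt1// ltr1n.
have F0 k : 0 < G r - G r / k.+2%:R by rewrite FE mulr_gt0.
have -> : [set x | G r <= h x] = \bigcap_k F k.
  apply/seteqP; split => x /=.
    move=> Gx k _ /=; apply: lt_le_trans Gx.
    by rewrite ltrBlDr ltrDl divr_gt0.
  move=> Fx; rewrite leNgt; apply/negP => hG.
  have d0 : 0 < G r - h x by rewrite subr_gt0.
  pose k := Num.truncn (G r / (G r - h x)).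
  have := Fx k I; rewrite /F /lev /= ltrBlDr -ltrBlDl; apply/negP; rewrite -leNgt.
  rewrite ler_pdivrMr// mulrC -ler_pdivrMr//.
  have : G r / (G r - h x) < k.+1%:R by rewrite -truncn_lt_nat// divr_ge0// ltW.
  by move=> /ltW /le_trans; apply; rewrite ler_nat.
have niF : {homo F : i j / (i <= j)%N >-> (j <= i)%O}.
  move=> i j ij; apply/subsetPset => x /=; apply: le_lt_trans.
  by rewrite lerD2l lerN2 ler_wpM2l ?(ltW G0)// lef_pV2 ?posrE// ler_nat.
have mI : measurable (\bigcap_k F k) by apply: bigcapT_measurable => k; exact: mlev.
have F0fin : (vol N (F 0%N) < +oo)%E by rewrite -ge0_fin_numE//; exact: h_fin.
have cv := @nonincreasing_cvg_mu _ _ _ (vol N) F F0fin (fun i => mlev _) mI niF.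
rewrite -(cvg_lim _ cv)//; apply: lime_ge; first by apply/cvg_ex; eexists; exact: cv.
apply: nearW => k /=; rewrite leNgt; apply/negP => hk.
have : G r <= G r - G r / k.+2%:R by apply: radial_profile_le => //; exact: ltW.
by apply/negP; rewrite -ltNge ltrBlDr ltrDl divr_gt0.
Qed.

Lemma vol_slab_radial_profile r s : 0 <= r -> r <= s -> G s < G r ->
  (vol N [set x | (G s < h x < G r)%R] <= (kappa N * (s ^+ N - r ^+ N))%:E)%E.
Proof.
move=> r0 rs Gsr; have s0 := le_trans r0 rs.
have G0 : 0 < G r by apply: le_lt_trans Gsr; exact: radial_profile_ge0.
have h1 := vol_above_radial_profile s0; have h2 := vol_radial_profile_le r0 G0.
have E : vol N [set x | G s < h x] =
    (vol N [set x | (G s < h x < G r)%R] + vol N [set x | (G r <= h x)%R])%E.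
  rewrite -measureU//.
  - congr (vol N _); apply/seteqP; split => x /=.
      by move=> Gx; rewrite Gx /=; have [?|?] := ltP (h x) (G r); [left|right].
    by move=> [/andP[]//|]; exact: lt_le_trans.
  - exact: slab_measurable.
  - exact: measurable_ler_set.
  - by rewrite -subset0 => x /= [/andP[_]]; rewrite ltNge => /negP.
move: h1; rewrite E => h1.
rewrite mulrBr EFinB leeBrDr//.
exact: le_trans (leeD2l _ h2) h1.
Qed.

End rearrangement.

(** * Summation formulas *)

Section lattice_sums.
Context {R : realType}.

(** A layer cake with finitely many levels: the terms whose indicator is [1] telescope from the
    first level interval that contains [Y] down to [b L]. *)
Lemma powR_layer_sum (p Y : R) (b : nat -> R) L : 0 < p ->
  (forall i, 0 <= b i) -> (forall i, b i.+1 <= b i) -> 0 <= Y -> Y <= b 0%N ->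
  Y `^ p <= b L `^ p + \sum_(0 <= i < L) (b i `^ p - b i.+1 `^ p) * (b i.+1 < Y)%R%:R.
Proof.
move=> p0 b0 bS Y0 Yb; have mono x y : 0 <= x -> x <= y -> x `^ p <= y `^ p.
  by move=> x0 xy; rewrite ge0_ler_powR ?nnegrE ?(ltW p0)// (le_trans x0).
have d0 i : 0 <= b i `^ p - b i.+1 `^ p by rewrite subr_ge0 mono.
elim: L => [|L IH]; first by rewrite big_geq// addr0 mono.
rewrite big_nat_recr//=; case: (ltP (b L.+1) Y) => bY; last first.
  by rewrite mulr0 addr0 (le_trans (mono _ _ Y0 bY))// lerDl sumr_ge0// => i _; rewrite mulr_ge0.
by apply: le_trans IH _; rewrite mulr1; lra.
Qed.

Lemma abel_sum (B r : nat -> R) L :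
  \sum_(0 <= i < L) (B i - B i.+1) * r i.+1 =
  \sum_(0 <= i < L) B i * (r i.+1 - r i) + B 0%N * r 0%N - B L * r L.
Proof.
elim: L => [|L IH]; first by rewrite !big_geq// add0r subrr.
by rewrite !big_nat_recr//= IH; ring.
Qed.

(** Each square equals [g (w_(i+1) - w_i)^2 + (1 - g)^2 w_i^2 + g (1 - g) (w_i^2 - w_(i+1)^2)], and
    the last part telescopes. With [g = lam^(-c)] the coefficient [(1 - g)^2] is the source of
    [c^2 tau^2]. *)
Lemma lattice_square_sum (g : R) (w : nat -> R) L : w L = 0 ->
  \sum_(0 <= i < L) (w i - g * w i.+1) ^+ 2 =
  g * \sum_(0 <= i < L) (w i.+1 - w i) ^+ 2 + (1 - g) ^+ 2 * \sum_(0 <= i < L) w i ^+ 2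
    + g * (1 - g) * w 0%N ^+ 2.
Proof.
move=> wL.
suff -> : \sum_(0 <= i < L) (w i - g * w i.+1) ^+ 2 =
  g * \sum_(0 <= i < L) (w i.+1 - w i) ^+ 2 + (1 - g) ^+ 2 * \sum_(0 <= i < L) w i ^+ 2
    + g * (1 - g) * (w 0%N ^+ 2 - w L ^+ 2) by rewrite wL expr0n/= subr0.
elim: L {wL} => [|L IH]; first by rewrite !big_geq//; ring.
by rewrite !big_nat_recr//= IH; ring.
Qed.

Lemma sum_slab_integral_le n (h : 'rV[R]_n -> R) (F : 'rV[R]_n -> \bar R) (t : nat -> R) L :
  measurable_fun setT h -> measurable_fun setT F -> (forall x, 0 <= F x)%E ->
  (forall i, t i.+1 <= t i) ->
  (\sum_(0 <= i < L) \int[vol n]_(x in [set x | (t i.+1 < h x < t i)%R]) F x <=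
   \int[vol n]_(x in [set x | (t L < h x)%R]) F x)%E.
Proof.
move=> mh mF F0 tS.
have ms a b : measurable [set x | a < h x < b].
  rewrite (_ : mkset _ = [set x | a < h x] `&` [set x | h x < b]).
    by apply: measurableI; exact: measurable_ltr_set.
  by apply/seteqP; split => x /= => [/andP[]|[-> ->]].
elim: L => [|l IH]; first by rewrite big_geq//; apply: integral_ge0.
rewrite big_nat_recr//=.
apply: (le_trans (leeD2r _ IH)).
rewrite -ge0_integral_setU//.
- apply: ge0_subset_integral => //.
  + by apply: measurableU => //; exact: measurable_ltr_set.
  + exact: measurable_ltr_set.
  + exact: measurable_funTS.
  + by move=> x /= [|/andP[]//]; exact: le_lt_trans.
- exact: measurable_ltr_set.
- exact: measurable_funTS.
- apply/disj_setPS => x /= [tl /andP[_]]; by rewrite ltNge (ltW tl).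
Qed.

End lattice_sums.

(** * Energy and weighted integrals in terms of lattice values *)

Section lattice_estimates.
Context {R : realType} (n : nat).
Local Notation N := n.+1.
Variables (h g : 'rV[R]_N -> R) (C1 C2 Mh : R).
Hypothesis n0 : (0 < n)%N.
Hypotheses (mh : measurable_fun setT h) (mg : measurable_fun setT g).
Hypotheses (h0 : forall x, 0 <= h x) (g0 : forall x, 0 <= g x).
Hypothesis hM : forall x, h x <= Mh.
Hypothesis C10 : 0 <= C1.
Hypothesis C20 : 0 < C2.
Hypothesis h_lip : forall x y, enorm y <= 1 -> h (x + y) <= h x + C2 * enorm y.
Hypothesis h_taylor : forall x y d, 0 < d -> d <= h x -> enorm y <= 1 ->
  h (x + y) <= h x + enorm y * g x + C1 / d * enorm y ^+ 2.
Hypothesis h_decay : forall t, 0 < t -> exists k, [set x | t < h x] `<=` cube N k.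
Variables (lam r0 : R) (L : nat).
Hypotheses (lam1 : 1 < lam) (r00 : 0 < r0).

Let r (i : nat) : R := r0 * lam ^+ i.
Let t (i : nat) : R := radial_profile h (r i).
(** Chosen so that the shell between the radii [r] and [lam * r] has volume
    [N * kappa N * tau * r^N]. *)
Let tau : R := (lam ^+ N - 1) / N%:R.
Let lam0 : 0 < lam. Proof. exact: lt_trans lam1. Qed.
Let r_gt0 i : 0 < r i. Proof. by rewrite mulr_gt0// exprn_gt0. Qed.
Let r_ge0 i : 0 <= r i. Proof. exact: ltW. Qed.
Let rS i : r i.+1 = lam * r i. Proof. by rewrite /r exprS mulrCA. Qed.
Let rleS i : r i <= r i.+1. Proof. by rewrite rS ler_peMl// ltW. Qed.
Let tS i : t i.+1 <= t i. Proof. exact: radial_profile_decr. Qed.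
Let t_ge0 i : 0 <= t i. Proof. exact: radial_profile_ge0. Qed.
Let h_fin s : 0 < s -> vol N [set x | s < h x] \is a fin_num.
Proof.
by move=> /h_decay[k hk]; apply: vol_sub_cube hk; exact: measurable_ltr_set.
Qed.
Let lamN : 0 < lam ^+ N - 1. Proof. by rewrite subr_gt0 exprn_egt1. Qed.
Let mg2 (D : set 'rV[R]_N) : measurable_fun D (fun x => (g x ^+ 2)%:E).
Proof. by apply/measurable_funTS/measurable_EFinP; exact: measurable_funX. Qed.
Let g20 x : (0 <= (g x ^+ 2)%:E)%E. Proof. by rewrite lee_fin sqr_ge0. Qed.

(** [slab_energy] between consecutive levels: the squared area contributes [r^(2n)] and the volume
    of the shell divides by [r^(n+1)], leaving [r^(n-1)], which is [r^(2c)]. A plateau contributes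
    nothing, and the slabs are disjoint. *)
Lemma lattice_energy :
  ((N%:R * kappa N / tau * \sum_(0 <= i < L) ((t i - t i.+1) ^+ 2 * r i ^+ n.-1))%:E <=
   \int[vol N]_x (g x ^+ 2)%:E)%E.
Proof.
have k0 : 0 < kappa N :> R by exact: kappa_gt0.
have slab i : ((N%:R * kappa N / tau * ((t i - t i.+1) ^+ 2 * r i ^+ n.-1))%:E <=
    \int[vol N]_(x in [set x | (t i.+1 < h x < t i)%R]) (g x ^+ 2)%:E)%E.
  have := tS i; rewrite le_eqVlt => /predU1P[->|tlt].
    by rewrite subrr expr0n/= mul0r mulr0; apply: integral_ge0 => x _; exact: g20.
  have v0 : 0 < kappa N * (r i.+1 ^+ N - r i ^+ N).
    rewrite mulr_gt0// subr_gt0 ltrXn2r// rS ltr_pMl//.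
  have t0 : 0 < t i by exact: le_lt_trans (t_ge0 _) tlt.
  have := @slab_energy R n h g C1 C2 mh mg g0 C10 C20 h_lip h_taylor h_decay
    (t i.+1) (t i) (r i) (kappa N * (r i.+1 ^+ N - r i ^+ N)) n0 (t_ge0 _) tlt (r_ge0 _) v0
    (vol_radial_profile_le mh h0 hM h_fin (r_ge0 i) t0)
    (vol_slab_radial_profile mh h0 hM h_fin (r_ge0 i) (rleS i) tlt).
  apply: le_trans; rewrite lee_fin le_eqVlt; apply/orP; left; apply/eqP.
  have alg (N' k' l ri a d : R) : N' != 0 -> k' != 0 -> l - 1 != 0 -> ri != 0 -> a != 0 ->
      N' * k' / ((l - 1) / N') * (d ^+ 2 * a) =
      d ^+ 2 * (N' * k' * (ri * a)) ^+ 2 / (k' * (l * (ri * (ri * a)) - ri * (ri * a))).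
    move=> ? ? ? ? ?.
    have -> : l * (ri * (ri * a)) - ri * (ri * a) = (l - 1) * (ri * (ri * a)) by ring.
    by field; do ?[apply/andP; split].
  have rn : r i ^+ n = r i * r i ^+ n.-1 by rewrite -exprS prednK.
  have rN : r i ^+ N = r i * (r i * r i ^+ n.-1) by rewrite -rn -exprS.
  rewrite rS [(lam * r i) ^+ N]exprMn rN rn /tau; apply: alg; rewrite ?gt_eqF ?exprn_gt0//.
rewrite mulr_sumr -sumEFin.
apply: (@le_trans _ _ (\sum_(0 <= i < L)
    \int[vol N]_(x in [set x | (t i.+1 < h x < t i)%R]) (g x ^+ 2)%:E)%E).
  by apply: lee_sum => i _; exact: slab.
apply: (@le_trans _ _ (\int[vol N]_(x in [set x | (t L < h x)%R]) (g x ^+ 2)%:E)%E).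
  by apply: sum_slab_integral_le => //; exact: mg2.
by apply: ge0_subset_integral => //; exact: measurable_ltr_set.
Qed.

Definition lattice_trunc (x : 'rV[R]_N) : R := Num.max (Num.min (h x) (t 0%N) - t L) 0.

(** The last level is subtracted so that the sequence vanishes at index [L]; accordingly
    [lattice_trunc] takes the place of [h] in the weighted integrals. *)
Definition lattice_val (c : R) (i : nat) : R := r i `^ c * (t i - t L).

(** The layers of [lattice_trunc] are cut at the lattice levels. The set [{t_(i+1) < h}] has at most
    the volume of a ball of radius [r_(i+1)], so its weighted integral is at most a constant times
    [r_(i+1)^(p c)]; summation by parts then produces the powers of the lattice values, and the
    boundary term at [r_0] is the second summand. *)
Lemma lattice_weight (b p c : R) : 0 <= b -> 0 < p -> 0 < c -> b + p * c = N%:R ->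
  (\int[vol N]_x (radial_weight b x * lattice_trunc x `^ p)%:E <=
   (N%:R * kappa N * tau * (\sum_(0 <= i < L) lattice_val c i `^ p +
     lattice_val c 0%N `^ p / (lam `^ (p * c) - 1)))%:E)%E.
Proof.
move=> b0 p0 c0 bpc; have pc0 : 0 < p * c by exact: mulr_gt0.
(* The maximum keeps [B] nonnegative and decreasing beyond the index [L] too, as [powR_layer_sum]
   requires. *)
pose B i := Num.max (t i - t L) 0.
have tle i j : (i <= j)%N -> t j <= t i.
  move=> ij; apply: radial_profile_decr => //.
  by rewrite /r ler_pM2l// ler_eXn2l.
have BE i : (i <= L)%N -> B i = t i - t L.
  by move=> iL; apply/max_idPl; rewrite subr_ge0 tle.
have B0 i : 0 <= B i by rewrite le_max lexx orbT.
have BS i : B i.+1 <= B i by rewrite ge_max !le_max lexx orbT andbT lerD2r tS.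
pose d i := B i `^ p - B i.+1 `^ p.
have d0 i : 0 <= d i by rewrite subr_ge0 ge0_ler_powR ?nnegrE// ltW.
have W0 (x : 'rV[R]_N) : 0 <= radial_weight b x :> R by exact: radial_weight_ge0.
have Y0 x : 0 <= lattice_trunc x by rewrite le_max lexx orbT.
pose I i (x : 'rV[R]_N) : R := (t i.+1 < h x)%R%:R * radial_weight b x.
have mW := @measurable_radial_weight R n b.
have mI i : measurable_fun setT (I i).
  apply: measurable_funM => //; apply: measurable_bool_indic.
  exact: measurable_fun_ltr.
have mY : measurable_fun setT lattice_trunc.
  apply: measurable_maxr => //; apply: measurable_funB => //.
  exact: measurable_minr.
have pw x : radial_weight b x * lattice_trunc x `^ p <= \sum_(0 <= i < L) d i * I i x.
  have YB : lattice_trunc x <= B 0%N.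
    by rewrite ge_max !le_max lexx orbT andbT lerD2r ge_min lexx orbT.
  have := powR_layer_sum L p0 B0 BS (Y0 x) YB.
  rewrite BE// subrr powR0 ?gt_eqF// add0r => H.
  have H2 := ler_wpM2l (W0 x) H.
  apply: (le_trans H2); rewrite mulr_sumr !big_nat.
  apply: ler_sum => i /andP[_ iL].
  rewrite mulrCA; apply: ler_wpM2l; first exact: d0.
  rewrite /I [leLHS]mulrC; apply: ler_wpM2r; [exact: W0|rewrite ler_nat].
  case: (ltP (B i.+1) (lattice_trunc x)) => // BY.
  move: BY; rewrite BE// /lattice_trunc lt_max => /orP[|].
    by rewrite ltrD2r lt_min => /andP[->].
  by rewrite subr_lt0 ltNge tle.
have k0 : 0 < kappa N :> R by exact: kappa_gt0.
have lp1 : 0 < lam `^ (p * c) - 1.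
  have e1 : 1 `^ (p * c) = 1 :> R by rewrite powR1.
  by rewrite subr_gt0 -[ltLHS]e1 gt0_ltr_powR ?nnegrE ?ler01 ?(ltW lam0).
apply: (@le_trans _ _ (\int[vol N]_x (\sum_(0 <= i < L) (d i)%:E * (I i x)%:E))%E).
  apply: ge0_le_integral => //.
  - by move=> x _; rewrite lee_fin mulr_ge0// powR_ge0.
  - apply/measurable_EFinP; apply: measurable_funM => //.
    exact: (measurableT_comp (measurable_powR _)).
  - apply: emeasurable_sum => i; apply: emeasurable_funM => //.
    by apply/measurable_EFinP.
  - move=> x _; under eq_bigr do rewrite -EFinM.
    by rewrite sumEFin lee_fin.
rewrite ge0_integral_sum//; last 2 first.
- by move=> i; apply: emeasurable_funM => //; apply/measurable_EFinP.
- by move=> i x _; rewrite -EFinM lee_fin !mulr_ge0.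
apply: (@le_trans _ _ (\sum_(0 <= i < L) (d i * (kappa N * (lam ^+ N - 1) /
    (lam `^ (p * c) - 1) * r i.+1 `^ (p * c)))%:E)%E).
  apply: lee_sum => i _; rewrite ge0_integralZl; [|exact: measurableT
    |by apply/measurable_EFinP|by move=> x _; rewrite lee_fin mulr_ge0|by rewrite lee_fin].
  rewrite EFinM lee_wpmul2l ?lee_fin//.
  rewrite -(@integral_indic_mul R _ _ (vol N) [set x | t i.+1 < h x] (fun x => t i.+1 < h x))//.
  apply: integral_radial_weight_le => //; first exact: measurable_ltr_set.
  exact: vol_above_radial_profile.
rewrite sumEFin lee_fin.
set K := kappa N * _ / _.
have -> : \sum_(0 <= i < L) d i * (K * r i.+1 `^ (p * c)) =
    K * \sum_(0 <= i < L) (B i `^ p - B i.+1 `^ p) * r i.+1 `^ (p * c).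
  by rewrite mulr_sumr; apply: eq_bigr => i _; rewrite mulrCA.
rewrite (abel_sum (fun i => B i `^ p) (fun i => r i `^ (p * c))) (BE _ (leqnn L)) subrr powR0 ?gt_eqF// mul0r subr0.
have wE i : (i <= L)%N -> lattice_val c i `^ p = B i `^ p * r i `^ (p * c).
  move=> iL; rewrite /lattice_val -BE// powRM ?powR_ge0// -powRrM mulrC.
  by rewrite [c * p]mulrC.
have -> : \sum_(0 <= i < L) B i `^ p * (r i.+1 `^ (p * c) - r i `^ (p * c)) =
    (lam `^ (p * c) - 1) * \sum_(0 <= i < L) lattice_val c i `^ p.
  rewrite mulr_sumr !big_nat; apply: eq_bigr => i /andP[_ iL].
  rewrite wE ?(ltnW iL)// rS powRM ?(ltW lam0)//; ring.
rewrite -wE// /K /tau le_eqVlt; apply/orP; left; apply/eqP; field.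
by rewrite (gt_eqF lp1) /= ?natr1 ?nat1r pnatr_eq0.
Qed.

End lattice_estimates.

(** * The modulus of a Schwartz function *)

Section directional_calculus.
Context {R : realType} (n : nat).
Implicit Types (w : 'rV[R]_n -> R) (x y : 'rV[R]_n).

Lemma derive_coord_sum w x y : differentiable w x ->
  'D_y w x = \sum_(i < n) y ord0 i * dpart1 i w x.
Proof.
move=> dw; rewrite deriveE//.
have {1}-> : y = \sum_(i < n) y ord0 i *: evec R i.
  rewrite {1}[y]row_sum_delta; apply: eq_bigr => i _; by [].
rewrite linear_sum; apply: eq_bigr => i _.
by rewrite linearZ /dpart1 deriveE.
Qed.

Lemma is_derive_line w x y (s : R) : differentiable w (x + s *: y) ->
  is_derive s 1 (fun s : R => w (x + s *: y)) ('D_y w (x + s *: y)).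
Proof.
move=> dw; have E : (fun k : R => k^-1 *: (((fun s => w (x + s *: y)) \o shift s) (k *: 1) - w (x + s *: y))) =
    (fun k : R => k^-1 *: ((w \o shift (x + s *: y)) (k *: y) - w (x + s *: y))).
  apply/funext => k /=; congr (_ *: (w _ - _)).
  by rewrite [k *: 1]mulr1 scalerDl addrCA.
have dv : derivable w (x + s *: y) y by exact: diff_derivable.
apply: DeriveDef; first by rewrite /derivable E.
by rewrite /derive E.
Qed.

Lemma mvt_line w x y : (forall z, differentiable w z) ->
  exists2 c : R, 0 <= c <= 1 &
    w (x + y) - w x = \sum_(i < n) y ord0 i * dpart1 i w (x + c *: y).
Proof.
move=> dw; pose f (s : R) := w (x + s *: y).
have df (s : R) : is_derive s 1 f ('D_y w (x + s *: y)) by exact: is_derive_line.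
have [|c] := @MVT_segment R f (fun s => 'D_y w (x + s *: y)) 0 1 ler01 (fun s _ => df s).
  apply: continuous_subspaceT => s; apply: differentiable_continuous.
  by apply/derivable1_diffP; have [] := df s.
rewrite in_itv/= => c01; rewrite /f scale1r scale0r addr0 subr0 mulr1 => E.
by exists c => //; rewrite E derive_coord_sum.
Qed.

Lemma lipschitz_of_dpart w (C : R) x y : (forall z, differentiable w z) -> 0 <= C ->
  (forall i z, `|dpart1 i w z| <= C) -> `|w (x + y) - w x| <= n%:R * C * enorm y.
Proof.
move=> dw C0 wC; have [c _ ->] := mvt_line x y dw.
rewrite (le_trans (ler_norm_sum _ _ _))//.
rewrite (le_trans (ler_sum _ (_ : forall i : 'I_n, true -> _ <= enorm y * C)))//.
  by move=> i _; rewrite normrM ler_pM// ler_coord_enorm.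
by rewrite sumr_const card_ord -mulr_natl; lra.
Qed.

Lemma taylor_of_dpart w (C : R) x y : (forall z, differentiable w z) ->
  (forall i z, differentiable (dpart1 i w) z) -> 0 <= C ->
  (forall i j z, `|dpart1 j (dpart1 i w) z| <= C) ->
  `|w (x + y) - w x - \sum_(i < n) y ord0 i * dpart1 i w x| <= n%:R ^+ 2 * C * enorm y ^+ 2.
Proof.
move=> dw ddw C0 wC; have [c /andP[c0 c1] ->] := mvt_line x y dw.
rewrite -sumrB (le_trans (ler_norm_sum _ _ _))//.
have e0 := enorm_ge0 y.
rewrite (le_trans (ler_sum _ (_ : forall i : 'I_n, true -> _ <= enorm y * (n%:R * C * enorm y))))//.
  move=> i _; rewrite -mulrBr normrM ler_pM// ?ler_coord_enorm//.
  rewrite (le_trans (lipschitz_of_dpart _ _ (ddw i) C0 (wC i)))//.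
  rewrite ler_wpM2l ?mulr_ge0// enormZ// ler_piMl//.
by rewrite sumr_const card_ord -mulr_natl; lra.
Qed.

End directional_calculus.

Section schwartz_modulus.
Context {R : realType} (n : nat).
Local Notation N := n.+1.

Lemma schwartz_differentiable (u : 'rV[R]_N -> R) s z : schwartz u -> differentiable (dpart s u) z.
Proof. by move=> [du _]; exact: du. Qed.

Lemma schwartz_bounds (u : 'rV[R]_N -> R) : schwartz u ->
  exists2 C : R, 0 <= C &
  [/\ forall z, (1 + enorm z) * `|u z| <= C, forall z, `|u z| <= C,
    forall i z, `|dpart1 i u z| <= C & forall i j z, `|dpart1 j (dpart1 i u) z| <= C].
Proof.
move=> [_ bu]; have b0 s : exists C, forall z, `|dpart s u z| <= C.
  by have [C hC] := bu s 0%N; exists C => z; have := hC z; rewrite expr0 mul1r.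
have [A0 hA0] := bu [::] 1%N.
have [A1 hA1] := b0 [::].
have /choice[A2 hA2] i := b0 [:: i].
have /choice[A3 hA3] (ij : 'I_N * 'I_N) := b0 [:: ij.2; ij.1].
pose S2 := \sum_i `|A2 i|; pose S3 := \sum_ij `|A3 ij|.
have S20 : 0 <= S2 by apply: sumr_ge0.
have S30 : 0 <= S3 by apply: sumr_ge0.
exists (`|A0| + `|A1| + S2 + S3); first by rewrite !addr_ge0.
have A00 := normr_ge0 A0; have A10 := normr_ge0 A1.
have A0n := ler_norm A0; have A1n := ler_norm A1.
split.
- by move=> z; have := hA0 z; rewrite expr1 /=; lra.
- by move=> z; have := hA1 z => /=; lra.
- move=> i z; have := hA2 i z => /= h; have := ler_norm (A2 i).
  have : `|A2 i| <= S2 by rewrite /S2 (bigD1 i)//= lerDl sumr_ge0.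
  by lra.
- move=> i j z; have := hA3 (i, j) z => /= h; have := ler_norm (A3 (i, j)).
  have : `|A3 (i, j)| <= S3 by rewrite /S3 (bigD1 (i, j))//= lerDl sumr_ge0.
  by lra.
Qed.

Variables u v : 'rV[R]_N -> R.
Hypotheses (su : schwartz u) (sv : schwartz v).

Definition modulus (x : 'rV[R]_N) : R := Num.sqrt (u x ^+ 2 + v x ^+ 2).
Definition gradient_norm (x : 'rV[R]_N) : R :=
  Num.sqrt (\sum_(i < N) (dpart1 i u x ^+ 2 + dpart1 i v x ^+ 2)).

Lemma modulus_ge0 x : 0 <= modulus x. Proof. exact: sqrtr_ge0. Qed.
Lemma gradient_norm_ge0 x : 0 <= gradient_norm x. Proof. exact: sqrtr_ge0. Qed.

Lemma modulus_sqr x : modulus x ^+ 2 = u x ^+ 2 + v x ^+ 2.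
Proof. by rewrite sqr_sqrtr// addr_ge0// sqr_ge0. Qed.

Lemma gradient_norm_sqr x : gradient_norm x ^+ 2 =
  \sum_(i < N) (dpart1 i u x ^+ 2 + dpart1 i v x ^+ 2).
Proof. by rewrite sqr_sqrtr// sumr_ge0// => i _; rewrite addr_ge0// sqr_ge0. Qed.

Lemma measurable_dpart (w : 'rV[R]_N -> R) s : schwartz w ->
  measurable_fun setT (dpart s w).
Proof.
move=> sw; apply: continuous_measurable_rV => z; apply: differentiable_continuous.
exact: schwartz_differentiable.
Qed.

Let msqrt : measurable_fun [set: R] (@Num.sqrt R).
Proof. by apply: continuous_measurable_fun; exact: sqrt_continuous. Qed.

Lemma measurable_modulus : measurable_fun setT modulus.
Proof.
apply: (measurableT_comp msqrt); apply: measurable_funD; apply: measurable_funX.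
  exact: (@measurable_dpart u [::]).
exact: (@measurable_dpart v [::]).
Qed.

Lemma measurable_gradient_norm : measurable_fun setT gradient_norm.
Proof.
apply: (measurableT_comp msqrt); apply: measurable_sum => i.
apply: measurable_funD; apply: measurable_funX.
  exact: (@measurable_dpart u [:: i]).
exact: (@measurable_dpart v [:: i]).
Qed.

(** The square of the modulus is smooth, so the expansion [T1] is made there, with Cauchy-Schwarz
    for the linear term. Comparing with the square of [modulus x + C2 * enorm y] gives the Lipschitz
    bound; dividing by [modulus x >= d], through [2 m m' <= m^2 + m'^2], gives the second-order
    bound and its factor [1 / d]. *)
Lemma modulus_regular : exists C1 C2 Mh : R,
  [/\ 0 <= C1, 0 < C2, forall x, modulus x <= Mh,
    forall t, 0 < t -> exists k, [set x | t < modulus x] `<=` cube N k &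
    (forall x y, enorm y <= 1 -> modulus (x + y) <= modulus x + C2 * enorm y) /\
    (forall x y d, 0 < d -> d <= modulus x -> enorm y <= 1 ->
      modulus (x + y) <= modulus x + enorm y * gradient_norm x + C1 / d * enorm y ^+ 2)].
Proof.
have [Cu Cu0 [u0 u1 u2 u3]] := schwartz_bounds su.
have [Cv Cv0 [v0 v1 v2 v3]] := schwartz_bounds sv.
pose C := Cu + Cv.
have C0 : 0 <= C by rewrite addr_ge0.
have mle x : modulus x <= `|u x| + `|v x|.
  rewrite -(@ler_pXn2r _ 2) ?nnegrE ?modulus_ge0 ?addr_ge0// modulus_sqr.
  rewrite sqrrD !real_normK ?num_real//.
  have := mulr_ge0 (normr_ge0 (u x)) (normr_ge0 (v x)); lra.
pose K := N%:R * C; pose P := N%:R ^+ 2 * C.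
have K0 : 0 <= K by rewrite mulr_ge0.
have P0 : 0 <= P by rewrite mulr_ge0// exprn_ge0.
pose B := 2 * C * P + K ^+ 2.
have B0 : 0 <= B by rewrite addr_ge0 ?sqr_ge0// !mulr_ge0.
have quad (w : 'rV[R]_N -> R) (x y : 'rV[R]_N) : schwartz w ->
    (forall z, `|w z| <= C) -> (forall i z, `|dpart1 i w z| <= C) ->
    (forall i j z, `|dpart1 j (dpart1 i w) z| <= C) ->
    w (x + y) ^+ 2 <= w x ^+ 2 + 2 * (w x * \sum_(i < N) y ord0 i * dpart1 i w x)
      + B * enorm y ^+ 2.
  move=> sw w1 w2 w3.
  have dw z : differentiable w z by exact: (@schwartz_differentiable w [::]).
  have ddw i z : differentiable (dpart1 i w) z by exact: (@schwartz_differentiable w [:: i]).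
  have t1 := taylor_of_dpart x y dw ddw C0 w3.
  have t2 := lipschitz_of_dpart x y dw C0 w2.
  set a := \sum_(i < N) _ in t1 *; set d := w (x + y) - w x in t1 t2.
  have -> : w (x + y) = w x + d by rewrite [RHS]addrC subrK.
  have h1 : w x * (d - a) <= C * (P * enorm y ^+ 2).
    by rewrite (le_trans (ler_norm _))// normrM ler_pM.
  have h2 : d ^+ 2 <= K ^+ 2 * enorm y ^+ 2.
    by rewrite -exprMn -(real_normK (num_real d)) lerXn2r ?nnegrE ?mulr_ge0 ?enorm_ge0.
  by rewrite /B sqrrD; lra.
have sum_sq (x y : 'rV[R]_N) : u x * (\sum_(i < N) y ord0 i * dpart1 i u x) +
    v x * (\sum_(i < N) y ord0 i * dpart1 i v x) <= modulus x * (enorm y * gradient_norm x).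
  set a := \sum_(i < N) _; set b := \sum_(i < N) _.
  have ha : a ^+ 2 <= enorm y ^+ 2 * \sum_(i < N) dpart1 i u x ^+ 2 by exact: cauchy_schwarz_enorm.
  have hb : b ^+ 2 <= enorm y ^+ 2 * \sum_(i < N) dpart1 i v x ^+ 2 by exact: cauchy_schwarz_enorm.
  have hg := gradient_norm_sqr x; rewrite big_split/= in hg.
  have hm := modulus_sqr x.
  have M0 := modulus_ge0 x; have G0 := gradient_norm_ge0 x; have Y0 := enorm_ge0 y.
  have R0 : 0 <= modulus x * (enorm y * gradient_norm x) by rewrite !mulr_ge0.
  rewrite (le_trans (ler_norm _))// -(@ler_pXn2r _ 2) ?nnegrE// real_normK ?num_real//.
  rewrite [leRHS]exprMn hm exprMn hg mulrDr.
  apply: (@le_trans _ _ ((u x ^+ 2 + v x ^+ 2) * (a ^+ 2 + b ^+ 2))).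
    by have := sqr_ge0 (u x * b - v x * a); lra.
  by rewrite ler_wpM2l ?lerD// addr_ge0// sqr_ge0.
have T1 (x y : 'rV[R]_N) : modulus (x + y) ^+ 2 <=
    modulus x ^+ 2 + 2 * (modulus x * (enorm y * gradient_norm x)) + 2 * B * enorm y ^+ 2.
  rewrite !modulus_sqr; have := sum_sq x y.
  have CuC : Cu <= C by rewrite lerDl.
  have CvC : Cv <= C by rewrite lerDr.
  have := quad u x y su (fun z => le_trans (u1 z) CuC) (fun i z => le_trans (u2 i z) CuC)
    (fun i j z => le_trans (u3 i j z) CuC).
  have := quad v x y sv (fun z => le_trans (v1 z) CvC) (fun i z => le_trans (v2 i z) CvC)
    (fun i j z => le_trans (v3 i j z) CvC).
  by lra.
have gK x : gradient_norm x <= K.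
  rewrite -(@ler_pXn2r _ 2) ?nnegrE ?gradient_norm_ge0// gradient_norm_sqr.
  rewrite (le_trans (ler_sum _ (_ : forall i : 'I_N, true -> _ <= C ^+ 2)))//.
    move=> i _; rewrite -(real_normK (num_real (dpart1 i u x))) -(real_normK (num_real (dpart1 i v x))).
    have := u2 i x; have := v2 i x; have := normr_ge0 (dpart1 i u x).
    have := normr_ge0 (dpart1 i v x); rewrite /C; nra.
  rewrite sumr_const card_ord -mulr_natl exprMn ler_wpM2r ?sqr_ge0//.
  by rewrite ler_eXnr// ler1n.
exists B, (K + 2 * B + 1), (2 * C); split => //.
- by rewrite ltr_pwDr// addr_ge0// mulr_ge0.
- by move=> x; apply: le_trans (mle x) _; have := u1 x; have := v1 x; rewrite /C; lra.
- move=> t t0; exists (C / t) => x /= tx i.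
  apply: le_trans (ler_coord_enorm x i) _; rewrite ler_pdivlMr//.
  have := u0 x; have := v0 x; have := mle x; have := enorm_ge0 x.
  have := normr_ge0 (u x); have := normr_ge0 (v x); rewrite /C; nra.
split=> [x y y1|x y d d0 dx y1].
  have r0 := enorm_ge0 y; have M0 := modulus_ge0 x; have G0 := gradient_norm_ge0 x.
  set C2 := K + 2 * B + 1.
  have C21 : 1 <= C2 by rewrite /C2; lra.
  have C2B : 2 * B <= C2 by rewrite /C2; lra.
  have C2g : gradient_norm x <= C2 by apply: le_trans (gK x) _; rewrite /C2; lra.
  rewrite -(@ler_pXn2r _ 2) ?nnegrE ?modulus_ge0 ?addr_ge0 ?mulr_ge0 ?(le_trans ler01 C21)//.
  apply: le_trans (T1 x y) _; rewrite sqrrD -addrA -addrA lerD2l.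
  have h1 : modulus x * (enorm y * gradient_norm x) <= modulus x * (C2 * enorm y).
    by rewrite ler_wpM2l// mulrC ler_wpM2r.
  have h2 : 2 * B * enorm y ^+ 2 <= (C2 * enorm y) ^+ 2.
    rewrite exprMn ler_wpM2r ?sqr_ge0// (le_trans C2B)// expr2 ler_peMl// (le_trans ler01)//.
  by lra.
have M0 : 0 < modulus x by exact: lt_le_trans dx.
have h1 : B / modulus x * enorm y ^+ 2 <= B / d * enorm y ^+ 2.
  by rewrite ler_wpM2r ?sqr_ge0// ler_wpM2l// lef_pV2 ?posrE.
apply: (@le_trans _ _ (modulus x + enorm y * gradient_norm x + B / modulus x * enorm y ^+ 2)).
  rewrite -(ler_pM2l M0) (_ : modulus x * (_ + _ + _) =
    modulus x ^+ 2 + modulus x * (enorm y * gradient_norm x) + B * enorm y ^+ 2); last first.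
    by field; rewrite gt_eqF.
  have := T1 x y; have := sqr_ge0 (modulus (x + y) - modulus x); rewrite sqrrB; lra.
by rewrite lerD2l.
Qed.

End schwartz_modulus.

(** * Passing to the limit *)

Section ratio_to_one.
Context {R : realType}.

Lemma cvg_powR_nneg (T : Type) (F : set_system T) (FF : Filter F) (f : T -> R) (s l : R) :
  0 < s -> 0 <= l -> (\forall z \near F, 0 <= f z) ->
  f z @[z --> F] --> l -> (f z) `^ s @[z --> F] --> l `^ s.
Proof.
move=> s0; rewrite le_eqVlt => /predU1P[<-|l0] f0 fl.
  by rewrite powR0 ?gt_eqF//; exact: cvg_powR0.
apply: (@cvg_comp _ _ _ f (@powR R ^~ s) F (nbhs l)) => //.
exact: continuous_powR_gt0.
Qed.

(* With [lam = expR sg] one has [tau = sg + O(sg^2)] and [1 - gam = c sg + O(sg^2)]. *)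
Lemma ratio_close_to_one (n : nat) (eta : R) : (1 < n)%N -> 0 < eta < 1 ->
  let c : R := n.-1%:R / 2 in
  exists2 lam : R, 1 < lam &
  let tau := (lam ^+ n.+1 - 1) / n.+1%:R in let gam := lam `^ (- c) in
  [/\ 0 < tau, tau <= eta, 1 - eta <= gam, gam <= 1 &
    tau ^+ 2 * (c ^+ 2 - 1 / 4 + (1 - eta) / 4) <= (1 - gam) ^+ 2].
Proof.
move=> n1 /andP[eta0 eta1] c.
pose N : R := n.+1%:R.
have nE : n.-1%:R = N - 2 :> R.
  by case: n n1 @c @N => [//|[//|m]] _; rewrite /= -!natr1; lra.
have N3 : 3 <= N by rewrite ler_nat.
have cE : c = (N - 2) / 2 by rewrite /c nE.
(* This choice makes [8 N^2 S = eta] for [S = N sg], so that both [S] and [c^2 S] are small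
   fractions of [eta]. *)
pose sg := eta / (8 * N ^+ 3).
have N30 : 0 < 8 * N ^+ 3 by rewrite mulr_gt0// exprn_gt0//; lra.
have sg0 : 0 < sg by rewrite divr_gt0.
have sgE : sg * (8 * N ^+ 3) = eta by rewrite divfK// gt_eqF.
exists (expR sg); first by rewrite -expR0 ltr_expR.
have -> : expR sg ^+ n.+1 = expR (N * sg) by rewrite -expRM_natl mulr_natl.
have -> : expR sg `^ (- c) = expR (- (c * sg)) by rewrite /powR gt_eqF ?expR_gt0// expRK mulNr.
move=> tau gam.
have c0 : 2^-1 <= c by rewrite cE ler_pdivlMr//; lra.
have cN : c <= N / 2 by rewrite cE; lra.
have N2 : 0 < N ^+ 2 by rewrite exprn_gt0//; lra.
pose S := N * sg.
have S0 : 0 < S by rewrite mulr_gt0//; lra.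
have SE : 8 * (N ^+ 2 * S) = eta by rewrite -sgE /S; ring.
have N9 : 9 <= N ^+ 2 by nra.
have S1 : 72 * S <= eta by nra.
have csS : c * sg <= S / 2 by rewrite /S; nra.
have cs0 : 0 <= c * sg by rewrite mulr_ge0 ?ltW//; lra.
have c2S : c ^+ 2 * S <= eta / 32.
  have : c ^+ 2 <= N ^+ 2 / 4 by nra.
  by move=> h; have := ler_wpM2r (ltW S0) h; lra.
have N0 : 0 < N by lra.
have tauN : tau * N = expR S - 1 by rewrite /tau divfK// gt_eqF.
have e1 : 1 + S <= expR S by exact: expR_ge1Dx.
have e2 : expR S * (1 - S) <= 1.
  have := expR_ge1Dx (- S); rewrite expRN => h.
  by rewrite -(ler_pM2l (expR_gt0 S)) mulrV ?unitfE ?gt_eqF ?expR_gt0// in h.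
have e3 : 1 - c * sg <= gam by exact: expR_ge1Dx.
have e4 : gam * (1 + c * sg) <= 1.
  have := expR_ge1Dx (c * sg); rewrite /gam expRN => h.
  by rewrite mulrC ler_pdivrMr ?expR_gt0// mul1r.
have gam0 : 0 < gam by exact: expR_gt0.
have tau1 : sg <= tau by rewrite -(ler_pM2r N0) tauN mulrC -/S; lra.
have tau2 : tau * (1 - S) <= sg.
  by rewrite -(ler_pM2r N0) mulrAC tauN [sg * N]mulrC -/S; lra.
have gam1 : c * sg <= (1 - gam) * (1 + c * sg) by lra.
split.
- exact: lt_le_trans tau1.
- have : sg <= S by rewrite /S ler_peMl ?(ltW sg0)//; lra.
  by nra.
- by lra.
- by rewrite -expR0 ler_expR oppr_le0.
set a := 1 + c * sg in e4 gam1.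
have a1 : 1 <= a by rewrite lerDl.
have b1 : 0 < 1 - S by lra.
(* The bounds are [tau <= sg / (1 - S)] and [1 - gam >= c sg / a]. The resulting loss, at most
   [3 c^2 S], fits into the slack [eta / 4]. *)
have key : (c ^+ 2 - eta / 4) * a ^+ 2 <= c ^+ 2 * (1 - S) ^+ 2.
  have h1 : a ^+ 2 - (1 - S) ^+ 2 <= 3 * S by rewrite /a; nra.
  have := ler_wpM2l (sqr_ge0 c) h1; have : 1 <= a ^+ 2 by nra.
  by nra.
have ce : 0 <= c ^+ 2 - eta / 4 by nra.
have -> : c ^+ 2 - 1 / 4 + (1 - eta) / 4 = c ^+ 2 - eta / 4 by lra.
rewrite -(ler_pM2r (_ : 0 < (a * (1 - S)) ^+ 2)); last first.
  by rewrite exprn_gt0// mulr_gt0// (lt_le_trans ltr01 a1).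
have h1 : (tau * (1 - S)) ^+ 2 <= sg ^+ 2.
  rewrite lerXn2r ?nnegrE ?(ltW sg0)// mulr_ge0 ?(ltW b1)//.
  exact: le_trans (ltW sg0) tau1.
have h2 : (c * sg) ^+ 2 <= ((1 - gam) * a) ^+ 2.
  by rewrite lerXn2r ?nnegrE// (le_trans cs0).
apply: (@le_trans _ _ (sg ^+ 2 * ((c ^+ 2 - eta / 4) * a ^+ 2))).
  have := ler_wpM2r (mulr_ge0 ce (sqr_ge0 a)) h1; apply: le_trans.
  by rewrite le_eqVlt; apply/orP; left; apply/eqP; ring.
apply: le_trans (ler_wpM2l (sqr_ge0 sg) key) _.
rewrite (_ : sg ^+ 2 * _ = (c * sg) ^+ 2 * (1 - S) ^+ 2); last by ring.
apply: le_trans (ler_wpM2r (sqr_ge0 (1 - S)) h2) _.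
by rewrite le_eqVlt; apply/orP; left; apply/eqP; ring.
Qed.

End ratio_to_one.

(** * Vanishing of the lattice errors *)

Section lattice_to_continuum.
Context {R : realType}.

(** The coefficient [(1 - gam)^2] of [w_i^2] in the energy is split: the share [tau^2 kk] pays for
    the Hardy term, and the share [tau^2 theta / 4], together with [gam >= theta] on the
    differences, is [theta] times the form bounded by [discrete_bliss]. The maximum with [0] keeps
    the base of the power nonnegative, where the power is monotone. *)
Lemma lattice_inequality (p tau gam theta kk om en d X c2 cq : R) (w : nat -> R) L :
  let q := p + 2 in let al := q / p in
  0 < p -> 0 < tau -> tau <= 1 -> 0 < theta -> theta <= gam -> gam <= 1 -> 0 <= kk -> 0 < om ->
  tau ^+ 2 * (kk + theta / 4) <= (1 - gam) ^+ 2 ->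
  (forall i, 0 <= w i) -> (forall i, (L <= i)%N -> w i = 0) ->
  om / tau * \sum_(0 <= i < L) (w i - gam * w i.+1) ^+ 2 <= en ->
  d <= om * tau * (\sum_(0 <= i < L) w i ^+ 2 + c2) ->
  X <= om * tau * (\sum_(0 <= i < L) w i `^ q + cq) ->
  kk * d + om * theta / (1 + q * tau) *
    ((q / 8) `^ (2 / q) * (al * (4 * Psi p 1)) `^ (al^-1) *
      (Num.max (X / om - tau * cq) 0) `^ (2 / q) - w 0%N ^+ 2 / 2) <=
  en + om * kk * tau * c2.
Proof.
move=> q al p0 t0 t1 th0 thg g1 kk0 om0 hg w0 wL hen hd hX.
have q0 : 0 < q by rewrite addr_gt0.
rewrite lattice_square_sum in hen; last exact: wL.
set Sd := \sum_(0 <= i < L) (w i.+1 - w i) ^+ 2 in hen.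
set S2 := \sum_(0 <= i < L) w i ^+ 2 in hen hd.
set Sq := \sum_(0 <= i < L) _ in hX.
have Sd0 : 0 <= Sd by rewrite sumr_ge0// => i _; rewrite sqr_ge0.
have S20 : 0 <= S2 by rewrite sumr_ge0// => i _; rewrite sqr_ge0.
have Sq0 : 0 <= Sq by rewrite sumr_ge0// => i _; rewrite powR_ge0.
have := discrete_bliss p0 t0 t1 w0 wL; rewrite -/q -/al.
set Cp := _ * _ `^ (al^-1).
have Cp0 : 0 <= Cp by rewrite mulr_ge0// powR_ge0.
have -> : \sum_(0 <= k < L) ((w k.+1 - w k) ^+ 2 / tau + tau * w k ^+ 2 / 4) =
    Sd / tau + tau * S2 / 4.
  rewrite big_split/= -mulr_suml; congr (_ + _).
  by rewrite -mulr_suml -mulr_sumr.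
move=> bliss.
have qt0 : 0 < 1 + q * tau by rewrite addr_gt0// mulr_gt0.
have mX : Cp * (Num.max (X / om - tau * cq) 0) `^ (2 / q) <= Cp * (tau * Sq) `^ (2 / q).
  rewrite ler_wpM2l// ge0_ler_powR ?nnegrE ?divr_ge0 ?(ltW q0) ?mulr_ge0 ?(ltW t0)//.
    by rewrite le_max lexx orbT.
  rewrite ge_max mulr_ge0 ?(ltW t0)// andbT lerBlDr ler_pdivrMr//.
  by apply: le_trans hX _; rewrite le_eqVlt; apply/orP; left; apply/eqP; ring.
apply: (@le_trans _ _ (kk * (om * tau * (S2 + c2)) + om * theta * (Sd / tau + tau * S2 / 4))).
  apply: lerD; first exact: ler_wpM2l.
  rewrite -(mulrA (om * theta)) ler_wpM2l ?mulr_ge0 ?(ltW om0) ?(ltW th0)//.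
  rewrite mulrC ler_pdivrMr// mulrC; lra.
have E1 : om / tau * (theta * Sd + tau ^+ 2 * (kk + theta / 4) * S2) <= en.
  apply: le_trans hen; rewrite ler_wpM2l ?divr_ge0 ?(ltW om0) ?(ltW t0)//.
  have := ler_wpM2r Sd0 thg; have := ler_wpM2r S20 hg.
  have : 0 <= gam * (1 - gam) * w 0%N ^+ 2.
    by rewrite mulr_ge0 ?sqr_ge0// mulr_ge0 ?subr_ge0// (le_trans (ltW th0)).
  by lra.
have -> : kk * (om * tau * (S2 + c2)) + om * theta * (Sd / tau + tau * S2 / 4) =
  om / tau * (theta * Sd + tau ^+ 2 * (kk + theta / 4) * S2) + om * kk * tau * c2.
  by field; rewrite gt_eqF.
by rewrite lerD2r.
Qed.

(** For a fixed ratio all remaining defects come from the first value [w0]. Both sides are monotone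
    in it, so [w0] may be replaced by its bound [e], and continuity lets [e] tend to [0]. *)
Lemma lattice_defect_limit (q tau om kk b d X Cp en c2 cq : R) :
  2 < q -> 0 < tau -> 0 < om -> 0 <= kk -> 0 <= b -> 0 <= Cp -> 0 <= c2 -> 0 <= cq -> 0 <= X ->
  (forall e, 0 < e -> exists2 w0, 0 <= w0 <= e &
    kk * d + b * (Cp * (Num.max (X / om - tau * (w0 `^ q * cq)) 0) `^ (2 / q) - w0 ^+ 2 / 2)
      <= en + om * kk * tau * (w0 ^+ 2 * c2)) ->
  kk * d + b * (Cp * (X / om) `^ (2 / q)) <= en.
Proof.
move=> q2 t0 om0 kk0 b0 Cp0 c20 cq0 X0 H.
have q0 : 0 < q by lra.
pose lhs (e : R) := kk * d + b * (Cp * (Num.max (X / om - tau * (e `^ q * cq)) 0) `^ (2 / q) - e ^+ 2 / 2).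
pose rhs (e : R) := en + om * kk * tau * (e ^+ 2 * c2).
have hle e : 0 < e -> lhs e <= rhs e.
  move=> e0; have [w0 /andP[w00 w0e] hw] := H e e0.
  have sq : w0 ^+ 2 <= e ^+ 2 by rewrite lerXn2r ?nnegrE// ltW.
  have pq : w0 `^ q <= e `^ q by rewrite ge0_ler_powR ?nnegrE ?(ltW q0)// ltW.
  apply: le_trans (le_trans hw _); rewrite /lhs /rhs.
    have mx : Num.max (X / om - tau * (e `^ q * cq)) 0 <=
        Num.max (X / om - tau * (w0 `^ q * cq)) 0.
      rewrite ge_max !le_max lexx orbT andbT; apply/orP; left.
      apply: lerB; first exact: lexx.
      by apply: ler_wpM2l; [exact: ltW|apply: ler_wpM2r].
    rewrite lerD2l; apply: ler_wpM2l; first exact: b0.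
    apply: lerB; last by apply: ler_wpM2r; [rewrite invr_ge0|exact: sq].
    apply: ler_wpM2l; first exact: Cp0.
    apply: ge0_ler_powR; rewrite ?nnegrE; last exact: mx.
    - by rewrite divr_ge0// ltW.
    - by rewrite le_max lexx orbT.
    - by rewrite le_max lexx orbT.
  by rewrite lerD2l ler_wpM2l ?mulr_ge0 ?(ltW om0) ?(ltW t0)// ler_wpM2r.
have e2 : e ^+ 2 @[e --> (0 : R)^'+] --> (0 : R).
  apply: cvg_at_right_filter; rewrite -[X in _ --> X](mulr0 (0 : R)).
  by under eq_fun do rewrite expr2; apply: cvgM; exact: cvg_id.
have eq0 : e `^ q @[e --> (0 : R)^'+] --> (0 : R).
  apply: cvg_powR0 => //; last exact: cvg_at_right_filter.
  by near=> e.
have XO : 0 <= X / om by rewrite divr_ge0// ltW.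
have Hl : X / om - tau * (e `^ q * cq) @[e --> (0 : R)^'+] --> X / om.
  rewrite -[X in _ --> X]subr0; apply: cvgB; first exact: cvg_cst.
  rewrite -[X in _ --> X](mulr0 tau); apply: cvgM; first exact: cvg_cst.
  by rewrite -[X in _ --> X](mul0r cq); apply: cvgM => //; exact: cvg_cst.
have Hm : Num.max (X / om - tau * (e `^ q * cq)) 0 @[e --> (0 : R)^'+] --> X / om.
  rewrite -[X in _ --> X](_ : Num.max (X / om) 0 = _); last by apply/max_idPl.
  apply: (@cvg_comp _ _ _ (fun e : R => X / om - tau * (e `^ q * cq))
    (fun y : R => Num.max y 0) _ (nbhs (X / om)) _ Hl).
  by apply: (@continuous_max R R id (fun=> 0)); [exact: cvg_id|exact: cvg_cst].
have L1 : lhs e @[e --> (0 : R)^'+] --> kk * d + b * (Cp * (X / om) `^ (2 / q)).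
  apply: cvgD; first exact: cvg_cst.
  apply: cvgM; first exact: cvg_cst.
  rewrite -[X in _ --> X]subr0; apply: cvgB.
    apply: cvgM; first exact: cvg_cst.
    apply: cvg_powR_nneg => //; first by rewrite divr_gt0.
    by near=> e; rewrite le_max lexx orbT.
  by rewrite -[X in _ --> X](mul0r (2^-1)); apply: cvgM => //; exact: cvg_cst.
have L2 : rhs e @[e --> (0 : R)^'+] --> en.
  rewrite -[X in _ --> X]addr0; apply: cvgD; first exact: cvg_cst.
  rewrite -[X in _ --> X](mulr0 (om * kk * tau)); apply: cvgM; first exact: cvg_cst.
  by rewrite -[X in _ --> X](mul0r c2); apply: cvgM => //; exact: cvg_cst.
apply: (ler_cvg_to L1 L2); near=> e; apply: hle; by near: e; exact: nbhs_right_gt.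
Unshelve. all: end_near. Qed.

(** For [tau <= eta] the factor is at least [1 - q eta - eta], which tends to [1]. *)
Lemma ratio_defect_limit (q kd Z en : R) : 0 < q -> 0 <= Z ->
  (forall eta, 0 < eta < 1 -> exists2 tau, 0 < tau <= eta &
     kd + (1 - eta) / (1 + q * tau) * Z <= en) -> kd + Z <= en.
Proof.
move=> q0 Z0 H.
have L1 : kd + (1 - q * e - e) * Z @[e --> (0 : R)^'+] --> kd + Z.
  apply: cvgD; first exact: cvg_cst.
  rewrite -[X in _ --> X](_ : (1 - q * 0 - 0) * Z = Z); last by ring.
  apply: cvg_at_right_filter; apply: cvgM; last exact: cvg_cst.
  apply: cvgB; last exact: cvg_id.
  by apply: cvgB; [exact: cvg_cst|apply: cvgM; [exact: cvg_cst|exact: cvg_id]].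
apply: (ler_cvg_to L1 (cvg_cst en)); near=> e.
have e0 : 0 < e by near: e; exact: nbhs_right_gt.
have e1 : e < 1 by near: e; exact: nbhs_right_lt.
have [|tau /andP[t0 te]] := H e; first by rewrite e0 e1.
apply: le_trans; rewrite lerD2l ler_wpM2r// ler_pdivlMr; last by rewrite addr_gt0// mulr_gt0.
have qt : q * tau <= q * e by rewrite ler_pM2l.
have qt0 : 0 < q * tau by rewrite mulr_gt0.
by nra.
Unshelve. all: end_near. Qed.

End lattice_to_continuum.

Definition bliss_const {R : realType} (q : R) : R :=
  let al := q / (q - 2) in (q / 8) `^ (2 / q) * (al * (4 * Psi (q - 2) 1)) `^ (al^-1).

Definition level_trunc {R : realType} {T : Type} (f : T -> R) (s S : R) (x : T) : R :=
  Num.max (Num.min (f x) S - s) 0.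

(** * Removal of the truncations *)

Section supremum_of_truncations.
Context {R : realType}.

Lemma ereal_real_between (M : R) (y : \bar R) : (M%:E < y)%E ->
  exists2 x : R, M < x & (x%:E <= y)%E.
Proof.
case: y => [r|_|//]; first by rewrite lte_fin => Mr; exists r.
by exists (M + 1); [rewrite ltrDl|rewrite leey].
Qed.

(** The integrals may a priori be infinite, so the inequality is tested on reals [d] and [x] below
    them. Solving for [x] with [d] fixed bounds every [B_ j], hence [B]; with that term fixed,
    solving for [d] bounds [A]. Vanishing coefficients are treated apart, since a zero coefficient
    gives no bound on its integral. *)
Lemma two_term_limit (kk Z en s : R) (A_ B_ : nat -> \bar R) (A B : \bar R) :
  0 <= kk -> 0 <= Z -> 0 < s -> (forall k, 0 <= A_ k)%E -> (forall k, 0 <= B_ k)%E ->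
  {homo A_ : i j / (i <= j)%N >-> (i <= j)%E} -> {homo B_ : i j / (i <= j)%N >-> (i <= j)%E} ->
  (0 <= A)%E -> (0 <= B)%E ->
  (forall c, (forall k, A_ k <= c) -> A <= c)%E ->
  (forall c, (forall k, B_ k <= c) -> B <= c)%E ->
  (forall k d x, 0 <= d -> 0 <= x -> (d%:E <= A_ k)%E -> (x%:E <= B_ k)%E ->
    kk * d + Z * x `^ s <= en) ->
  (kk%:E * A + Z%:E * B `^ s <= en%:E)%E.
Proof.
move=> kk0 Z0 s0 A_0 B_0 ndA ndB A0 B0 supA supB H.
have stepB k d : 0 <= d -> (d%:E <= A_ k)%E -> ((kk * d)%:E + Z%:E * B `^ s <= en%:E)%E.
  move=> d0 dA; have H0 : kk * d <= en.
    by have := H k d 0 d0 (lexx 0) dA (B_0 k); rewrite powR0 ?gt_eqF// mulr0 addr0.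
  move: Z0; rewrite le_eqVlt => /predU1P[Z0|Z0]; first by rewrite -Z0 mul0e adde0 lee_fin.
  pose T := (en - kk * d) / Z; have T0 : 0 <= T by rewrite divr_ge0 ?subr_ge0// ltW.
  pose M := T `^ s^-1; have M0 : 0 <= M by exact: powR_ge0.
  have MT : M `^ s = T by rewrite /M -powRrM mulVf ?gt_eqF// powRr1.
  have BM : (B <= M%:E)%E.
    apply: supB => j; rewrite leNgt; apply/negP => Mj.
    have [x Mx xB] := ereal_real_between (lt_le_trans Mj (ndB _ _ (leq_maxl j k))).
    have x0 : 0 <= x by exact: le_trans M0 (ltW Mx).
    have := H _ d x d0 x0 (le_trans dA (ndA _ _ (leq_maxr j k))) xB.
    rewrite addrC -lerBrDr mulrC -ler_pdivlMr// -/T -MT.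
    rewrite leNgt => /negP; apply.
    by apply: gt0_ltr_powR; rewrite ?nnegrE.
  move: B0 BM; case: (B) => [r| |]//; rewrite !lee_fin => r0 rM.
  rewrite addrC -lerBrDr mulrC -ler_pdivlMr// -/T -MT.
  by apply: ge0_ler_powR; rewrite ?nnegrE ?(ltW s0).
have zb0 : (0 <= Z%:E * B `^ s)%E by rewrite mule_ge0 ?lee_fin// poweR_ge0.
have := stepB 0%N 0 (lexx 0) (A_0 _); rewrite mulr0 add0e.
move: zb0 stepB; case: (Z%:E * B `^ s)%E => [z| |]// z0 stepB zen.
move: kk0; rewrite le_eqVlt => /predU1P[kk0|kk0]; first by rewrite -kk0 mul0e add0e.
pose M := (en - z) / kk.
have M0 : 0 <= M by rewrite divr_ge0 ?(ltW kk0)// subr_ge0 -lee_fin.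
have AM : (A <= M%:E)%E.
  apply: supA => j; rewrite leNgt; apply/negP => Mj.
  have [d Md dA] := ereal_real_between Mj.
  have d0 : 0 <= d by exact: le_trans M0 (ltW Md).
  have := stepB j d d0 dA; rewrite -EFinD lee_fin -lerBrDr mulrC -ler_pdivlMr// -/M.
  by rewrite leNgt Md.
move: A0 AM; case: (A) => [r| |]//; rewrite !lee_fin => r0 rM.
by rewrite -lerBrDr mulrC -ler_pdivlMr.
Qed.

Lemma level_trunc_ge0 (T : Type) (f : T -> R) s S x : 0 <= level_trunc f s S x.
Proof. by rewrite le_max lexx orbT. Qed.

Lemma level_trunc_homo (T : Type) (f : T -> R) M x i j : (i <= j)%N ->
  level_trunc f i.+1%:R^-1 (M - i.+1%:R^-1) x <= level_trunc f j.+1%:R^-1 (M - j.+1%:R^-1) x.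
Proof.
move=> ij; have le_ij : j.+1%:R^-1 <= i.+1%:R^-1 :> R by rewrite lef_pV2 ?posrE ?ler_nat.
rewrite /level_trunc ge_max !le_max lexx orbT andbT; apply/orP; left.
apply: lerB => //; rewrite le_min !ge_min lexx/=; apply/orP; right.
exact: lerB.
Qed.

Lemma cvg_level_trunc (T : Type) (f : T -> R) M x : 0 <= f x <= M ->
  level_trunc f k.+1%:R^-1 (M - k.+1%:R^-1) x @[k --> \oo] --> f x.
Proof.
move=> /andP[f0 fM]; pose G (s : R) := level_trunc f s (M - s) x.
have G0 : G 0 = f x.
  by rewrite /G /level_trunc !subr0 (min_idPl fM); apply/max_idPl.
have cG : {for 0, continuous G}.
  apply: (@continuous_max R R (fun s => Num.min (f x) (M - s) - s) (fun=> 0)); last exact: cvg_cst.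
  apply: cvgB; last exact: cvg_id.
  apply: (@continuous_min R R (fun=> f x) (fun s => M - s)); first exact: cvg_cst.
  by apply: cvgB; [exact: cvg_cst|exact: cvg_id].
rewrite -G0; apply: (@cvg_comp _ _ _ (fun k : nat => k.+1%:R^-1 : R) G _ (nbhs 0)) => //.
exact: cvg_harmonic.
Qed.

End supremum_of_truncations.

(** * The weighted inequality for a function with finite energy *)

Section hardy_sobolev.
Context {R : realType} (n : nat).
Local Notation N := n.+1.
Variables (h g : 'rV[R]_N -> R) (C1 C2 Mh : R).
Hypothesis n1 : (1 < n)%N.
Hypotheses (mh : measurable_fun setT h) (mg : measurable_fun setT g).
Hypotheses (h0 : forall x, 0 <= h x) (g0 : forall x, 0 <= g x).
Hypothesis hM : forall x, h x <= Mh.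
Hypothesis C10 : 0 <= C1.
Hypothesis C20 : 0 < C2.
Hypothesis h_lip : forall x y, enorm y <= 1 -> h (x + y) <= h x + C2 * enorm y.
Hypothesis h_taylor : forall x y d, 0 < d -> d <= h x -> enorm y <= 1 ->
  h (x + y) <= h x + enorm y * g x + C1 / d * enorm y ^+ 2.
Hypothesis h_decay : forall t, 0 < t -> exists k, [set x | t < h x] `<=` cube N k.
Variable en : R.
Hypothesis energy_le : (\int[vol N]_x (g x ^+ 2)%:E <= en%:E)%E.

Let c : R := n.-1%:R / 2.
Let c0 : 0 < c.
Proof. by rewrite divr_gt0// ltr0n; case: n n1 => [|[]]. Qed.
Let h_fin s : 0 < s -> vol N [set x | s < h x] \is a fin_num.
Proof.
by move=> /h_decay[k hk]; apply: vol_sub_cube hk; exact: measurable_ltr_set.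
Qed.
Let k0 : 0 < kappa N :> R. Proof. exact: kappa_gt0. Qed.

(** Beyond [L] the lattice values could be negative, so [w] is set to [0] there; at [L] they already
    vanish. The factor [lam^(-c)] brings [w_(i+1)] back to the radius [r_i], so that [w_i - lam^(-c)
    w_(i+1) = r_i^c (t_i - t_(i+1))], the quantity in [lattice_energy]. *)
Lemma lattice_sequence (lam r0 : R) (L : nat) : 1 < lam -> 0 < r0 ->
  let tau := (lam ^+ N - 1) / N%:R in
  exists w : nat -> R, [/\ forall i, 0 <= w i, forall i, (L <= i)%N -> w i = 0,
    w 0%N = lattice_val h lam r0 L c 0,
    N%:R * kappa N / tau * \sum_(0 <= i < L) (w i - lam `^ (- c) * w i.+1) ^+ 2 <= en &
    forall b p, 0 <= b -> 0 < p -> b + p * c = N%:R ->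
      (\int[vol N]_x (radial_weight b x * lattice_trunc h lam r0 L x `^ p)%:E <=
      (N%:R * kappa N * tau *
        (\sum_(0 <= i < L) w i `^ p + w 0%N `^ p / (lam `^ (p * c) - 1)))%:E)%E].
Proof.
move=> lam1 r00 tau.
have lam0 : 0 < lam by exact: lt_trans lam1.
have r_ge0 i : 0 <= r0 * lam ^+ i by rewrite mulr_ge0 ?exprn_ge0 ?ltW.
pose t i := radial_profile h (r0 * lam ^+ i).
have tle i j : (i <= j)%N -> t j <= t i.
  move=> ij; apply: (radial_profile_decr h0 hM) => //.
  by rewrite ler_wpM2l ?(ltW r00)// ler_weXn2l// ltW.
pose W := lattice_val h lam r0 L c.
have WE i : W i = (r0 * lam ^+ i) `^ c * (t i - t L) by [].
have WL : W L = 0 by rewrite WE subrr mulr0.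
have en_le := le_trans (lattice_energy (ltnW n1) mh mg h0 g0 hM C10 C20 h_lip h_taylor h_decay
  L lam1 r00) energy_le.
rewrite lee_fin in en_le.
have en_le' : N%:R * kappa N / tau *
    \sum_(0 <= i < L) ((t i - t i.+1) ^+ 2 * (r0 * lam ^+ i) ^+ n.-1) <= en by exact: en_le.
have weight_le b p b0 p0 bp := @lattice_weight R n h Mh mh h0 hM lam r0 L lam1 r00 b p c b0 p0 c0 bp.
have -> : lattice_val h lam r0 L c 0 = W 0%N by [].
have {}weight_le b p : 0 <= b -> 0 < p -> b + p * c = N%:R ->
    (\int[vol N]_x (radial_weight b x * lattice_trunc h lam r0 L x `^ p)%:E <=
      (N%:R * kappa N * tau *
        (\sum_(0 <= i < L) W i `^ p + W 0%N `^ p / (lam `^ (p * c) - 1)))%:E)%E.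
  by move=> b0 p0 bp; exact: weight_le.
clear en_le; clearbody W t tau.
pose w i := if (i < L)%N then W i else 0.
have wW i : (i <= L)%N -> w i = W i.
  by rewrite leq_eqVlt /w => /predU1P[->|->]//; rewrite ltnn WL.
exists w; split.
- move=> i; rewrite /w; case: ifP => // iL.
  by rewrite WE mulr_ge0 ?powR_ge0// subr_ge0 tle// ltnW.
- by move=> i Li; rewrite /w ltnNge Li.
- exact: wW.
- apply: le_trans en_le'; rewrite le_eqVlt; apply/orP; left; apply/eqP.
  congr (_ * _); apply: eq_big_nat => i /andP[_ iL].
  rewrite !wW//; last exact: ltnW.
  have ri0 : 0 < r0 * lam ^+ i by rewrite mulr_gt0// exprn_gt0.
  have -> : lam `^ (- c) * W i.+1 = (r0 * lam ^+ i) `^ c * (t i.+1 - t L).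
    rewrite WE (_ : r0 * lam ^+ i.+1 = lam * (r0 * lam ^+ i)); last by rewrite exprS mulrCA.
    rewrite powRM ?(ltW lam0) ?(ltW ri0)// !mulrA -powRD; last first.
      by rewrite (gt_eqF lam0) implybT.
    by rewrite addNr powRr0 mul1r.
  rewrite WE -mulrBr (_ : t i - t L - _ = t i - t i.+1); last by ring.
  rewrite exprMn mulrC; congr (_ * _).
  rewrite -[LHS]powR_mulrn ?powR_ge0// -[RHS]powR_mulrn ?(ltW ri0)// -powRrM.
  by rewrite /c divfK.
- move=> b p b0 p0 bp; apply: le_trans (weight_le b p b0 p0 bp) _.
  rewrite wW// lee_fin le_eqVlt; apply/orP; left; apply/eqP; congr (_ * (_ + _)).
  by apply: eq_big_nat => i /andP[_ /ltnW iL]; rewrite wW.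
Qed.

(** Take [r_0 = lam^(-M)] and [r_L = lam^M] with [M] large: the ball of radius [r_L] outgrows
    [{s < h}], the ball of radius [r_0] has less volume than [{S < h}], and the bounded profile
    times [r_0^c] drops below [e]. *)
Lemma lattice_choice (lam s S v0 e : R) : 1 < lam -> 0 < s -> 0 < v0 ->
  (v0%:E <= vol N [set x | (S < h x)%R])%E -> 0 < e ->
  exists r0 L, [/\ 0 < r0, radial_profile h (r0 * lam ^+ L) <= s,
    S <= radial_profile h (r0 * lam ^+ 0) & lattice_val h lam r0 L c 0 <= e].
Proof.
move=> lam1 s0 v00 v0S e0.
have lam0 : 0 < lam by exact: lt_trans lam1.
have Mh0 : 0 <= Mh by exact: le_trans (h0 0) (hM 0).
pose V := fine (vol N [set x | s < h x]).
have VE : vol N [set x | s < h x] = V%:E by rewrite fineK// h_fin.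
have [a1 A1] := pow_unbounded (V / kappa N) lam1.
(* The [+ 1] makes the volume comparison strict, as [radial_profile_ge] demands. *)
have [a2 A2] := pow_unbounded (kappa N / v0 + 1) lam1.
have [a3 A3] := pow_unbounded (((Mh + 1) / e) `^ c^-1) lam1.
pose M := (a1 + a2 + a3)%N.
have {}A1 : V / kappa N <= lam ^+ M by apply: A1; rewrite /M -addnA leq_addr.
have {}A2 : kappa N / v0 + 1 <= lam ^+ M by apply: A2; rewrite /M addnAC leq_addl.
have {}A3 : ((Mh + 1) / e) `^ c^-1 <= lam ^+ M by apply: A3; rewrite /M leq_addl.
clearbody M; set l := lam ^+ M in A1 A2 A3.
have l1 : 1 <= l by rewrite exprn_ege1// ltW.
have l0 : 0 < l by exact: lt_le_trans l1.
exists l^-1, (M + M)%N.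
have rL : l^-1 * lam ^+ (M + M) = l by rewrite exprD -/l mulKf// gt_eqF.
have lV0 : 0 < l^-1 by rewrite invr_gt0.
have tM (r : R) : 0 <= r -> radial_profile h r <= Mh by exact: radial_profile_le_bound.
have tG0 (r : R) : 0 <= r -> 0 <= radial_profile h r by exact: radial_profile_ge0.
split => //.
- rewrite rL; apply: (radial_profile_le h0 hM (ltW l0) (ltW s0)).
  rewrite VE lee_fin mulrC -ler_pdivrMr//; apply: le_trans A1 _.
  by rewrite ler_eXnr.
- rewrite expr0 mulr1; apply: (radial_profile_ge mh h0 hM (ltW lV0)).
  apply: lt_le_trans v0S; rewrite lte_fin.
  apply: (@le_lt_trans _ _ (kappa N * l^-1)).
    by rewrite ler_wpM2l ?(ltW k0)// ler_iXnr ?(ltW lV0)// invf_le1.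
  by rewrite ltr_pdivrMr// mulrC -ltr_pdivrMr//; apply: lt_le_trans A2; rewrite ltrDl.
rewrite /lattice_val rL expr0 mulr1.
apply: (@le_trans _ _ (l^-1 `^ c * (Mh + 1))).
  rewrite ler_wpM2l ?powR_ge0//.
  rewrite lerBlDr (le_trans (tM _ (ltW lV0)))// -addrA lerDl addr_ge0//.
  exact: tG0 (ltW l0).
have A4 : (Mh + 1) / e <= l `^ c.
  have z0 : 0 <= (Mh + 1) / e by rewrite divr_ge0 ?(ltW e0)// addr_ge0.
  rewrite -[leLHS]powRr1// -[X in _ `^ X <= _](mulVf (lt0r_neq0 c0)) powRrM.
  by rewrite ge0_ler_powR ?nnegrE ?powR_ge0 ?(ltW c0) ?(ltW l0).
have -> : l^-1 `^ c = (l `^ c)^-1.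
  by rewrite -powR_inv1 ?(ltW l0)// -powRrM mulN1r powRN.
by rewrite mulrC ler_pdivrMr ?powR_gt0// mulrC -ler_pdivrMr.
Qed.

Lemma measurable_level_trunc s S : measurable_fun setT (level_trunc h s S).
Proof.
apply: measurable_maxr => //; apply: measurable_funB => //.
exact: measurable_minr.
Qed.

Lemma level_trunc_integral_le (b p s S lam r0 : R) L : 0 < p ->
  radial_profile h (r0 * lam ^+ L) <= s -> S <= radial_profile h (r0 * lam ^+ 0) ->
  (\int[vol N]_x (radial_weight b x * level_trunc h s S x `^ p)%:E <=
   \int[vol N]_x (radial_weight b x * lattice_trunc h lam r0 L x `^ p)%:E)%E.
Proof.
move=> p0 ts St.
have m1 : measurable_fun setT (lattice_trunc h lam r0 L) by exact: measurable_level_trunc.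
have mw (f : 'rV[R]_N -> R) : measurable_fun setT f ->
    measurable_fun setT (fun x => (radial_weight b x * f x `^ p)%:E).
  move=> mf; apply/measurable_EFinP; apply: measurable_funM; first exact: measurable_radial_weight.
  by apply: (measurableT_comp (measurable_powR p)).
have w0 (f : 'rV[R]_N -> R) x : (0 <= (radial_weight b x * f x `^ p)%:E)%E.
  by rewrite lee_fin mulr_ge0 ?radial_weight_ge0 ?powR_ge0.
apply: ge0_le_integral => //.
- by apply: mw; exact: measurable_level_trunc.
- exact: mw.
move=> x _; rewrite lee_fin ler_wpM2l ?radial_weight_ge0//.
have le0 a : 0 <= Num.max a 0 :> R by rewrite le_max lexx orbT.
apply: ge0_ler_powR; rewrite ?nnegrE ?le0 ?(ltW p0)//.
rewrite /level_trunc /lattice_trunc ge_max !le_max lexx orbT andbT; apply/orP; left.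
apply: lerB => //; rewrite le_min !ge_min lexx/=; apply/orP; right.
exact: St.
Qed.

(** With the truncation levels fixed, [eta] determines [lam], and for every [e] a lattice exists
    whose extreme levels enclose [[s, S]], so its truncation dominates the given one.
    [lattice_inequality] is used with [theta = 1 - eta]; then [e] and [eta] tend to [0] in this
    order. *)
Lemma truncated_hardy_sobolev (q b s S v0 d X : R) :
  2 < q -> 0 <= b -> b + q * c = N%:R ->
  0 < s -> 0 < v0 -> (v0%:E <= vol N [set x | (S < h x)%R])%E -> 0 <= X ->
  (d%:E <= \int[vol N]_x (radial_weight 2 x * level_trunc h s S x `^ 2)%:E)%E ->
  (X%:E <= \int[vol N]_x (radial_weight b x * level_trunc h s S x `^ q)%:E)%E ->
  (c ^+ 2 - 1 / 4) * d +
    N%:R * kappa N * (bliss_const q * (X / (N%:R * kappa N)) `^ (2 / q)) <= en.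
Proof.
move=> q2 b0 bq s0 v00 v0S X0 dle Xle.
have q0 : 0 < q by lra.
have p0 : 0 < q - 2 by rewrite subr_gt0.
have qE : q - 2 + 2 = q by ring.
set om := N%:R * kappa N.
have om0 : 0 < om by rewrite mulr_gt0.
have B0 : 0 <= bliss_const q by rewrite mulr_ge0// powR_ge0.
have c12 : 1 / 2 <= c.
  rewrite /c ler_pM2r ?invr_gt0// ler1n; case: n n1 => [|[]]//.
have kk0 : 0 <= c ^+ 2 - 1 / 4 by nra.
have c2N : 2 + 2 * c = N%:R.
  rewrite /c mulrC divfK//; case: n n1 => [//|[//|m]] _ /=.
  by rewrite -!natr1; ring.
apply: (@ratio_defect_limit R q) => //.
  by rewrite mulr_ge0 ?(ltW om0)// mulr_ge0// powR_ge0.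
move=> eta eta01; have [lam lam1] := ratio_close_to_one n1 eta01.
pose tau := (lam ^+ N - 1) / N%:R; pose gam := lam `^ (- c).
rewrite -/c -/tau -/gam => -[t0 te geta g1 key].
have /andP[eta0 eta1] := eta01.
exists tau; first by rewrite t0 te.
rewrite mulrA [X in _ + X](_ : _ =
  om * (1 - eta) / (1 + q * tau) * (bliss_const q * (X / om) `^ (2 / q))); last by ring.
have lam0 : 0 < lam by exact: lt_trans lam1.
have lp (a : R) : 0 < a -> 0 <= (lam `^ (a * c) - 1)^-1.
  move=> a0; rewrite invr_ge0 subr_ge0 -[leLHS](powRr0 lam) ler_powR ?(ltW lam1)//.
  by rewrite mulr_ge0 ?(ltW a0) ?(ltW c0).
apply: (@lattice_defect_limit R q tau om (c ^+ 2 - 1 / 4) (om * (1 - eta) / (1 + q * tau))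
  d X _ en (lam `^ (2 * c) - 1)^-1 (lam `^ (q * c) - 1)^-1) => //.
- apply: divr_ge0; first by apply: mulr_ge0; [exact: ltW|rewrite subr_ge0 ltW].
  by apply: addr_ge0 => //; apply: mulr_ge0; exact: ltW.
- by apply: lp.
- by apply: lp.
move=> e e0.
have [r0 [L [r00 tL tS we]]] := lattice_choice lam1 s0 v00 v0S e0.
have [w [w0 wL wE wen ww]] := lattice_sequence L lam1 r00.
exists (w 0%N); first by rewrite w0 wE we.
have := @lattice_inequality R (q - 2) tau gam (1 - eta) (c ^+ 2 - 1 / 4) om en d X
  (w 0%N ^+ 2 * (lam `^ (2 * c) - 1)^-1) (w 0%N `^ q * (lam `^ (q * c) - 1)^-1) w L.
rewrite qE; apply => //.
- by apply: le_trans te _; exact: ltW.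
- by rewrite subr_gt0.
- rewrite -lee_fin; apply: le_trans dle _.
  apply: le_trans (level_trunc_integral_le _ _ tL tS) _ => //.
  apply: le_trans (ww 2 2 _ _ c2N) _ => //.
  rewrite lee_fin le_eqVlt; apply/orP; left; apply/eqP; rewrite -/tau -/om.
  rewrite [w 0%N `^ _]powR_mulrn//; congr (_ * (_ + _)).
  by apply: eq_bigr => i _; rewrite powR_mulrn.
- rewrite -lee_fin; apply: le_trans Xle _.
  apply: le_trans (level_trunc_integral_le _ _ tL tS) _ => //.
  exact: ww.
Qed.

Lemma vol_superlevel_gt0 (S : R) (x0 : 'rV[R]_N) : S < h x0 ->
  exists2 v0 : R, 0 < v0 & (v0%:E <= vol N [set x | (S < h x)%R])%E.
Proof.
move=> Sx0; pose e := Num.min 1 ((h x0 - S) / C2).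
have e0 : 0 < e by rewrite lt_min ltr01 divr_gt0// subr_gt0.
exists (kappa N * e ^+ N); first by rewrite mulr_gt0 ?kappa_gt0// exprn_gt0.
have mS : measurable [set x | S < h x] by exact: measurable_ltr_set.
rewrite (vol_affine x0 ltr01 mS) expr1n mul1e -vol_eball ?(ltW e0)//.
apply: le_measure; rewrite ?inE; first exact: measurable_eball.
  rewrite (_ : mkset _ = (fun x => 1 *: x + x0) @^-1` [set x | S < h x])//.
  rewrite -[X in measurable X]setTI; apply: (_ : measurable_fun setT _) => //.
  apply/measurable_rVP => i; under eq_fun do rewrite mxE scale1r.
  by apply: measurable_funD => //; exact: measurable_coord.
move=> y; rewrite /eball /= => ye; rewrite scale1r.
have y1 : enorm y <= 1 by apply: ltW; apply: lt_le_trans ye _; rewrite ge_min lexx.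
have : enorm y < (h x0 - S) / C2 by apply: lt_le_trans ye _; rewrite ge_min lexx orbT.
rewrite ltr_pdivlMr// => y2.
have yN : enorm (- y) = enorm y by congr Num.sqrt; apply: eq_bigr => i _; rewrite mxE sqrrN.
have := @h_lip (y + x0) (- y); rewrite yN => /(_ y1).
rewrite addrAC subrr add0r mulrC => hl; lra.
Qed.

Lemma hardy_sobolev_finite_energy (q b : R) :
  2 < q -> 0 <= b -> b + q * (n.-1%:R / 2) = N%:R ->
  (((n.-1%:R / 2) ^+ 2 - 1 / 4)%:E * \int[vol N]_x (radial_weight 2 x * h x `^ 2)%:E +
   (N%:R * kappa N * (bliss_const q * (N%:R * kappa N)^-1 `^ (2 / q)))%:E *
     (\int[vol N]_x (radial_weight b x * h x `^ q)%:E) `^ (2 / q) <= en%:E)%E.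
Proof.
move=> q2 b0 bq; have q0 : 0 < q by lra.
rewrite -/c; set om := N%:R * kappa N.
have om0 : 0 < om by rewrite mulr_gt0.
have c12 : 1 / 2 <= c.
  rewrite /c ler_pM2r ?invr_gt0// ler1n; case: n n1 => [|[]]//.
have hr : has_sup (range h).
  by split; [exists (h 0), 0|exists Mh => _ [x _ <-]; exact: hM].
(* The supremum, rather than the bound [Mh], ensures that [h] exceeds [M - 1/(k+1)] somewhere, hence
   on a set of positive volume, which the lattice needs at its inner end. *)
pose M := sup (range h).
have hM' x : h x <= M by apply: ub_le_sup; [case: hr|exists x].
pose Y k := level_trunc h k.+1%:R^-1 (M - k.+1%:R^-1).
have mY k : measurable_fun setT (Y k) by exact: measurable_level_trunc.
have Y0 k x : 0 <= Y k x by exact: level_trunc_ge0.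
have Yh x : {homo Y ^~ x : i j / (i <= j)%N >-> i <= j}.
  by move=> i j; exact: level_trunc_homo.
have Yc x : Y k x @[k --> \oo] --> h x by apply: cvg_level_trunc; rewrite h0 hM'.
pose F b' p k x := radial_weight b' x * Y k x `^ p.
have mF b' p k : measurable_fun setT (F b' p k).
  apply: measurable_funM; first exact: measurable_radial_weight.
  exact: (measurableT_comp (measurable_powR p)).
have F0 b' p k x : 0 <= F b' p k x by rewrite mulr_ge0 ?radial_weight_ge0 ?powR_ge0.
have Fh b' p x : 0 < p -> {homo F b' p ^~ x : i j / (i <= j)%N >-> i <= j}.
  move=> p0 i j ij; rewrite ler_wpM2l ?radial_weight_ge0//.
  by apply: ge0_ler_powR; rewrite ?nnegrE ?Y0 ?(ltW p0)//; exact: Yh.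
have Fc b' p x : 0 < p -> F b' p k x @[k --> \oo] --> radial_weight b' x * h x `^ p.
  move=> p0; apply: cvgM; first exact: cvg_cst.
  by apply: cvg_powR_nneg => //; near=> k.
have ndF b' p : 0 < p -> {homo (fun k => \int[vol N]_x (F b' p k x)%:E)%E :
    i j / (i <= j)%N >-> (i <= j)%E}.
  move=> p0 i j ij; apply: ge0_le_integral => //.
  - by move=> x _; rewrite lee_fin.
  - by apply/measurable_EFinP; exact: mF.
  - by apply/measurable_EFinP; exact: mF.
  - by move=> x _; rewrite lee_fin Fh.
apply: (@two_term_limit R _ _ en _ (fun k => \int[vol N]_x (F 2%R 2%R k x)%:E)%E
  (fun k => \int[vol N]_x (F b q k x)%:E)%E).
- by nra.
- by rewrite mulr_ge0 ?(ltW om0)// !mulr_ge0// powR_ge0.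
- by rewrite divr_gt0.
- by move=> k; apply: integral_ge0 => x _; rewrite lee_fin.
- by move=> k; apply: integral_ge0 => x _; rewrite lee_fin.
- exact: ndF.
- exact: ndF.
- by apply: integral_ge0 => x _; rewrite lee_fin mulr_ge0 ?radial_weight_ge0 ?powR_ge0.
- by apply: integral_ge0 => x _; rewrite lee_fin mulr_ge0 ?radial_weight_ge0 ?powR_ge0.
- move=> C HC; apply: (integral_le_of_monotone_approx measurableT (mF 2 2)) => //.
  + by move=> x; exact: Fh.
  + by move=> x; exact: Fc.
- move=> C HC; apply: (integral_le_of_monotone_approx measurableT (mF b q)) => //.
  + by move=> x; exact: Fh.
  + by move=> x; exact: Fc.
move=> k d X d0 X0 dle Xle.
have kV : 0 < k.+1%:R^-1 :> R by rewrite invr_gt0.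
have [_ [x0 _ <-] Sx0] := sup_adherent kV hr.
have [v0 v00 v0S] := vol_superlevel_gt0 Sx0.
have := truncated_hardy_sobolev q2 b0 bq kV v00 v0S X0 dle Xle.
rewrite -/om powRM ?invr_ge0 ?(ltW om0)//; apply: le_trans.
by rewrite le_eqVlt; apply/orP; left; apply/eqP; ring.
Unshelve. all: end_near. Qed.

End hardy_sobolev.

(** * Identification of the sharp constant *)

Section constants.
Context {R : realType}.

Lemma Gamma_ge0 (s : R) : 0 <= Gamma s.
Proof.
apply: fine_ge0; apply: integral_ge0 => t _.
by rewrite lee_fin mulr_ge0 ?powR_ge0 ?expR_ge0.
Qed.

Lemma Psi1_ge0 (p : R) : 0 < p -> 0 <= Psi p 1.
Proof.
by move=> p0; have /andP[+ _] := Psi_increment p0 (lexx 0) ler01 (lexx 1); rewrite Psi0 subr0.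
Qed.

(** Since [1/alpha = 1 - 2/q], the power [om^(1/alpha)] is [om * om^(-2/q)]. The Beta integral
    brings [4^(1 - alpha)], whose power [1/alpha] is [4^(-2/q)]; it turns [(q/2)^(2/q)] into the
    [(q/8)^(2/q)] of [bliss_const]. *)
Lemma sharp_constant_le n (q : R) : (2 < n)%N -> 2 < q ->
  let alpha := q / (q - 2) in let om := n%:R * kappa n in
  0 < om /\
  (2 * pi `^ (n%:R / 2) / Gamma (n%:R / 2)) `^ (alpha^-1)
    * (q / 2) `^ (2 / q)
    * (Gamma alpha * Gamma (alpha + 1) / Gamma (2 * alpha)) `^ (alpha^-1)
  <= om * (bliss_const q * om^-1 `^ (2 / q)).
Proof.
move=> n2 q2 alpha om; have q0 : 0 < q by lra.
have p0 : 0 < q - 2 by rewrite subr_gt0.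
have al0 : 0 < alpha by rewrite divr_gt0.
have alE : alpha = 1 + 2 / (q - 2) by rewrite /alpha; field; rewrite gt_eqF.
have al1 : 1 < alpha by rewrite alE ltrDl divr_gt0.
have alV : alpha^-1 = 1 - 2 / q by rewrite /alpha; field; rewrite !gt_eqF.
have om0 : 0 < om.
  by rewrite mulr_gt0 ?ltr0n ?(ltn_trans _ n2)//; case: n n2 @om => [//|m] _ om; exact: kappa_gt0.
have P1 := Psi1_ge0 p0; set P := Psi (q - 2) 1 in P1.
split => //.
have monoV (x y : R) : 0 <= x -> x <= y -> x `^ alpha^-1 <= y `^ alpha^-1.
  by move=> x0 xy; apply: ge0_ler_powR; rewrite ?nnegrE ?invr_ge0 ?(ltW al0)// (le_trans x0).
set A := 2 * _ / _; set G := Gamma alpha * _ / _.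
have A0 : 0 <= A by rewrite !mulr_ge0 ?invr_ge0 ?Gamma_ge0 ?powR_ge0.
have G0 : 0 <= G by rewrite !mulr_ge0 ?invr_ge0 ?Gamma_ge0.
have Ale : A <= om by exact: sphere_area_le.
have Gle : G <= alpha * (4 `^ (2 - alpha) * P).
  by apply: Gamma_ratio_le => //; rewrite alE; exact: beta_integral_Psi.
apply: (@le_trans _ _ (om `^ alpha^-1 * (q / 2) `^ (2 / q) *
    (alpha * (4 `^ (2 - alpha) * P)) `^ alpha^-1)).
  apply: ler_pM; rewrite ?mulr_ge0 ?powR_ge0 ?monoV//.
  by apply: ler_wpM2r; rewrite ?powR_ge0 ?monoV.
rewrite le_eqVlt; apply/orP; left; apply/eqP.
have four0 : 0 < 4 :> R by [].
have -> : alpha * (4 `^ (2 - alpha) * P) = 4 `^ (1 - alpha) * (alpha * (4 * P)).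
  have -> : 2 - alpha = 1 - alpha + 1 by ring.
  by rewrite powRD ?(gt_eqF four0) ?implybT// powRr1//; ring.
have aP0 : 0 <= alpha * (4 * P) by apply: mulr_ge0; [exact: ltW|exact: mulr_ge0].
rewrite [(4 `^ _ * _) `^ _](powRM _ (powR_ge0 _ _) aP0) -powRrM.
have -> : (1 - alpha) * alpha^-1 = - (2 / q).
  by rewrite mulrBl mul1r mulfV ?gt_eqF// alV; ring.
have -> : q / 2 = 4 * (q / 8) by field.
rewrite [(4 * (q / 8)) `^ _]powRM ?divr_ge0 ?(ltW q0)//.
have -> : om `^ alpha^-1 = om * om^-1 `^ (2 / q).
  rewrite -(powR_inv1 (ltW om0)) -powRrM mulN1r alV powRD ?(gt_eqF om0) ?implybT//.
  by rewrite powRr1// ltW.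
rewrite /bliss_const -/alpha -/P powRN; field.
by rewrite gt_eqF// powR_gt0.
Qed.

End constants.

(* A complex-valued Schwartz function f = u + i v is given by its real
   and imaginary parts u, v (both real Schwartz functions);
   |grad f|^2 = sum_i (d_i u)^2 + (d_i v)^2 and |f|^2 = u^2 + v^2. *)
Theorem theorem1 (R : realType) (n : nat) (q : R)
  (u v : 'rV[R]_n -> R) :
  (3 <= n)%N ->
  2 < q -> q <= (2 * n%:R) / (n%:R - 2) ->
  schwartz u -> schwartz v ->
  let qs : R := (2 * n%:R) / (n%:R - 2) in
  let alpha : R := q / (q - 2) in
  let Cq : R :=
    (2 * pi `^ (n%:R / 2) / Gamma (n%:R / 2)) `^ (alpha^-1)
    * (q / 2) `^ (2 / q)
    * (Gamma alpha * Gamma (alpha + 1) / Gamma (2 * alpha)) `^ (alpha^-1) in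
  let absf (x : 'rV[R]_n) : R := Num.sqrt (u x ^+ 2 + v x ^+ 2) in
  let grad2 (x : 'rV[R]_n) : R :=
    \sum_(i < n) (dpart1 i u x ^+ 2 + dpart1 i v x ^+ 2) in
  (intRn (fun x => (grad2 x)%:E)
   >= (((n%:R - 1) * (n%:R - 3) / 4)%:E
         * intRn (fun x => ((enorm x ^+ 2)^-1 * absf x ^+ 2)%:E)
       + Cq%:E * (intRn (fun x =>
             (enorm x `^ (- (n%:R * (qs - q) / qs)) * absf x `^ q)%:E))
             `^ (2 / q))%E)%E.

Proof.
case: n u v => [//|n] u v n2 q2 qle su sv.
set N := n.+1%:R : R; have N3 : 3 <= N by rewrite ler_nat.
have q0 : 0 < q by lra.
have nE : n.-1%:R = N - 2 :> R.
  by rewrite /N; case: n n2 {u v N qle su sv N3} => [//|[//|m]] _ /=; rewrite -!natr1; lra.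
cbv beta zeta; set qs := 2 * N / (N - 2).
have [C1 [C2 [Mh [C10 C20 hM h_decay [h_lip h_taylor]]]]] := modulus_regular su sv.
have mh := measurable_modulus su sv; have mg := measurable_gradient_norm su sv.
have h0 := modulus_ge0 u v; have g0 := gradient_norm_ge0 u v.
have wE b p : intRn (fun x => (radial_weight b x * modulus u v x `^ p)%:E) =
    (\int[vol n.+1]_x (radial_weight b x * modulus u v x `^ p)%:E)%E.
  apply: intRnE => [|x]; last by rewrite lee_fin mulr_ge0 ?radial_weight_ge0 ?powR_ge0.
  apply/measurable_EFinP; apply: measurable_funM; first exact: measurable_radial_weight.
  exact: (measurableT_comp (measurable_powR p)).
have -> : intRn (fun x => (\sum_(i < n.+1) (dpart1 i u x ^+ 2 + dpart1 i v x ^+ 2))%:E) =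
    (\int[vol n.+1]_x (gradient_norm u v x ^+ 2)%:E)%E.
  rewrite -intRnE; last 2 first.
  - by apply/measurable_EFinP; exact: measurable_funX.
  - by move=> x; rewrite lee_fin sqr_ge0.
  by congr intRn; apply/funext => x; rewrite gradient_norm_sqr.
have -> : intRn (fun x => ((enorm x ^+ 2)^-1 * Num.sqrt (u x ^+ 2 + v x ^+ 2) ^+ 2)%:E) =
    (\int[vol n.+1]_x (radial_weight 2 x * modulus u v x `^ 2)%:E)%E.
  (* The two forms of the Hardy weight agree even at the origin, where both are [0]. *)
  rewrite -wE; congr intRn; apply/funext => x.
  by rewrite /radial_weight powR_invn ?enorm_ge0// powR_mulrn.
set b := N * (qs - q) / qs.
have -> : intRn (fun x => (enorm x `^ (- b) * Num.sqrt (u x ^+ 2 + v x ^+ 2) `^ q)%:E) =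
    (\int[vol n.+1]_x (radial_weight b x * modulus u v x `^ q)%:E)%E by rewrite -wE.
have [om0 Cle] := sharp_constant_le n2 q2.
have N0 : 0 < N by exact: lt_le_trans N3.
have N2 : 0 < N - 2 by rewrite subr_gt0 (lt_le_trans _ N3)// ltr_nat.
have qs0 : 0 < qs by apply: divr_gt0 => //; exact: mulr_gt0.
have b0 : 0 <= b.
  by apply: divr_ge0; [apply: mulr_ge0; [exact: ltW|rewrite subr_ge0]|exact: ltW].
(* This holds because [N / qs = (N - 2) / 2]; the upper bound on [q] is what makes [b]
   nonnegative. *)
have bq : b + q * (n.-1%:R / 2) = N.
  have alg (M : R) : 0 < M -> 0 < M - 2 ->
      M * (2 * M / (M - 2) - q) / (2 * M / (M - 2)) + q * ((M - 2) / 2) = M.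
    by move=> M0 M2; field; rewrite !gt_eqF.
  by rewrite nE; exact: alg.
have E0 : (0 <= \int[vol n.+1]_x (gradient_norm u v x ^+ 2)%:E)%E.
  by apply: integral_ge0 => x _; rewrite lee_fin sqr_ge0.
(* An infinite energy makes the claim trivial, and [E0] excludes the value [-oo]. *)
case E : (\int[vol n.+1]_x (gradient_norm u v x ^+ 2)%:E)%E E0 => [en| |]// _; last by rewrite leey.
have en_le : (\int[vol n.+1]_x (gradient_norm u v x ^+ 2)%:E <= en%:E)%E by rewrite E.
apply: le_trans (hardy_sobolev_finite_energy n2 mh mg h0 g0 hM C10 C20 h_lip h_taylor h_decay
  en_le q2 b0 bq).
apply: leeD.
  rewrite le_eqVlt; apply/orP; left; apply/eqP; congr (_%:E * _)%E.
  by rewrite nE; field.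
by apply: lee_wpmul2r; [exact: poweR_ge0|rewrite lee_fin].
Qed.
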